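(* Let $G=(V,E)$ be a connected, locally finite, quasi-transitive, nonunimodular graph and let $p\in[0,1]$. Then for $\mathbf{P}_p$-almost every configuration $\omega$, any two distinct heavy clusters come within unit distance of each other only in a light set of vertices; that is, for any two distinct heavy clusters $C, C'$ of $\omega$, the set of vertices of $C$ that are at $G$-distance at most one from $C'$ is light.
   Context: A graph $G$ is quasi-transitive if its automorphism group $\Gamma=\mathrm{Aut}(G)$ has finitely many orbits on $V$. $\Gamma$ carries the topology of pointwise convergence (it is locally compact, and vertex stabilizers $\Gamma_v=\{\gamma\in\Gamma:\gamma v=v\}$ are compact and open). $G$ is called unimodular if $\Gamma$ is a unimodular group, and nonunimodular otherwise. Fix a Haar measure $m$ on $\Gamma$ and define the relative weight of $y$ with respect to $x$ by $\mathbf{w}^x(y)=m(\Gamma_y)/m(\Gamma_x)$ for $x,y\in V$. A set $A\subseteq V$ is light if $\sum_{y\in A}\mathbf{w}^x(y)<\infty$ and heavy if this sum is infinite; this does not depend on the reference vertex $x$. $\mathbf{P}_p$ denotes Bernoulli$(p)$ bond percolation on $G$: the probability measure on $2^E$ under which every edge is present in the configuration $\omega\in 2^E$ independently with probability $p$. Clusters are the connected components of $\omega$ (as a graph on $V$), identified with their vertex sets. *)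

(* Defs.v *)
From HB Require Import structures.
From mathcomp Require Import all_boot all_order all_algebra finmap.
From mathcomp Require Import all_classical all_reals all_analysis.

Set Implicit Arguments.
Unset Strict Implicit.
Unset Printing Implicit Defensive.

Import Order.TTheory GRing.Theory Num.Theory.
Local Open Scope classical_set_scope.
Local Open Scope ring_scope.

(** Simple graphs, possibly infinite *)

Record sgraph := SGraph {
  vertex :> choiceType;
  adj : rel vertex;
  adj_sym : symmetric adj;
  adj_irrefl : irreflexive adj
}.

Arguments adj {s}.

Definition reachable (T : Type) (e : rel T) (x y : T) : Prop :=
  exists2 s : seq T, path e x s & last x s = y.

Definition connected_graph (G : sgraph) : Prop :=
  forall x y : G, reachable adj x y.

Definition locally_finite (G : sgraph) : Prop :=
  forall x : G, finite_set [set y | adj x y].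

(* the graph distance between x and y is at most n *)
Definition gdist_le (G : sgraph) (n : nat) (x y : G) : Prop :=
  exists s : seq G, [/\ path adj x s, last x s = y & (size s <= n)%N].

(** The automorphism group, with the topology of pointwise convergence *)

Definition is_automorphism (G : sgraph) (f : G -> G) : Prop :=
  bijective f /\ forall x y, adj (f x) (f y) = adj x y.

Record aut (G : sgraph) := Aut {
  aut_fun :> G -> G;
  aut_funP : `[< is_automorphism aut_fun >]
}.

HB.instance Definition _ (G : sgraph) := [isSub for @aut_fun G].
HB.instance Definition _ (G : sgraph) := gen_eqMixin (aut G).
HB.instance Definition _ (G : sgraph) := gen_choiceMixin (aut G).

Section AutGroup.
Variable G : sgraph.
Implicit Types g h k : aut G.

Lemma autP g : is_automorphism g.
Proof. by apply/asboolP; exact: aut_funP. Qed.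

Lemma aut_ext g h : g =1 h -> g = h.
Proof. by move=> gh; apply: val_inj; apply/funext. Qed.

Lemma aut_one_subproof : `[< is_automorphism (@id G) >].
Proof. by apply/asboolP; split => //; exists id. Qed.

Definition aut_one : aut G := Aut aut_one_subproof.

Lemma aut_mul_subproof g h : `[< is_automorphism (g \o h) >].
Proof.
have [bg ag] := autP g; have [bh ah] := autP h.
by apply/asboolP; split=> [|x y]; [exact: bij_comp | rewrite /= ag ah].
Qed.

Definition aut_mul g h : aut G := Aut (aut_mul_subproof g h).

Lemma aut_inv_ex g : exists h, cancel h g /\ cancel g h.
Proof.
have [[f fg gf] ag] := autP g.
have fP : `[< is_automorphism f >].
  apply/asboolP; split=> [|x y]; first by exists g.
  by rewrite -ag !gf.
by exists (Aut fP).
Qed.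

Definition aut_inv g : aut G := sval (cid (aut_inv_ex g)).

Lemma aut_mulA : associative aut_mul.
Proof. by move=> g h k; exact: aut_ext. Qed.

Lemma aut_mul1g : left_id aut_one aut_mul.
Proof. by move=> g; exact: aut_ext. Qed.

Lemma aut_mulg1 : right_id aut_one aut_mul.
Proof. by move=> g; exact: aut_ext. Qed.

Lemma aut_mulVg : left_inverse aut_one aut_inv aut_mul.
Proof.
move=> g; apply: aut_ext => x.
by rewrite /= /aut_inv; case: cid => h /= [_ ->].
Qed.

Lemma aut_mulgV : right_inverse aut_one aut_inv aut_mul.
Proof.
move=> g; apply: aut_ext => x.
by rewrite /= /aut_inv; case: cid => h /= [-> _].
Qed.

HB.instance Definition _ := isGroup.Build (aut G)
  aut_mulA aut_mul1g aut_mulg1 aut_mulVg aut_mulgV.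

HB.instance Definition _ := isPointed.Build (aut G) aut_one.

HB.instance Definition _ := Topological.copy (aut G)
  (initial_topology
    (@aut_fun G : aut G -> {ptws G -> discrete_topology G})).

End AutGroup.

Definition orbit_of (G : sgraph) (x : G) : set G := [set g x | g in [set: aut G]].

Definition quasi_transitive (G : sgraph) : Prop :=
  finite_set [set orbit_of x | x in [set: G]].

Definition stabilizer (G : sgraph) (x : G) : set (aut G) := [set g | g x = x].

(** Haar measures on the automorphism group *)

Definition borel_aut (G : sgraph) := g_sigma_algebraType (@open (aut G)).


Section Haar.
Variables (R : realType) (G : sgraph).
Implicit Type m : {measure set (borel_aut G) -> \bar R}.

Definition left_invariant m : Prop :=
  forall (g : aut G) (A : set (borel_aut G)), measurable A ->
    m [set (g * h)%g | h in A] = m A.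

Definition right_invariant m : Prop :=
  forall (g : aut G) (A : set (borel_aut G)), measurable A ->
    m [set (h * g)%g | h in A] = m A.

(* No regularity is required: if G is connected and locally finite, then its
   automorphism group is locally compact and second countable, so that every
   Borel measure that is finite on compact sets is regular. *)
Definition haar_measure m : Prop :=
  [/\ left_invariant m,
      forall K : set (aut G), compact K -> (m K < +oo)%E &
      forall U : set (aut G), open U -> U !=set0 -> (0 < m U)%E].

End Haar.

Definition unimodular (R : realType) (G : sgraph) : Prop :=
  exists m : {measure set (borel_aut G) -> \bar R},
    haar_measure m /\ right_invariant m.

Section Weight.
Variables (R : realType) (G : sgraph) (m : {measure set (borel_aut G) -> \bar R}).

(* Stabilizers are compact and open, so both measures are positive reals when
   m is a Haar measure, and [fine] loses nothing. *)
Definition rel_weight (x y : G) : R :=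
  fine (m (stabilizer y)) / fine (m (stabilizer x)).

Definition light (x : G) (A : set G) : Prop :=
  (\esum_(y in A) (rel_weight x y)%:E < +oo)%E.

Definition heavy (x : G) (A : set G) : Prop :=
  (\esum_(y in A) (rel_weight x y)%:E = +oo)%E.

End Weight.

(** Bernoulli bond percolation *)

Definition is_edge (G : sgraph) (e : {fset G}) : Prop :=
  exists x y : G, adj x y /\ e = [fset x; y]%fset.

Definition edge (G : sgraph) := {e : {fset G} | `[< is_edge e >]}.


Definition open_event (G : sgraph) (e : edge G) : set (edge G -> bool) :=
  [set omega | omega e].

(* the product space 2^E *)
Definition config (G : sgraph) := g_sigma_algebraType (range (@open_event G)).


Definition bernoulli_percolation (R : realType) (G : sgraph) (p : R)
    (P : probability (config G) R) : Prop :=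
  (forall e : edge G, P (open_event e) = p%:E) /\
  (forall F : {fset edge G},
     P (\bigcap_(e in [set` F]) open_event e) =
     (\prod_(e <- F) P (open_event e))%E).

Definition open_adj (G : sgraph) (omega : config G) : rel G :=
  fun x y => `[< exists2 e : edge G, val e = [fset x; y]%fset & omega e >].

Definition cluster_of (G : sgraph) (omega : config G) (x : G) : set G :=
  [set y | reachable (open_adj omega) x y].

Definition is_cluster (G : sgraph) (omega : config G) (C : set G) : Prop :=
  exists x : G, C = cluster_of omega x.

(* Main.v *)
Require Import Defs.
From HB Require Import structures.
From mathcomp Require Import all_boot all_order all_algebra finmap ring lra zify.
From mathcomp Require Import all_classical all_reals all_analysis measurable_realfun.

Set Implicit Arguments.
Unset Strict Implicit.
Unset Printing Implicit Defensive.

Import Order.TTheory GRing.Theory Num.Theory.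
Local Open Scope classical_set_scope.
Local Open Scope ring_scope.

(** The idea is that a heavy contact between two clusters contains infinitely
   many vertices of weight bounded below, and that this is impossible.

   Let [w x] be the Haar measure of the stabilizer of [x]. An automorphism [g]
   scales all weights by one factor [D g], and counting automorphisms in two ways
   gives the mass transport principle ([mass_transport]) for functions that scale
   like [D]. Multiply the percolation by Lebesgue measure on a line of levels and
   call [x] visible at the level [t] if [0 < t <= w x]; automorphisms scale levels
   by [D]. Then [x] is visible for levels of measure [w x], and an invariant
   relation between visible vertices obeys mass transport. If every vertex
   receives from boundedly many senders, the expected mass that one vertex sends
   is finite, so almost surely no vertex sends to infinitely many visible vertices
   ([visible_finite]). This is used as follows.

   If the vertices of one cluster next to another have infinite total weight,
   then infinitely many of them, with their partners, have weight above some
   positive level ([heavy_meet]): otherwise the heaviest ones, finitely many,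
   would send to all others. Call such a pair of clusters meeting ([meet]).

   A vertex cannot split its cluster into three parts each of which has
   infinitely many contacts with the same other cluster ([no_split3]). Such
   vertices, called spots, are present in every arm of a spot. Delete a sparse
   random set of marked edges. A piece of a cluster that still touches the other
   one contains finitely many spots, which form a tree with fewer branchings than
   ends, so by mass transport branchings are at most a constant times as dense as
   ends. But when the marks get sparser, almost all spots become branchings, and
   the density of the ends tends to zero. Likewise, if a cluster [m] has exactly
   two neighbours on one side, then these neighbours cannot have a nonzero finite
   number of contacts, since those would send to infinitely many contacts with
   [m] ([no_selection]).

   These facts hold almost surely for all finite modifications of the
   configuration as well, when [0 < p < 1]. Suppose that meeting pairs exist with
   positive probability. Contacts between two clusters lie in one block of the
   graph, as no single vertex separates them; so some edge [e0] has with positive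
   probability a meeting pair in its block, and by ergodicity under the
   automorphisms that preserve the block ([zero_one]) with probability one, again
   for all modifications. The remaining argument ([surgery_contradiction]) is
   deterministic. Three clusters that meet [m] and are joined off [m] can be
   modified into three parts around one vertex ([no_three]), so there are at most
   two, and two of them meet each other ([neighbours_meet]). Two disjoint meeting
   pairs in one block can be joined by two disjoint paths, by Menger's theorem
   ([two_disjoint_paths]); opening one path makes the ends of the other meet, and
   so produces a square of clusters, which contains three neighbours of one
   ([no_two_pairs]). On the other hand merging a meeting pair leaves another one,
   and after merging twice one obtains a star of three pairs or two disjoint pairs,
   both of which are impossible ([no_star], [no_disjoint_pairs]).

   Hence no two clusters meet, and no two distinct ones have heavy contact. For
   [p = 0] all clusters are single vertices, and for [p = 1] there is only one. *)

(** * Reachability, infinite sets and infinite contacts of clusters *)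

Section Reach.
Variable T : eqType.
Implicit Types (e : rel T) (x y z : T).

Lemma reach_refl e x : reachable e x x.
Proof. by exists [::]. Qed.

Lemma reach1 e x y : e x y -> reachable e x y.
Proof. by move=> exy; exists [:: y] => //=; rewrite exy. Qed.

Lemma reach_trans e x y z : reachable e x y -> reachable e y z -> reachable e x z.
Proof.
move=> [s ps <-] [s' ps' <-]; exists (s ++ s'); last by rewrite last_cat.
by rewrite cat_path ps.
Qed.

Lemma reach_closed e (P : T -> Prop) x y :
  (forall u v, P u -> e u v -> P v) -> P x -> reachable e x y -> P y.
Proof.
move=> cl Px [s + <-]; elim: s x Px => //= u s IH x Px /andP[xu].
by apply: IH; exact: cl xu.
Qed.

Lemma reach_transfer e e' (P : T -> Prop) x y :
  (forall u v, P u -> e u v -> P v /\ e' u v) -> P x ->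
  reachable e x y -> reachable e' x y.
Proof.
move=> cl Px xy; suff [] : P y /\ reachable e' x y by [].
apply: (reach_closed (P := fun y => P y /\ reachable e' x y)) xy => [u v [Pu xu] uv|].
  by have [Pv uv'] := cl _ _ Pu uv; split=> //; exact: reach_trans (reach1 uv').
by split=> //; exact: reach_refl.
Qed.

Lemma reach_mono e e' x y :
  (forall u v, e u v -> e' u v) -> reachable e x y -> reachable e' x y.
Proof. by move=> sub; apply: (reach_transfer (P := fun=> True)) => // u v _ /sub. Qed.

Lemma reach_sym e x y : symmetric e -> reachable e x y -> reachable e y x.
Proof.
move=> se; apply: (reach_closed (P := fun y => reachable e y x)) => [u v ux uv|].
  by apply: reach_trans ux; apply: reach1; rewrite se.
exact: reach_refl.
Qed.

(** A walk from [P] to [Q] contains a stretch from [P] to [Q] whose inner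
   vertices avoid both sets. *)
Lemma reach_segment e (P Q : T -> Prop) x y :
  (forall z, P z -> ~ Q z) -> P x -> Q y -> reachable e x y ->
  exists u s v, [/\ P u, Q v, path e u (rcons s v) &
    forall z, z \in s -> ~ P z /\ ~ Q z].
Proof.
move=> dPQ Px Qy [s ps ls]; rewrite -{}ls in Qy.
have key : ~ Q x -> (exists u s v, [/\ P u, Q v, path e u (rcons s v) &
    forall z, z \in s -> ~ P z /\ ~ Q z]) \/
  exists s1 v, [/\ path e x (rcons s1 v), Q v &
    forall z, z \in s1 -> ~ P z /\ ~ Q z].
  elim: s x {Px} ps Qy => [|y' s IH] x //= /andP[xy ps] Qy nQx.
  have [Qy'|nQy'] := pselect (Q y').
    by right; exists [::], y'; split=> //=; rewrite xy.
  have [|[s1 [v [pv Qv hs]]]] := IH _ ps Qy nQy'; first by left.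
  have [Py'|nPy'] := pselect (P y').
    by left; exists y', s1, v.
  right; exists (y' :: s1), v; split=> //=; first by rewrite xy.
  by move=> z; rewrite inE => /orP[/eqP->|/hs].
have [//|[s1 [v [pv Qv hs]]]] := key (dPQ _ Px).
by exists x, s1, v.
Qed.

End Reach.

(** Phrased against finite lists, so that an infinite supply can be consumed one
   new point at a time. *)
Definition infinitely (T : eqType) (P : T -> Prop) : Prop :=
  forall s : seq T, exists2 x, x \notin s & P x.

Section Infinitely.
Variable T : eqType.
Implicit Types P Q : T -> Prop.

Lemma infinitely_sub P Q : (forall x, P x -> Q x) -> infinitely P -> infinitely Q.
Proof. by move=> PQ iP s; have [x xs /PQ] := iP s; exists x. Qed.

Lemma infinitely_notin P (s : seq T) : infinitely P ->
  infinitely (fun x => x \notin s /\ P x).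
Proof.
move=> iP s'; have [x] := iP (s ++ s').
by rewrite mem_cat negb_or => /andP[xs xs'] Px; exists x.
Qed.

(** The pigeonhole principle. *)
Lemma infinitely_split (I : eqType) (l : seq I) P (Q : I -> T -> Prop) :
  infinitely P -> (forall x, P x -> exists2 i, i \in l & Q i x) ->
  exists2 i, i \in l & infinitely (Q i).
Proof.
elim: l P => [|i l IH] P iP PQ.
  by have [x _ /PQ[]] := iP [::].
have [iQ|/existsNP[s ns]] := pselect (infinitely (Q i)).
  by exists i; rewrite ?mem_head.
have [|x [xs Px]|j jl iQ] := IH (fun x => x \notin s /\ P x).
- exact: infinitely_notin.
- have [j] := PQ _ Px; rewrite inE => /orP[/eqP-> Qx|]; last by exists j.
  by case: ns; exists x.
- by exists j => //; rewrite inE jl orbT.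
Qed.

Lemma infinitelyNE P : ~ infinitely P <-> exists s : seq T, forall x, P x -> x \in s.
Proof.
split=> [/existsNP[s ns]|[s Ps] iP].
  exists s => x Px; apply/negPn/negP => xs; case: ns; by exists x.
by have [x /negP xs /Ps] := iP s.
Qed.

End Infinitely.

Section Clusters.
Variables (R : realType) (G : sgraph) (w : G -> R).
Hypothesis lf : locally_finite G.
Implicit Types (o : rel G) (x y z a b m u v : G).

Lemma adjC x y : adj x y = adj y x. Proof. exact: adj_sym. Qed.

Lemma nbrs_ex x : exists s : seq G, forall y, adj x y -> y \in s.
Proof. by have /finite_seqP[s es] := lf x; exists s => y xy; have : [set` s] y by rewrite -es. Qed.

Definition nbrs x : seq G := sval (cid (nbrs_ex x)).

Lemma nbrsP x y : adj x y -> y \in nbrs x.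
Proof. by rewrite /nbrs; case: cid => s /=; exact. Qed.

(** Both ends carry the weight bound, so that a contact can be read from either
   side. *)
Definition contact o (t : R) a b x : Prop :=
  [/\ reachable o a x, t <= w x &
     exists y, [/\ adj x y, t <= w y & reachable o b y]].

(** Infinitely many contacts of weight bounded below: this is what heavy
   contact sets are reduced to. *)
Definition meet o a b : Prop :=
  ~ reachable o a b /\ exists2 t, 0 < t & infinitely (contact o t a b).

Definition substate o := symmetric o /\ forall x y, o x y -> adj x y.

Lemma contact_le o t t' a b x : t' <= t -> contact o t a b x -> contact o t' a b x.
Proof.
move=> tt [ax tx [y [xy ty bY]]]; split=> //; first exact: le_trans tx.
by exists y; split=> //; exact: le_trans ty.
Qed.

(** By local finiteness a finite set of partners could serve only finitely many
   contacts. *)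
Lemma contact_sym o t a b : infinitely (contact o t a b) -> infinitely (contact o t b a).
Proof.
move=> iab s; have [x xs [ax tx [y [xy ty bY]]]] := iab (flatten [seq nbrs y | y <- s]).
exists y.
  apply: contra xs => ys; apply/flattenP; exists (nbrs y); first exact: map_f.
  by apply: nbrsP; rewrite adjC.
by split=> //; exists x; rewrite adjC.
Qed.

Lemma meet_sym o a b : symmetric o -> meet o a b -> meet o b a.
Proof.
move=> so [nab [t t0 iab]]; split; first by move=> /(reach_sym so).
by exists t => //; exact: contact_sym.
Qed.

Lemma contact_eq o a a' b b' t x : reachable o a' a -> reachable o b' b ->
  contact o t a b x -> contact o t a' b' x.
Proof.
move=> aa bb [ax tx [y [xy ty bY]]]; split=> //; first exact: reach_trans ax.
by exists y; split=> //; exact: reach_trans bY.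
Qed.

Lemma meet_eq o a a' b b' : symmetric o -> reachable o a a' -> reachable o b b' ->
  meet o a b -> meet o a' b'.
Proof.
move=> so aa bb [nab [t t0 iab]]; split.
  by move=> ab; apply: nab; apply: reach_trans (reach_trans aa ab) _; exact: reach_sym.
exists t => //; apply: infinitely_sub iab => x; apply: contact_eq; exact: reach_sym.
Qed.

Lemma meet_mono o o' a b : (forall z, reachable o a z -> reachable o' a z) ->
  (forall z, reachable o b z -> reachable o' b z) -> ~ reachable o' a b ->
  meet o a b -> meet o' a b.
Proof.
move=> ha hb nab [_ [t t0 iab]]; split=> //; exists t => //.
apply: infinitely_sub iab => x [ax tx [y [xy ty bY]]].
by split=> //; [exact: ha|exists y; split=> //; exact: hb].
Qed.

Lemma meet_contact o a b : meet o a b ->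
  exists u v, [/\ reachable o a u, reachable o b v & adj u v].
Proof.
move=> [_ [t _ iab]]; have [x _ [ax _ [y [xy _ bY]]]] := iab [::].
by exists x, y.
Qed.

Definition isolated o z := forall z', ~~ o z z'.

Lemma isolated_reach o z z' : symmetric o -> isolated o z -> reachable o z' z -> z' = z.
Proof.
move=> so iz /(reach_sym so) [[|x s] //=]; by rewrite (negbTE (iz x)).
Qed.

Lemma meet_nisol o a b c : symmetric o -> meet o a b -> reachable o a c -> ~ isolated o c.
Proof.
move=> so ab ac ic; have [_ [t _ /(_ [:: c])[x]]] := meet_eq so ac (reach_refl o b) ab.
rewrite inE => /eqP xc [cx _ _]; apply: xc.
exact: (isolated_reach so ic (reach_sym so cx)).
Qed.

(** [close] and [link] are the finite modifications of a configuration, [delv]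
   cuts at one vertex. *)
Definition close (B : seq G) o : rel G :=
  [rel u v | [&& o u v, u \notin B & v \notin B]].
Definition link u v o : rel G :=
  [rel x y | [|| o x y, (x == u) && (y == v) | (x == v) && (y == u)]].
Definition delv o y : rel G := [rel u v | [&& o u v, u != y & v != y]].
Definition off o m : rel G :=
  [rel u v | [&& adj u v, ~~ `[< reachable o m u >] & ~~ `[< reachable o m v >]]].

Lemma close_sym B o : symmetric o -> symmetric (close B o).
Proof. by move=> so x y; rewrite /close /= so [X in _ && X]andbC. Qed.

Lemma link_sym u v o : symmetric o -> symmetric (link u v o).
Proof. by move=> so x y; rewrite /link /= so; congr (_ || _); rewrite orbC andbC [X in _ || X]andbC. Qed.

Lemma delv_sym o y : symmetric o -> symmetric (delv o y).
Proof. by move=> so u v; rewrite /delv /= so [X in _ && X]andbC. Qed.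

Lemma off_sym o m : symmetric (off o m).
Proof. by move=> x y; rewrite /off /= adjC [X in _ && X]andbC. Qed.

Lemma close_sub B o u v : close B o u v -> o u v. Proof. by case/and3P. Qed.
Lemma link_sub u v o x y : o x y -> link u v o x y. Proof. by rewrite /link /= => ->. Qed.

Lemma link_reach u v o : reachable (link u v o) u v.
Proof. by apply: reach1; rewrite /link /= !eqxx orbT. Qed.

Lemma reach_link u v o x y : reachable o x y -> reachable (link u v o) x y.
Proof. by apply: reach_mono => a b; exact: link_sub. Qed.

(** Linking an isolated vertex [u] to [c] only lengthens the cluster of [c]. *)
Lemma link_pendant o u c a b : symmetric o -> isolated o u -> ~ isolated o c ->
  a <> u -> b <> u -> reachable (link u c o) a b -> reachable o a b.
Proof.
move=> so iu nc au bu.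
have cu : c <> u by move=> cu; apply: nc; rewrite cu.
pose P z := reachable o a (if z == u then c else z).
suff cl : forall x y, P x -> link u c o x y -> P y.
  move=> ab; have : P b.
    by apply: (reach_closed cl) ab; rewrite /P (introF eqP au); exact: reach_refl.
  by rewrite /P (introF eqP bu).
rewrite /P => x y Px /or3P[oxy|/andP[/eqP xu /eqP yc]|/andP[/eqP xc /eqP yu]].
- move: Px; case: eqP => [xu|_]; first by move: oxy; rewrite xu (negbTE (iu y)).
  case: eqP => [yu|_]; first by move: oxy; rewrite yu so (negbTE (iu x)).
  by move=> ax; apply: reach_trans ax (reach1 oxy).
- by move: Px; rewrite xu yc eqxx (introF eqP cu).
- by move: Px; rewrite xc yu eqxx (introF eqP cu).
Qed.

Lemma meet_pendant o u c a b : symmetric o -> isolated o u -> ~ isolated o c ->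
  meet o a b -> meet (link u c o) a b.
Proof.
move=> so iu nc ab.
have au : a <> u by move=> au; apply: (meet_nisol so ab (reach_refl o a)); rewrite au.
have bu : b <> u.
  by move=> bu; apply: (meet_nisol so (meet_sym so ab) (reach_refl o b)); rewrite bu.
apply: meet_mono (ab) => [z|z|]; [exact: reach_link|exact: reach_link|].
by move=> /(link_pendant so iu nc au bu); case: ab.
Qed.

(** [split3] is the trifurcation of the argument: not the parts themselves are
   asked to be infinite, but their contacts with one other cluster, at the
   weight level [t]. *)
Definition arm o t b y x : Prop :=
  [/\ x != y, reachable o y x &
    infinitely (fun z => reachable (delv o y) x z /\ contact o t y b z)].
Definition split3 o t b y : Prop := [/\ t <= w y, ~ reachable o y b &
  exists x0 x1 x2, [/\ [/\ arm o t b y x0, arm o t b y x1 & arm o t b y x2],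
    ~ reachable (delv o y) x0 x1, ~ reachable (delv o y) x0 x2 &
    ~ reachable (delv o y) x1 x2]].

(** Edges that no single vertex separates: they lie in the same block of the
   graph, the largest part in which Menger's theorem yields two disjoint
   paths. *)
Definition linked (e f : G * G) : Prop := forall z, exists u v,
  [/\ u \in [:: e.1; e.2], v \in [:: f.1; f.2], u != z, v != z &
      reachable (delv adj z) u v].

End Clusters.


(** * Two disjoint paths (Menger's theorem for two paths) *)

Section Menger.
Variables (T : eqType) (h : rel T) (A : T -> Prop).
Implicit Types (B : T -> Prop) (l r s t : seq T).

(** The end [b] is kept apart from the rest of the path, as the induction below
   changes the target [B] and fixes one end. *)
Definition to_set B l b : Prop := [/\ sorted h (rcons l b), A (head b l), B b &
  forall z, z \in l -> ~ B z].

Definition apart (s s' : seq T) : Prop := forall z, z \in s -> z \in s' -> False.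

Let sorted_split l p t : sorted h (l ++ p :: t) = sorted h (rcons l p) && path h p t.
Proof.
case: l => [|x l] //=.
by rewrite cat_path /= rcons_path andbA.
Qed.

Lemma to_set_cat B B' l p t e : (forall z, B z -> B' z) -> to_set B' l p ->
  path h p (rcons t e) -> B e -> (forall z, z \in p :: t -> ~ B z) ->
  to_set B (l ++ p :: t) e.
Proof.
move=> BB [sl Al B'p nl] pt Be nt; split=> //.
- by rewrite rcons_cat rcons_cons sorted_split sl.
- by case: l Al {sl nl}.
- by move=> z; rewrite mem_cat => /orP[/nl nB /BB|/nt].
Qed.

Lemma to_set_trim B B' l b : (forall z, B z -> B' z) -> to_set B l b ->
  exists l' b', to_set B' l' b' /\ {subset rcons l' b' <= rcons l b}.
Proof.
move=> BB [sl Al Bb _].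
suff [l' [b' [t [e B'b' nl]]]] : exists l' b' t,
    [/\ rcons l b = l' ++ b' :: t, B' b' & forall z, z \in l' -> ~ B' z].
  exists l', b'; split; last by move=> z; rewrite e -cat_rcons mem_cat => ->.
  split=> //; first by move: sl; rewrite e sorted_split => /andP[].
  by case: l' e {nl} => [|z l'] e; case: l Al e {sl} => [|y l] Al [<-].
elim: l {sl Al} => [|x l [l' [b' [t [e B'b' nl]]]]].
  by exists [::], b, [::]; split=> //; exact: BB.
have [B'x|nB'x] := pselect (B' x); first by exists [::], x, (rcons l b).
exists (x :: l'), b', t; split=> //=; first by rewrite e.
by move=> z; rewrite inE => /orP[/eqP->|/nl].
Qed.

Let split_last (a : pred T) l : has a l ->
  exists l1 p l2, [/\ l = l1 ++ p :: l2, a p & ~~ has a l2].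
Proof.
elim: l => //= x l IH; have [al _|nal] := boolP (has a l).
  by have [l1 [p [l2 [-> ap n]]]] := IH al; exists (x :: l1), p, l2.
by rewrite orbF => ax; exists [::], x, l.
Qed.

(** Göring's induction: re-route at the last vertex [p] that the given path and
   a path avoiding its end have in common, enlarging the target by what
   follows [p] on both. *)
Lemma two_disjoint_paths n : forall B l b, (size l <= n)%N -> uniq (rcons l b) ->
  to_set B l b ->
  (forall z, exists l' b', to_set B l' b' /\ z \notin rcons l' b') ->
  exists l1 l2 q, [/\ to_set B l1 b, to_set B l2 q & apart (rcons l1 b) (rcons l2 q)].
Proof.
elim: n => [|n IH] B l b ln ul Pl avoid;
  have [r [c [Pr br]]] := avoid b;
  have [/split_last[r1 [p [r2 [er pl nr2]]]]|/hasPn nr] :=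
    boolP (has (mem (rcons l b)) (rcons r c)); last 1 first.
- by exists l, r, c; split=> // z zl /nr /=; rewrite zl.
- case: l ln pl {ul Pl nr2} => //= _; rewrite inE => /eqP pb.
  by move: br; rewrite er mem_cat -pb mem_head orbT.
- by exists l, r, c; split=> // z zl /nr /=; rewrite zl.
have pb : p != b.
  by apply: contra br => /eqP <-; rewrite er mem_cat mem_head orbT.
have pL : p \in l by move: pl => /=; rewrite mem_rcons inE (negbTE pb).
case: Pl => sl Al Bb nl; case: Pr => sr Ar Bc nr.
have nBp : ~ B p by exact: nl.
case/lastP: r2 er nr2 => [|r2 c'] er nr2.
  have [_ cp] : (r, c) = (r1, p) by apply: rcons_inj; rewrite er cats1.
  by case: nBp; rewrite -cp.
have [er' ec] : (r, c) = (r1 ++ p :: r2, c') by apply: rcons_inj; rewrite er rcons_cat.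
subst c'; subst r.
have {er}path_r : path h p (rcons r2 c).
  by move: sr; rewrite rcons_cat rcons_cons sorted_split => /andP[].
case/splitPr: pL sl Al nl ul ln pl nr2 => p1 p2 sl Al nl ul ln pl nr2.
have path_p : path h p (rcons p2 b).
  by move: sl; rewrite rcons_cat rcons_cons sorted_split => /andP[].
have r2P z : z \in rcons r2 c -> z \in rcons (p1 ++ p :: p2) b -> False.
  by move=> zr zp; move/hasPn: nr2 => /(_ _ zr) /=; rewrite zp.
have p1P z : z \in p1 -> z \in p :: rcons p2 b -> False.
  move=> z1 z2; move: ul; rewrite rcons_cat rcons_cons cat_uniq => /and3P[_ /hasPn/(_ _ z2)].
  by rewrite /= z1.
have pP : p \notin rcons p2 b.
  by move: ul; rewrite rcons_cat rcons_cons cat_uniq => /and3P[_ _ /=/andP[]].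
pose B' z := [\/ B z, z \in p :: p2 | z \in p :: r2].
have BB' z : B z -> B' z by move=> Bz; apply: Or31.
have mp2 z : z \in p2 -> z \in rcons p2 b by rewrite mem_rcons inE orbC => ->.
have mr2 z : z \in r2 -> z \in rcons r2 c by rewrite mem_rcons inE orbC => ->.
have mP z : z \in p :: rcons p2 b -> z \in rcons (p1 ++ p :: p2) b.
  by move=> zp; rewrite rcons_cat rcons_cons mem_cat zp orbT.
have [] := IH B' p1 p.
- by move: ln; rewrite size_cat /= addnS ltnS; apply: leq_trans; exact: leq_addr.
- by move: ul; rewrite rcons_cat rcons_cons -cat_rcons cat_uniq => /andP[].
- split=> //.
  + by move: sl; rewrite rcons_cat rcons_cons sorted_split => /andP[].
  + by case: (p1) Al.
  + by apply: Or32; exact: mem_head.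
  + move=> z z1 [Bz|zp|].
    * by apply: (nl z) => //; rewrite mem_cat z1.
    * by apply: (p1P z) => //; move: zp; rewrite !inE => /orP[->//|/mp2->]; rewrite orbT.
    * rewrite inE => /orP[/eqP zp|/mr2 zr].
        by apply: (p1P z) => //; rewrite zp mem_head.
      by apply: (r2P z zr); rewrite mem_rcons inE mem_cat z1 orbT.
- move=> z; have [l' [b' [Pl' zl']]] := avoid z.
  have [l'' [b'' [Pl'' sub]]] := to_set_trim BB' Pl'.
  by exists l'', b''; split=> //; apply: contra zl' => /sub.
move=> l1 [l2 [q [P1 P2 ap]]].
have [_ _ _ n1] := P1; have [_ _ B'q n2] := P2.
have n1B z : z \in l1 -> z \in p :: rcons p2 b -> False.
  move=> /n1 nz; rewrite inE mem_rcons inE orbCA => /orP[/eqP zb|zp].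
    by apply: nz; apply: Or31; rewrite zb.
  by apply: nz; apply: Or32; rewrite inE.
have n1C z : z \in l1 -> z \in p :: rcons r2 c -> False.
  move=> /n1 nz; rewrite inE mem_rcons inE orbCA => /orP[/eqP zb|zp].
    by apply: nz; apply: Or31; rewrite zb.
  by apply: nz; apply: Or33; rewrite inE.
have n2B z : z \in l2 -> z \in p :: rcons p2 b -> False.
  move=> /n2 nz; rewrite inE mem_rcons inE orbCA => /orP[/eqP zb|zp].
    by apply: nz; apply: Or31; rewrite zb.
  by apply: nz; apply: Or32; rewrite inE.
have n2C z : z \in l2 -> z \in p :: rcons r2 c -> False.
  move=> /n2 nz; rewrite inE mem_rcons inE orbCA => /orP[/eqP zb|zp].
    by apply: nz; apply: Or31; rewrite zb.
  by apply: nz; apply: Or33; rewrite inE.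
have qp : q != p.
  by apply/eqP => qp; apply: (ap p); rewrite ?qp mem_rcons mem_head.
have a12 z : z \in l1 -> z \in rcons l2 q -> False.
  by move=> z1; apply: ap; rewrite mem_rcons inE z1 orbT.
have a21 z : z \in l2 -> z \in rcons l1 p -> False.
  by move=> z2 z1; apply: (ap z z1); rewrite mem_rcons inE z2 orbT.
have path1 : to_set B (l1 ++ p :: p2) b.
  apply: (to_set_cat BB' P1) => // z zp; apply: nl; by rewrite mem_cat zp orbT.
have path1' : to_set B (l1 ++ p :: r2) c.
  by apply: (to_set_cat BB' P1) => // z zp; apply: nr; rewrite mem_cat zp orbT.
have toE l' u l'' v z : z \in rcons (l' ++ u :: l'') v -> z \in l' \/ z \in u :: rcons l'' v.
  by rewrite rcons_cat rcons_cons mem_cat => /orP[->|->]; [left|right].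
have [qb|nqb] := eqVneq q b.
  subst q; exists l2, (l1 ++ p :: r2), c; split=> //.
    case: P2 => s2 A2 _ _; split=> // z /n2 nz Bz; apply: nz; exact: BB'.
  move=> z zl2 /toE[z1|zr]; first exact: a12 z1 zl2.
  move: zl2; rewrite mem_rcons inE => /orP[/eqP zb|z2]; last exact: n2C z2 zr.
  move: zr; rewrite zb inE eq_sym (negbTE pb) /= => /r2P; apply.
  by rewrite mem_rcons mem_head.
have mem_split z s : z \in s -> exists a1 a2, s = a1 ++ z :: a2.
  by case/splitPr => a1 a2; exists a1, a2.
have l1p z : z \in l1 -> z \in rcons l1 p by rewrite mem_rcons inE => ->; rewrite orbT.
have [qp2|nqp2] := boolP (q \in p2).
  have [a1 [a2 e]] := mem_split _ _ qp2.
  have sub z : z \in q :: rcons a2 b -> z \in rcons p2 b.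
    by move=> zq; rewrite e rcons_cat rcons_cons mem_cat zq orbT.
  have sub' z : z \in q :: rcons a2 b -> z \in p :: rcons p2 b.
    by move=> /sub; rewrite inE orbC => ->.
  have path_q : path h q (rcons a2 b).
    by move: path_p; rewrite e rcons_cat rcons_cons cat_path /= => /and3P[].
  exists (l2 ++ q :: a2), (l1 ++ p :: r2), c; split=> //.
    apply: (to_set_cat BB' P2) => // z zq; apply: nl.
    by rewrite mem_cat inE e mem_cat zq !orbT.
  move=> z /toE[z2|zq] /toE[z1|zr].
  - by apply: (a12 z z1); rewrite mem_rcons inE z2 orbT.
  - exact: n2C z2 zr.
  - by apply: (n1B z z1); exact: sub'.
  - move: zr; rewrite inE => /orP[/eqP zp|zr].
      by move: pP; rewrite -zp (sub _ zq).
    by apply: (r2P _ zr); apply: mP; exact: sub'.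
have q2 z : z \in rcons l2 q -> z \in p :: rcons p2 b -> False.
  rewrite mem_rcons inE => /orP[/eqP->|]; last exact: n2B.
  by rewrite inE mem_rcons inE (negbTE qp) (negbTE nqb) (negbTE nqp2).
have [qr2|nqr2] := boolP (q \in r2).
  have [a1 [a2 e]] := mem_split _ _ qr2.
  have sub z : z \in q :: rcons a2 c -> z \in rcons r2 c.
    by move=> zq; rewrite e rcons_cat rcons_cons mem_cat zq orbT.
  have path_q : path h q (rcons a2 c).
    by move: path_r; rewrite e rcons_cat rcons_cons cat_path /= => /and3P[].
  exists (l1 ++ p :: p2), (l2 ++ q :: a2), c; split=> //.
    apply: (to_set_cat BB' P2) => // z zq; apply: nr.
    by rewrite mem_cat inE e mem_cat zq !orbT.
  move=> z /toE[z1|zp] /toE[z2|zq].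
  - by apply: (a12 z z1); rewrite mem_rcons inE z2 orbT.
  - by apply: (n1C z z1); rewrite inE (sub _ zq) orbT.
  - exact: n2B z2 zp.
  - by apply: (r2P z (sub _ zq)); exact: mP.
have Bq : B q.
  by case: B'q => //; rewrite inE (negbTE qp) /= ?(negbTE nqp2) ?(negbTE nqr2).
exists (l1 ++ p :: p2), l2, q; split=> //.
  by case: P2 => s2 A2 _ _; split=> // z /n2 nz Bz; apply: nz; exact: BB'.
move=> z /toE[z1|zp] z2; first exact: a12 z1 z2.
exact: q2 z2 zp.
Qed.

End Menger.


(** * Surgery on a stable family of configurations *)

(** The properties that hold almost surely, together with all their finite
   modifications, are abstracted to a family [Psi] of configurations that is
   stable under closing edges at finite sets and opening edges. What follows is
   deterministic. *)
Section Surgery.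
Variables (R : realType) (G : sgraph) (w : G -> R).
Hypothesis lf : locally_finite G.
Hypothesis w0 : forall x, 0 < w x.
Variable Psi : rel G -> Prop.
Hypothesis PsiS : forall o, Psi o -> substate o.
Hypothesis PsiC : forall B o, Psi o -> Psi (close B o).
Hypothesis PsiL : forall u v o, Psi o -> adj u v -> Psi (link u v o).
Implicit Types (o : rel G) (x y z a b m u v : G).

Local Notation meet := (meet w).
Local Notation contact := (contact w).

Let Psi_sym o : Psi o -> symmetric o. Proof. by move/PsiS => []. Qed.
Let Psi_adj o : Psi o -> forall x y, o x y -> adj x y. Proof. by move/PsiS => []. Qed.

(** Closing all edges at a finite set [B] leaves two pieces in infinite
   contact, because the clusters fall into finitely many pieces. *)
Lemma meet_close o B a b : Psi o -> meet o a b ->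
  exists a' b', [/\ a' \notin B /\ b' \notin B, reachable o a a', reachable o b b',
                    meet (close B o) a' b' & True].
Proof.
move=> Po [nab [t t0 iab]]; have so := Psi_sym Po.
pose o' := close B o.
pose reps := B ++ flatten [seq nbrs lf v | v <- B].
have rep c x : reachable o c x -> x \notin B ->
    exists2 c', c' \in c :: reps & reachable o' c' x.
  move=> cx; have : x \in B \/ exists2 c', c' \in c :: reps & reachable o' c' x.
    apply: (reach_closed (P := fun x => x \in B \/
        exists2 c', c' \in c :: reps & reachable o' c' x)) cx; last first.
      by right; exists c; [exact: mem_head|exact: reach_refl].
    move=> u v Pu uv; have [vB|vB] := boolP (v \in B); [by left|right].
    have [uB|uB] := boolP (u \in B).
      exists v; last exact: reach_refl.
      rewrite inE; apply/orP; right; rewrite mem_cat; apply/orP; right.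
      by apply/flattenP; exists (nbrs lf u); [exact: map_f|apply: nbrsP; exact: Psi_adj uv].
    case: Pu => [|[c' c's c'u]]; first by rewrite (negbTE uB).
    by exists c' => //; apply: reach_trans c'u (reach1 _); rewrite /o' /close /= uv uB vB.
  by case=> [->//|].
have [c cl ic] : exists2 c, c \in [seq (i, j) | i <- a :: reps, j <- b :: reps] &
    infinitely (fun x => [/\ reachable o' c.1 x, t <= w x, x \notin B, reachable o a x &
      exists y, [/\ adj x y, t <= w y, y \notin B, reachable o b y & reachable o' c.2 y]]).
  apply: (@infinitely_split _ _ _ (fun x => x \notin B ++ flatten [seq nbrs lf v | v <- B] /\
     contact o t a b x)); first exact: infinitely_notin.
  move=> x [xB [ax tx [y [xy ty bY]]]].
  move: xB; rewrite mem_cat negb_or => /andP[xB xN].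
  have yB : y \notin B.
    apply: contra xN => yB; apply/flattenP; exists (nbrs lf y); first exact: map_f.
    by apply: nbrsP; rewrite adjC.
  have [i il ix] := rep _ _ ax xB; have [j jl jy] := rep _ _ bY yB.
  exists (i, j); first by apply/allpairsP; exists (i, j).
  by split=> //; exists y.
have [x _ [cx tx xB ax [y [xy ty yB bY cy]]]] := ic [::].
have so' := close_sym B so.
exists x, y; split=> //; split.
  move=> xy'; apply: nab; apply: reach_trans ax _.
  apply: reach_trans (reach_sym so bY).
  by apply: reach_mono xy' => u v; exact: close_sub.
exists t => //; apply: infinitely_sub ic => x' [cx' tx' _ _ [y' [xy' ty' _ _ cy']]].
split=> //; first by apply: reach_trans cx'; exact: (reach_sym so' cx).
by exists y'; split=> //; apply: reach_trans cy'; exact: (reach_sym so' cy).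
Qed.

Lemma close_boundary o B a c : Psi o -> a \notin B -> c \in B -> reachable o a c ->
  exists u v, [/\ reachable (close B o) a u, v \in B & adj u v].
Proof.
move=> Po aB cB ac; have so := Psi_sym Po.
apply: contrapT => nex.
have cl : forall u v, reachable (close B o) a u /\ u \notin B -> o u v ->
    reachable (close B o) a v /\ v \notin B.
  move=> u v [au uB] uv; have [vB|vB] := boolP (v \in B).
    by case: nex; exists u, v; split=> //; exact: Psi_adj uv.
  by split=> //; apply: reach_trans au (reach1 _); rewrite /close /= uv uB vB.
have := reach_closed cl _ ac; rewrite cB; case=> //.
by split=> //; exact: reach_refl.
Qed.

Lemma close_same o B m : (forall z, z \in B -> ~ reachable o m z) ->
  forall z, reachable o m z <-> reachable (close B o) m z.
Proof.
move=> mB z; split; last by apply: reach_mono => u v; exact: close_sub.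
apply: (reach_transfer (P := fun z => reachable o m z)) => [u v mu uv|]; last exact: reach_refl.
have mv := reach_trans mu (reach1 uv).
split=> //; rewrite /close /= uv /=; apply/andP; split; apply/negP => /mB; exact.
Qed.

Lemma close_isolated o B z : z \in B -> isolated (close B o) z.
Proof. by move=> zB z'; rewrite /close /= zB andbF. Qed.

(** ** Growing three clusters towards a common vertex *)

(** A way of length [n] from the isolated vertex [y] to the cluster of [x],
   through isolated vertices; [iwalk] ends at the isolated vertex [u] instead.
   The length drives the induction of [no_tripod]. *)
Fixpoint walk o n y x : Prop := if n is n'.+1 then
  isolated o y /\ exists y', adj y y' /\ walk o n' y' x else reachable o x y.

Fixpoint iwalk o n y u : Prop := isolated o y /\
  if n is n'.+1 then exists y', adj y y' /\ iwalk o n' y' u else y = u.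

(** [walk_avoid] keeps off [u] and [iwalk_first] stops at its first visit of [u]:
   only such ways survive when [u] stops being isolated. *)
Fixpoint walk_avoid o u n y x : Prop := if n is n'.+1 then
  [/\ isolated o y, y <> u & exists y', adj y y' /\ walk_avoid o u n' y' x]
  else reachable o x y.

Fixpoint iwalk_first o u n y : Prop := isolated o y /\
  if n is n'.+1 then y <> u /\ exists y', adj y y' /\ iwalk_first o u n' y' else y = u.

Lemma walk_last o n y x : walk o n.+1 y x ->
  exists u c, [/\ iwalk o n y u, adj u c & reachable o x c].
Proof.
elim: n y => [|n IH] y [iy [y' [yy]]]; first by move=> /= xy'; exists y, y'.
by move=> /IH[u [c [h1 h2 h3]]]; exists u, c; split=> //; split=> //; exists y'.
Qed.

Lemma walk_cat o j n a b x : iwalk o j a b -> walk o n b x -> walk o (j + n) a x.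
Proof.
elim: j a => [|j IH] a /= [ia]; first by move=> ->.
by move=> [y' [ay /IH h]] /h{}h; split=> //; exists y'.
Qed.

Lemma iwalk_rcons o j a b c : iwalk o j a b -> isolated o c -> adj b c ->
  iwalk o j.+1 a c.
Proof.
elim: j a => [|j IH] a [ia].
  by move=> ab ic bc; subst b; split=> //; exists c.
by move=> [y' [ay h]] ic bc; split=> //; exists y'; split=> //; exact: IH.
Qed.

Lemma iwalk_rev o j a b : iwalk o j a b -> iwalk o j b a.
Proof.
elim: j a b => [|j IH] a b [ia]; first by move=> <-.
move=> [y' [ay /IH h]]; apply: iwalk_rcons h ia _; by rewrite adjC.
Qed.

(** Absorbing [u] into a cluster either leaves a way intact or shortens the ways
   that start from [u] instead. *)
Lemma walk_dich o u n y x : walk o n y x -> walk_avoid o u n y x \/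
  exists j, [/\ (j < n)%N, iwalk o j y u & walk o (n - j) u x].
Proof.
elim: n y => [|n IH] y; first by left.
move=> [iy [y' [yy h]]]; have [yu|nyu] := pselect (y = u).
  by right; exists 0; split=> //; rewrite subn0 -yu; split=> //; exists y'.
case: (IH _ h) => [h'|[j [jn hj hw]]]; first by left; split=> //; exists y'.
by right; exists j.+1; rewrite ltnS subSS; split=> //; split=> //; exists y'.
Qed.

Lemma iwalk_to_first o u n y : iwalk o n y u ->
  exists2 j, (j <= n)%N & iwalk_first o u j y.
Proof.
elim: n y => [|n IH] y [iy]; first by move=> yu; exists 0.
move=> [y' [yy /IH[j jn h]]]; have [yu|nyu] := pselect (y = u); first by exists 0.
by exists j.+1 => //; split=> //; split=> //; exists y'.
Qed.

Lemma iwalk_firstW o u n y : iwalk_first o u n y -> iwalk o n y u.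
Proof.
elim: n y => [|n IH] y [iy] //; move=> [_ [y' [yy /IH h]]]; split=> //; by exists y'.
Qed.

Section Link.
Variables (o : rel G) (u c : G).
Hypotheses (so : symmetric o) (iu : isolated o u) (nc : ~ isolated o c).

Lemma link_isolated z : isolated o z -> z <> u -> isolated (link u c o) z.
Proof.
move=> iz zu z'; rewrite /link /= (negbTE (iz z')) (introF eqP zu) /=.
by apply/negP => /andP[/eqP zc]; rewrite zc in iz.
Qed.

Lemma walk_link n y x : walk_avoid o u n y x -> walk (link u c o) n y x.
Proof.
elim: n y => [|n IH] y; first exact: reach_link.
by move=> [iy yu [y' [yy /IH h]]]; split; [exact: link_isolated|exists y'].
Qed.

Lemma iwalk_link n y x : reachable o x c -> iwalk_first o u n y -> walk (link u c o) n y x.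
Proof.
move=> xc; elim: n y => [|n IH] y [iy].
  move=> ->; apply: reach_trans (reach_link u c xc) _.
  by apply: reach_sym; [exact: link_sym|exact: link_reach].
by move=> [yu [y' [yy /IH h]]]; split; [exact: link_isolated|exists y'].
Qed.

End Link.

Hypothesis no_split3 : forall o, Psi o -> forall t y b, 0 < t -> ~ split3 w o t b y.

(* Three clusters adjacent to one isolated vertex [y] become the three parts
   around [y] once they are linked to it. *)
Let tripod_end o y m x0 x1 x2 : Psi o ->
  meet o x0 m -> meet o x1 m -> meet o x2 m ->
  ~ reachable o x0 x1 -> ~ reachable o x0 x2 -> ~ reachable o x1 x2 ->
  walk o 1 y x0 -> walk o 1 y x1 -> walk o 1 y x2 -> False.
Proof.
move=> Po m0 m1 m2 n01 n02 n12 [iy [u0 [yu0 xu0]]] [_ [u1 [yu1 xu1]]] [_ [u2 [yu2 xu2]]].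
have so := Psi_sym Po.
pose o' := link y u2 (link y u1 (link y u0 o)).
have Po' : Psi o' by do 3 (apply: PsiL => //).
have so' := Psi_sym Po'.
have oo' x z : reachable o x z -> reachable o' x z by move=> xz; do 3 apply: reach_link.
have ny x m' c : meet o x m' -> reachable o x c -> c <> y.
  by move=> mx xc cy; apply: (meet_nisol so mx xc); rewrite cy.
have dE a b : delv o' y a b = o a b.
  rewrite /o' /delv /link /=; apply/idP/idP => [|ab].
    move=> /and3P[]; case: (o a b) => //=.
    by move=> h /negbTE ay /negbTE bY; move: h; rewrite ay bY !andbF.
  rewrite ab /=; apply/andP; split; apply/eqP => e.
    by move: ab; rewrite e (negbTE (iy b)).
  by move: ab; rewrite e so (negbTE (iy a)).
have dR a b : reachable (delv o' y) a b <-> reachable o a b.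
  by split; apply: reach_mono => c d; rewrite dE.
have rchY c x : adj y c -> reachable o' y c -> reachable o x c -> reachable o' y x.
  by move=> yc rc xc; apply: reach_trans rc _; apply: oo'; exact: reach_sym.
have y0 : reachable o' y x0.
  by apply: rchY xu0 => //; do 2 (apply: reach_link); exact: link_reach.
have y1 : reachable o' y x1.
  by apply: rchY xu1 => //; apply: reach_link; exact: link_reach.
have y2 : reachable o' y x2 by apply: rchY xu2 => //; exact: link_reach.
have nym : ~ reachable o' y m.
  pose P z := [\/ z = y, reachable o x0 z, reachable o x1 z | reachable o x2 z].
  have cl : forall a b, P a -> o' a b -> P b.
    have st x a b : reachable o x a -> o a b -> reachable o x b.
      by move=> xa ab; exact: reach_trans xa (reach1 ab).
    move=> a b Pa; rewrite /o' /link /= => h.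
    case ab : (o a b).
      case: Pa => [ay|h0|h1|h2]; first by move: ab; rewrite ay (negbTE (iy b)).
      - by apply: Or42; exact: st h0 ab.
      - by apply: Or43; exact: st h1 ab.
      - by apply: Or44; exact: st h2 ab.
    move: h; rewrite ab /= -!orbA => /or4P[|||/or3P[]] /andP[/eqP ea /eqP eb]; subst.
    all: try by apply: Or41.
    - exact: Or42.
    - exact: Or43.
    - exact: Or44.
  move=> /(reach_closed cl); case; first exact: Or41.
  - by move=> my; apply: (ny m x0 m (meet_sym lf so m0) (reach_refl _ _)).
  - by case: m0.
  - by case: m1.
  - by case: m2.
have arms x t : meet o x m -> reachable o' y x -> infinitely (contact o t x m) ->
    forall t', t' <= t -> arm w o' t' m y x.
  move=> mx yx ix t' tt; split=> //.
    by apply/eqP; apply: (ny _ _ _ mx); exact: reach_refl.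
  apply: infinitely_sub ix => z /(contact_le tt)[xz tz [v [zv tv mv]]]; split; first exact/dR.
  split=> //; first by apply: reach_trans yx _; exact: oo'.
  by exists v; split=> //; exact: oo'.
have [_ [t0 t00 i0]] := m0; have [_ [t1 t10 i1]] := m1; have [_ [t2 t20 i2]] := m2.
pose t := Num.min (w y) (Num.min t0 (Num.min t1 t2)).
have tp : 0 < t by rewrite !lt_min w0 t00 t10 t20.
apply: (no_split3 Po' tp (y := y) (b := m)); split=> //; first by rewrite /t ge_min lexx.
exists x0, x1, x2; split; [split|..].
- by apply: (arms _ _ m0 y0 i0); rewrite /t !ge_min lexx !orbT.
- by apply: (arms _ _ m1 y1 i1); rewrite /t !ge_min lexx !orbT.
- by apply: (arms _ _ m2 y2 i2); rewrite /t !ge_min lexx !orbT.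
- by move/dR.
- by move/dR.
- by move/dR.
Qed.

(** Three clusters in infinite contact with [m] cannot be joined through
   isolated vertices: move the meeting point [y] until the three walks only
   share [y], absorbing the walks into the clusters on the way. *)
Lemma no_tripod N : forall o y m x0 x1 x2 n0 n1 n2, Psi o -> (n0 + n1 + n2 <= N)%N ->
  meet o x0 m -> meet o x1 m -> meet o x2 m ->
  ~ reachable o x0 x1 -> ~ reachable o x0 x2 -> ~ reachable o x1 x2 ->
  isolated o y -> walk o n0 y x0 -> walk o n1 y x1 -> walk o n2 y x2 -> False.
Proof.
elim: N => [|N IH].
  move=> o y m x0 x1 x2 [|n0] n1 n2 // Po _ m0 _ _ _ _ _ iy w0y _ _.
  exact: (meet_nisol (Psi_sym Po) m0 w0y).
have step o y m x0 x1 x2 n0 n1 n2 : Psi o -> (n0.+2 + n1 + n2 <= N.+1)%N ->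
  meet o x0 m -> meet o x1 m -> meet o x2 m ->
  ~ reachable o x0 x1 -> ~ reachable o x0 x2 -> ~ reachable o x1 x2 ->
  isolated o y -> walk o n0.+2 y x0 -> walk o n1 y x1 -> walk o n2 y x2 -> False.
  move=> Po le m0 m1 m2 n01 n02 n12 iy w0y w1y w2y; have so := Psi_sym Po.
  have [u [c [yu uc xc]]] := walk_last w0y.
  have iu : isolated o u by case: (iwalk_rev yu).
  have wu : walk o 1 u x0 by split=> //; exists c.
  have [j jn fj] := iwalk_to_first yu.
  have [jlt|] := ltnP j n0.+1.
    apply: (IH o y m x0 x1 x2 (j + 1)%N n1 n2) => //.
      by rewrite -ltnS; apply: leq_trans le; rewrite ltn_add2r ltn_add2r addn1 !ltnS.
    exact: walk_cat (iwalk_firstW fj) wu.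
  move=> jge; have {jn jge} jE : j = n0.+1 by apply/eqP; rewrite eqn_leq jn.
  subst j; have small : (1 + n1 + n2 <= N)%N.
    by rewrite -ltnS; apply: leq_trans le; rewrite !ltn_add2r.
  have [w1|[k [kn yk wk]]] := walk_dich u w1y; last first.
    apply: (IH o u m x0 x1 x2 1%N (n1 - k)%N (k + n2)%N) => //.
      by rewrite -addnA [(_ - _ + _)%N]addnA subnK ?addnA// ltnW.
    exact: walk_cat (iwalk_rev yk) w2y.
  have [w2|[k [kn yk wk]]] := walk_dich u w2y; last first.
    apply: (IH o u m x0 x1 x2 1%N (k + n1)%N (n2 - k)%N) => //.
      by rewrite -[(1 + _ + _)%N]addnA addnAC subnKC ?[(n2 + _)%N]addnC ?addnA// ltnW.
    exact: walk_cat (iwalk_rev yk) w1y.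
  have nc : ~ isolated o c by exact: meet_nisol m0 xc.
  have nu x : meet o x m -> x <> u.
    by move=> mx xu; apply: (meet_nisol so mx (reach_refl o x)); rewrite xu.
  apply: (IH (link u c o) y m x0 x1 x2 n0.+1 n1 n2) => //.
  - exact: PsiL.
  - exact: meet_pendant.
  - exact: meet_pendant.
  - exact: meet_pendant.
  - by move=> /(link_pendant so iu nc (nu _ m0) (nu _ m1)).
  - by move=> /(link_pendant so iu nc (nu _ m0) (nu _ m2)).
  - by move=> /(link_pendant so iu nc (nu _ m1) (nu _ m2)).
  - by apply: link_isolated => //; case: fj => _ [].
  - exact: iwalk_link fj.
  - exact: walk_link.
  - exact: walk_link.
move=> o y m x0 x1 x2 n0 n1 n2 Po le m0 m1 m2 n01 n02 n12 iy w0y w1y w2y.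
have so := Psi_sym Po.
case: n0 w0y le => [|[|n0]] w0y le; first exact: (meet_nisol so m0 w0y).
  case: n1 w1y le => [|[|n1]] w1y le; first exact: (meet_nisol so m1 w1y).
    case: n2 w2y le => [|[|n2]] w2y le; first exact: (meet_nisol so m2 w2y).
      exact: (tripod_end Po m0 m1 m2 n01 n02 n12 w0y w1y w2y).
    apply: (step o y m x2 x0 x1 n2 1%N 1%N) => //.
    - by rewrite -addnA addnC.
    - by move=> /(reach_sym so).
    - by move=> /(reach_sym so).
  apply: (step o y m x1 x0 x2 n1 1%N n2) => //.
  - by rewrite [(_ + 1)%N]addnC.
  - by move=> /(reach_sym so).
exact: (step o y m x0 x1 x2 n0 n1 n2).
Qed.

Lemma off_path o m x s z : path (off o m) x s -> z \in s -> ~ reachable o m z.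
Proof.
elim: s x => //= y s IH x /andP[/and3P[_ _ my] ps]; rewrite inE => /orP[/eqP->|].
  by apply/asboolPn.
exact: IH ps.
Qed.

Lemma path_iwalk o x s z : path adj x s -> (forall v, v \in x :: s -> isolated o v) ->
  z \in x :: s -> exists n, iwalk o n x z.
Proof.
elim: s x => [|y s IH] x /= => [_ h|/andP[xy ps] h].
  by rewrite inE => /eqP->; exists 0; split=> //; apply: h; exact: mem_head.
rewrite inE => /orP[/eqP->|zs].
  by exists 0; split=> //; apply: h; exact: mem_head.
have [|n hn] := IH _ ps _ zs; first by move=> v vs; apply: h; rewrite inE vs orbT.
by exists n.+1; split; [apply: h; exact: mem_head|exists y].
Qed.

Lemma off_adj o m x s : path (off o m) x s -> path adj x s.
Proof. by apply: sub_path => a b /and3P[]. Qed.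

(** Close all edges at a finite tree of paths, away from [m], that joins the three
   clusters: each leaves a piece in infinite contact with [m], and the tree now
   consists of isolated vertices, so the pieces form a tripod. *)
Lemma no_three o m x0 x1 x2 : Psi o -> meet o x0 m -> meet o x1 m -> meet o x2 m ->
  ~ reachable o x0 x1 -> ~ reachable o x0 x2 -> ~ reachable o x1 x2 ->
  reachable (off o m) x0 x1 -> reachable (off o m) x0 x2 -> False.
Proof.
move=> Po m0 m1 m2 n01 n02 n12 [s1 p1 l1] [s2 p2 l2]; have so := Psi_sym Po.
pose B := x0 :: s1 ++ s2.
have mB z : z \in B -> ~ reachable o m z.
  rewrite /B inE mem_cat => /or3P[/eqP->|/(off_path p1)//|/(off_path p2)//].
  by move=> /(reach_sym so); case: m0.
have Po' := PsiC B Po; have so' := Psi_sym Po'; set o' := close B o in Po' so'.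
have piece x : x \in B -> meet o x m -> exists x',
    [/\ reachable o x x', meet o' x' m & exists n, walk o' n x0 x'].
  move=> xB mx; have [x' [m' [[x'B m'B] xx' mm' mx' _]]] := meet_close B Po mx.
  exists x'; split=> //.
    apply: meet_eq (mx') => //; first exact: reach_refl.
    by apply: reach_sym => //; apply/(close_same mB).
  have [u [v [x'u vB uv]]] := close_boundary Po x'B xB (reach_sym so xx').
  have [n hn] : exists n, iwalk o' n x0 v.
    move: vB; rewrite /B -cat_cons mem_cat => /orP[vs|vs].
      apply: (path_iwalk (off_adj p1)) => // z zs.
      by apply: close_isolated; rewrite /B -cat_cons mem_cat zs.
    apply: (path_iwalk (off_adj p2)); last by rewrite inE vs orbT.
    move=> z zs; apply: close_isolated; rewrite /B inE mem_cat.
    by move: zs; rewrite inE => /orP[->//|->]; rewrite !orbT.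
  exists (n + 1)%N; apply: walk_cat hn _; split; first exact: close_isolated.
  by exists u; rewrite adjC.
have [|x0' [r0 m0' [n0 w0']]] := piece x0 _ m0; first exact: mem_head.
have [|x1' [r1 m1' [n1 w1']]] := piece x1 _ m1.
  by rewrite /B -cat_cons mem_cat -[X in X \in _]l1 mem_last.
have [|x2' [r2 m2' [n2 w2']]] := piece x2 _ m2.
  rewrite /B inE mem_cat -[X in X \in s2]l2 -[X in X == x0]l2.
  by have := mem_last x0 s2; rewrite inE => /orP[->//|->]; rewrite !orbT.
have sep a b a' b' : ~ reachable o a b -> reachable o a a' -> reachable o b b' ->
    ~ reachable o' a' b'.
  move=> nab aa bb ab; apply: nab; apply: reach_trans aa _.
  apply: reach_trans (reach_sym so bb).
  by apply: reach_mono ab => u v; exact: close_sub.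
apply: (no_tripod Po' (leqnn _) m0' m1' m2' _ _ _ _ w0' w1' w2').
- exact: sep n01 r0 r1.
- exact: sep n02 r0 r2.
- exact: sep n12 r1 r2.
- by apply: close_isolated; exact: mem_head.
Qed.

Fixpoint linkp u (s : seq G) o : rel G :=
  if s is z :: s' then linkp z s' (link u z o) else o.

Lemma PsiLp u s o : Psi o -> path adj u s -> Psi (linkp u s o).
Proof. by elim: s u o => //= z s IH u o Po /andP[uz /IH]; apply; exact: PsiL. Qed.

Lemma reach_linkp u s o a b : reachable o a b -> reachable (linkp u s o) a b.
Proof. by elim: s u o => //= z s IH u o ab; apply: IH; exact: reach_link. Qed.

Lemma linkp_reach u s o z : z \in u :: s -> reachable (linkp u s o) u z.
Proof.
elim: s u o => [|z' s IH] u o; first by rewrite inE => /eqP->; exact: reach_refl.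
rewrite inE => /orP[/eqP->|zs]; first exact: reach_refl.
apply: reach_trans (IH z' (link u z' o) zs).
by apply: reach_linkp; exact: link_reach.
Qed.

Lemma linkp_in u s o (P : G -> Prop) : (forall z, z \in u :: s -> P z) ->
  (forall a b, P a -> o a b -> P b) -> forall a b, P a -> linkp u s o a b -> P b.
Proof.
elim: s u o => //= z s IH u o Ps cl; apply: IH.
  by move=> v vs; apply: Ps; rewrite inE vs orbT.
move=> a b Pa /or3P[ab|/andP[_ /eqP->]|/andP[_ /eqP->]]; first exact: cl ab.
  by apply: Ps; rewrite !inE eqxx orbT.
by apply: Ps; exact: mem_head.
Qed.

Lemma linkp_out u s o (P : G -> Prop) : (forall z, z \in u :: s -> ~ P z) ->
  (forall a b, P a -> o a b -> P b) -> forall a b, P a -> linkp u s o a b -> P b.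
Proof.
elim: s u o => //= z s IH u o Ps cl; apply: IH.
  by move=> v vs; apply: Ps; rewrite inE vs orbT.
move=> a b Pa /or3P[ab|/andP[/eqP au _]|/andP[/eqP az _]]; first exact: cl ab.
  by case: (Ps u (mem_head _ _)); rewrite -au.
by case: (Ps z); rewrite -?az// !inE eqxx orbT.
Qed.

Lemma linkp_same u s o x : (forall z, z \in u :: s -> ~ reachable o x z) ->
  forall z, reachable (linkp u s o) x z <-> reachable o x z.
Proof.
move=> xs z; split; last exact: reach_linkp.
apply: (reach_closed (P := fun z => reachable o x z)); last exact: reach_refl.
apply: linkp_out => // a b xa ab; exact: reach_trans xa (reach1 ab).
Qed.

Lemma off_eq o o' m : (forall z, reachable o m z <-> reachable o' m z) -> off o m =2 off o' m.
Proof.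
by move=> h x y; rewrite /off /= (asbool_equiv_eq (h x)) (asbool_equiv_eq (h y)).
Qed.

Lemma reach_eq (e e' : rel G) x y : e =2 e' -> reachable e x y <-> reachable e' x y.
Proof. by move=> ee; split; apply: reach_mono => u v; rewrite ee. Qed.

(* A pair [x0], [x1] that is distinguished among the neighbours of [m] would
   single out the finite nonempty set of its contacts. *)
Hypothesis no_selection : forall o, Psi o -> forall m x0 x1,
  meet o x0 m -> meet o x1 m -> ~ reachable o x0 x1 -> reachable (off o m) x0 x1 ->
  (exists u v, [/\ reachable o x0 u, reachable o x1 v & adj u v]) ->
  (forall x, meet o x m -> reachable (off o m) x0 x -> reachable o x0 x \/ reachable o x1 x) ->
  meet o x0 x1.

(** Otherwise [x0] could be prolonged towards [x1] until both have a nonzero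
   finite number of contacts, a finite selection inside [x0]. *)
Lemma neighbours_meet o m x0 x1 : Psi o -> meet o x0 m -> meet o x1 m ->
  ~ reachable o x0 x1 -> reachable (off o m) x0 x1 -> meet o x0 x1.
Proof.
move=> Po m0 m1 n01 c01; have so := Psi_sym Po.
have [|||u [s [v [xu xv puv hs]]]] := reach_segment (P := fun z => reachable o x0 z)
   (Q := fun z => reachable o x1 z) _ _ _ c01; try exact: reach_refl.
  by move=> z h0 h1; apply: n01; apply: reach_trans h0 _; exact: reach_sym.
have ms z : z \in s -> ~ reachable o m z.
  by move=> zs; apply: (off_path puv); rewrite mem_rcons inE zs orbT.
pose o1 := close s o; have Po1 : Psi o1 := PsiC s Po.
have E1 x : (forall z, z \in s -> ~ reachable o x z) ->
  forall z, reachable o x z <-> reachable o1 x z by exact: close_same.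
have E10 := E1 x0 (fun z zs => (hs z zs).1); have E11 := E1 x1 (fun z zs => (hs z zs).2).
have E1m := E1 m ms.
have ps : path adj u s by have := off_adj puv; rewrite rcons_path => /andP[].
pose o2 := linkp u s o1; have Po2 : Psi o2 := PsiLp Po1 ps; have so2 := Psi_sym Po2.
have E2 x : (forall z, z \in u :: s -> ~ reachable o x z) ->
    (forall z, z \in s -> ~ reachable o x z) ->
    forall z, reachable o2 x z <-> reachable o x z.
  move=> h h' z; rewrite (E1 x h'); apply: linkp_same => z' zs; rewrite -(E1 x h').
  exact: h.
have E2m : forall z, reachable o2 m z <-> reachable o m z.
  apply: E2 => // z; rewrite inE => /orP[/eqP->|/ms//].
  by move=> mu; case: m0 => + _; apply; apply: reach_trans xu _; exact: reach_sym.
have E21 : forall z, reachable o2 x1 z <-> reachable o x1 z.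
  apply: E2 => z; last by case/hs.
  rewrite inE => /orP[/eqP->|/hs[]//] x1u.
  by apply: n01; apply: reach_trans xu _; exact: reach_sym.
have E20 z : reachable o2 x0 z -> reachable o x0 z \/ z \in s.
  apply: (reach_closed (P := fun z => reachable o x0 z \/ z \in s)); last first.
    by left; exact: reach_refl.
  apply: linkp_in => [z'|a b]; first by rewrite inE => /orP[/eqP->|]; [left|right].
  move=> [xa|zs ab]; last by have /negP := close_isolated o zs b.
  by move=> ab; left; apply: reach_trans xa (reach1 (close_sub ab)).
have m02 : meet o2 x0 m.
  apply: meet_mono (m0) => [z /E10|z /E2m//|/E20[|/ms]]; last by case; exact: reach_refl.
    exact: reach_linkp.
  by case: m0.
have m12 : meet o2 x1 m.
  by apply: meet_mono (m1) => [z /E21//|z /E2m//|/E21]; case: m1.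
have n012 : ~ reachable o2 x0 x1.
  by move=> /E20[//|/hs[_]]; case; exact: reach_refl.
have offE : off o2 m =2 off o m by apply: off_eq => z; exact: E2m.
have c012 : reachable (off o2 m) x0 x1 by apply/(reach_eq _ _ offE).
have [] : meet o2 x0 x1.
  apply: (no_selection Po2 m02 m12 n012 c012).
    exists (last u s), v; split; [|exact/E21|].
      apply: reach_trans (linkp_reach o1 (mem_last u s)).
      by apply: reach_linkp; exact/E10.
    by move: puv; rewrite rcons_path => /andP[_ /and3P[]].
  move=> x mx c0x; apply: contrapT => /not_orP[n0 n1].
  exact: (no_three Po2 m02 m12 mx n012 n0 n1 c012 c0x).
move=> _ [t t0 i]; split=> //; exists t => //.
apply: infinitely_sub (infinitely_notin s i) => x [xs [x0x tx [y [xy ty x1y]]]].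
split=> //; first by case: (E20 _ x0x) => //; rewrite (negbTE xs).
by exists y; split=> //; exact/E21.
Qed.


(** ** Two disjoint pairs of clusters in contact *)

Lemma off_meet o p q r : Psi o -> meet o q r -> ~ reachable o p q -> ~ reachable o p r ->
  reachable (off o p) q r.
Proof.
move=> Po qr npq npr; have so := Psi_sym Po; have ao := Psi_adj Po.
have inside x : ~ reachable o p x -> forall z, reachable o x z ->
    reachable (off o p) x z /\ ~ reachable o p z.
  move=> npx z xz.
  have npz a : reachable o x a -> ~ reachable o p a.
    by move=> xa pa; apply: npx; exact: reach_trans pa (reach_sym so xa).
  split; last exact: npz.
  apply: (reach_transfer (P := fun z => reachable o x z)) xz; last exact: reach_refl.
  move=> a b xa ab; have xb := reach_trans xa (reach1 ab); split=> //.
  by rewrite /off /= ao //= !asboolF//; exact: npz.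
have [u [v [qu rv uv]]] := meet_contact qr.
have [qu' npu] := inside q npq u qu; have [rv' npv] := inside r npr v rv.
apply: reach_trans qu' _; apply: reach_trans (reach_sym (off_sym o p) rv').
by apply: reach1; rewrite /off /= uv !asboolF.
Qed.

(** [p] and [r] are neighbours of [q] on the same side, hence in contact with each
   other, and [q], [r], [s] become three neighbours of [p]. *)
Lemma no_square o p q r s : Psi o ->
  meet o p q -> meet o q r -> meet o r s -> meet o s p ->
  ~ reachable o p r -> ~ reachable o q s -> False.
Proof.
move=> Po pq qr rs sp npr nqs; have so := Psi_sym Po.
have npq := pq.1; have nqr := qr.1; have nrs := rs.1.
have nps : ~ reachable o p s by move=> /(reach_sym so); case: sp.
have qp := meet_sym lf so pq; have rq := meet_sym lf so qr; have sr := meet_sym lf so rs.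
have c1 : reachable (off o p) q r by exact: off_meet.
have c2 : reachable (off o p) r s by exact: off_meet.
have c3 : reachable (off o q) p r.
  have h1 : reachable (off o q) p s.
    by apply: off_meet (meet_sym lf so sp) _ _ => // /(reach_sym so).
  by apply: reach_trans h1 _; apply: off_meet sr _ _.
have pr : meet o p r.
  by apply: neighbours_meet c3.
apply: (no_three Po qp (meet_sym lf so pr) sp nqr nqs nrs c1).
exact: reach_trans c1 c2.
Qed.

(** If disjoint paths join [a1] to [b1] and [a2] to [b2], then opening the
   former makes [a2] and [b2] two neighbours of one cluster. *)
Lemma wire o a1 a2 b1 b2 u s v : Psi o -> meet o a1 a2 -> meet o b1 b2 ->
  ~ reachable o a2 b2 -> ~ reachable o a2 b1 -> ~ reachable o a1 b2 ->
  path adj u (rcons s v) -> reachable o a1 u -> reachable o b1 v ->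
  (forall z, z \in s -> [/\ ~ reachable o a1 z, ~ reachable o a2 z,
     ~ reachable o b1 z & ~ reachable o b2 z]) ->
  (forall X : G -> Prop, (forall z, X z -> [\/ reachable o a1 z, reachable o b1 z | z \in s]) ->
     reachable [rel x y | [&& adj x y, ~~ `[< X x >] & ~~ `[< X y >]]] a2 b2) ->
  meet o a2 b2.
Proof.
move=> Po ma mb n22 n21 n12 puv au bv hs conn; have so := Psi_sym Po.
have bs z : z \in u :: rcons s v ->
    [/\ ~ reachable o a2 z, ~ reachable o b2 z &
        [\/ reachable o a1 z, reachable o b1 z | z \in s]].
  rewrite inE mem_rcons inE => /or3P[/eqP->|/eqP->|zs].
  - split; [move=> h|move=> h|exact: Or31].
      by apply: (ma.1); apply: reach_trans au (reach_sym so h).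
    by apply: n12; apply: reach_trans au (reach_sym so h).
  - split; [move=> h|move=> h|exact: Or32].
      by apply: n21; apply: reach_trans h (reach_sym so bv).
    by apply: (mb.1); apply: reach_trans bv (reach_sym so h).
  - by have [? ? ? ?] := hs _ zs; split=> //; exact: Or33.
pose o1 := close s o; have Po1 : Psi o1 := PsiC s Po.
pose o2 := linkp u (rcons s v) o1; have Po2 : Psi o2 := PsiLp Po1 puv.
have so2 := Psi_sym Po2.
have E1 x : (forall z, z \in s -> ~ reachable o x z) ->
  forall z, reachable o x z <-> reachable o1 x z by exact: close_same.
have up c : c = a1 \/ c = b1 -> forall z, reachable o c z -> reachable o2 c z.
  move=> ec z cz; apply: reach_linkp; apply/E1 => // y /hs[]; by case: ec => ->.
have E2 c : c = a2 \/ c = b2 -> forall z, reachable o2 c z <-> reachable o c z.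
  move=> ec z; have h : forall y, y \in s -> ~ reachable o c y.
    by move=> y /hs[]; case: ec => ->.
  rewrite (E1 c h); apply: linkp_same => y /bs[h1 h2 _]; rewrite -(E1 c h).
  by case: ec => ->.
pose X z := reachable o2 a1 z.
have Xs z : X z -> [\/ reachable o a1 z, reachable o b1 z | z \in s].
  apply: (reach_closed (P := fun z => [\/ reachable o a1 z, reachable o b1 z | z \in s])).
    apply: linkp_in => [y /bs[] //|a b].
    case=> [h|h|h] ab; last by have /negP := close_isolated o h b.
      by apply: Or31; apply: reach_trans h (reach1 (close_sub ab)).
    by apply: Or32; apply: reach_trans h (reach1 (close_sub ab)).
  by apply: Or31; exact: reach_refl.
have a1b1 : reachable o2 a1 b1.
  apply: reach_trans (up _ (or_introl erefl) _ au) _.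
  apply: (reach_trans (y := v)).
    by apply: linkp_reach; rewrite inE mem_rcons mem_head orbT.
  by apply: (reach_sym so2); exact: up (or_intror erefl) _ bv.
have na2 : ~ reachable o2 a2 a1 by move/(E2 _ (or_introl erefl)) => /(reach_sym so); case: ma.
have nb2 : ~ reachable o2 b2 b1 by move/(E2 _ (or_intror erefl)) => /(reach_sym so); case: mb.
have m2 : meet o2 a2 a1.
  apply: meet_mono (meet_sym lf so ma) => // z; first by move=> ?; exact/(E2 a2 (or_introl erefl)).
  exact: up (or_introl erefl) z.
have m2' : meet o2 b2 b1.
  apply: meet_mono (meet_sym lf so mb) => // z; first by move=> ?; exact/(E2 b2 (or_intror erefl)).
  exact: up (or_intror erefl) z.
have m3 : meet o2 b2 a1.
  by apply: meet_eq m2' => //; [exact: reach_refl|exact: reach_sym].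
have : meet o2 a2 b2.
  apply: neighbours_meet Po2 m2 m3 _ _; first by move/(E2 _ (or_introl erefl)).
  exact: (conn X).
by apply: meet_mono => // z; [move/(E2 a2 (or_introl erefl))|move/(E2 b2 (or_intror erefl))].
Qed.

(** A hub is a neutral meeting place: clusters touching it can be joined through
   it without hitting any cluster. *)
Definition inside (B : seq G) : rel G := [rel u v | [&& adj u v, u \in B & v \in B]].
Definition hub o (B : seq G) : Prop := (forall z, z \in B -> isolated o z) /\
  forall u v, u \in B -> v \in B -> reachable (inside B) u v.

Definition touches (B : seq G) o x : Prop :=
  exists u v, [/\ reachable o x u, v \in B & adj u v].

Section TwoPairs.
Variables (o : rel G) (B : seq G) (x1 x1' x2 x2' : G).
Hypotheses (Po : Psi o) (hB : hub o B).
Hypotheses (m1 : meet o x1 x1') (m2 : meet o x2 x2').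
Hypotheses (n12 : ~ reachable o x1 x2) (n12' : ~ reachable o x1 x2')
  (n1'2 : ~ reachable o x1' x2) (n1'2' : ~ reachable o x1' x2').
Hypotheses (t1 : touches B o x1) (t1' : touches B o x1')
  (t2 : touches B o x2) (t2' : touches B o x2').
Hypothesis unsep : forall z, exists u v, [/\ reachable o x1 u \/ reachable o x1' u,
  reachable o x2 v \/ reachable o x2' v, u != z, v != z & reachable (delv adj z) u v].

Let so := Psi_sym Po.
Let X4 := [:: x1; x1'; x2; x2'].

Let sep a b : a \in X4 -> b \in X4 -> reachable o a b -> a = b.
Proof.
have n1 := m1.1; have n2 := m2.1.
rewrite !inE => /or4P[] /eqP-> /or4P[] /eqP-> // ab; exfalso; move: ab => //; move/(reach_sym so) => //.
Qed.

(* contraction of the four clusters to single vertices *)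
Let c v := if pselect (exists2 x, x \in X4 & reachable o x v) is left h
  then s2val (cid2 h) else v.

Let cE x v : x \in X4 -> reachable o x v -> c v = x.
Proof.
move=> xX xv; rewrite /c; case: pselect => [h|[]]; last by exists x.
case: cid2 => y /= yX yv; apply: sep => //; exact: reach_trans yv (reach_sym so xv).
Qed.

Let cX x : x \in X4 -> c x = x. Proof. by move=> xX; apply: cE => //; exact: reach_refl. Qed.

Let cN v : ~ (exists2 x, x \in X4 & reachable o x v) -> c v = v.
Proof. by rewrite /c; case: pselect. Qed.

Let c_reach v : reachable o (c v) v.
Proof. by rewrite /c; case: pselect => [h|_]; [case: cid2|exact: reach_refl]. Qed.

Let c_cases v : c v \in X4 \/ c v = v.
Proof. by rewrite /c; case: pselect => [h|_]; [left; case: cid2|right]. Qed.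

Let ciso v : isolated o v -> c v = v /\ v \notin X4.
Proof.
move=> iv; have n x : x \in X4 -> ~ reachable o x v.
  move=> xX xv; move: xX iv xv; rewrite !inE => /or4P[] /eqP-> iv xv.
  - exact: (meet_nisol so m1 xv).
  - exact: (meet_nisol so (meet_sym lf so m1) xv).
  - exact: (meet_nisol so m2 xv).
  - exact: (meet_nisol so (meet_sym lf so m2) xv).
split; first by apply: cN => -[x /n].
by apply/negP => /n; apply; exact: reach_refl.
Qed.

(* the graph after contraction, in which disjoint paths cannot share a cluster *)
Let h : rel G := [rel u v | `[< exists u' v', [/\ c u' = u, c v' = v & adj u' v'] >]].

Let hsym : symmetric h.
Proof.
by move=> u v; apply/asboolP/asboolP => -[u' [v' [? ? ?]]]; exists v', u'; rewrite adjC.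
Qed.

Let hc u v : adj u v -> h (c u) (c v).
Proof. by move=> uv; apply/asboolP; exists u, v. Qed.

(* a path of the contracted graph is realised by going through the clusters *)
Let lift (L : seq G) x s : c x = x -> path h x s -> {subset x :: s <= L} ->
  reachable [rel u v | [&& adj u v, c u \in L & c v \in L]] x (last x s).
Proof.
set e := (X in reachable X).
have cls v : c v \in L -> reachable e (c v) v.
  move=> vL; have [cX4|->] := c_cases v; last exact: reach_refl.
  apply: (reach_transfer (P := fun z => reachable o (c v) z)) (c_reach v).
    move=> a b va ab; have vb := reach_trans va (reach1 ab); split=> //.
    by rewrite /e /= (Psi_adj Po ab) (cE cX4 va) (cE cX4 vb) vL.
  exact: reach_refl.
have se : symmetric e by move=> a b; rewrite /e /= adjC [X in _ && X]andbC.
elim: s x => [|y s IH] x cx /=; first by move=> _ _; exact: reach_refl.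
move=> /andP[/asboolP[u [v [cu cv uv]]] ps] sub.
have uL : c u \in L by rewrite cu; apply: sub; exact: mem_head.
have vL : c v \in L by rewrite cv; apply: sub; rewrite inE mem_head orbT.
have cy : c y = y by rewrite -cv; case: (c_cases v) => [/cX//|ev]; rewrite !ev.
apply: reach_trans (IH y cy ps _); last by move=> z zs; apply: sub; rewrite inE zs orbT.
rewrite -cu -cv; apply: reach_trans (cls u uL) _.
apply: reach_trans (reach_sym se (cls v vL)).
by apply: reach1; rewrite /e /= uv uL vL.
Qed.

Let viaB a b z : a \in X4 -> b \in X4 -> touches B o a -> touches B o b ->
  z != a -> z != b -> z \notin B -> reachable (delv h z) a b.
Proof.
move=> aX bX [u [v [au vB uv]]] [u' [v' [bu' vB' uv']]] za zb zB.
have [isoB connB] := hB.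
have sd : symmetric (delv h z) by exact: delv_sym hsym.
have nz y : y \in B -> (y != z).
  by move=> yB; apply: contraNneq zB => <-.
have st x p q : x \in X4 -> reachable o x p -> q \in B -> adj p q -> z != x ->
    delv h z x q.
  move=> xX xp qB pq zx; rewrite /delv /= eq_sym zx nz //= andbT.
  by have := hc pq; rewrite (cE xX xp) (ciso (isoB _ qB)).1.
apply: reach_trans (reach1 (st _ _ _ aX au vB uv za)) _.
apply: reach_trans (reach_sym sd (reach1 (st _ _ _ bX bu' vB' uv' zb))).
apply: reach_mono (connB _ _ vB vB') => p q /and3P[pq pB qB].
rewrite /delv /= !nz // !andbT.
by have := hc pq; rewrite (ciso (isoB _ pB)).1 (ciso (isoB _ qB)).1.
Qed.

Let A z := z \in [:: x1; x1'].
Let Bs z := z \in [:: x2; x2'].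

Let to_path a b (e : rel G) : A a -> Bs b -> reachable e a b -> (forall u v, e u v -> h u v) ->
  exists l b', to_set h A Bs l b' /\ forall v, v \in rcons l b' -> v = a \/ exists u, e u v.
Proof.
move=> Aa Bb [s ps lb] eh.
have [b' [t [t' [et Bb' nt]]]] : exists b' t t', [/\ a :: s = t ++ b' :: t', Bs b' &
    forall z, z \in t -> ~ Bs z].
  rewrite -{}lb in Bb; elim: s a {Aa} ps Bb => [|y s IH] a /=.
    by move=> _ Ba; exists a, [::], [::].
  move=> /andP[ay ps] Bb; have [Ba|nBa] := pselect (Bs a).
    by exists a, [::], (y :: s).
  have [b' [t [t' [es Bb' nt]]]] := IH y ps Bb.
  exists b', (a :: t), t'; split=> //=; first by rewrite es.
  by move=> z; rewrite inE => /orP[/eqP->|/nt].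
exists t, b'; split; first split=> //.
- have : sorted h (a :: s) by exact: sub_path ps.
  by rewrite et -cat_rcons => /cat_sorted2[].
- by case: t et {nt} => [|y t] [<-].
- move=> v vt; have {vt} : v \in a :: s by rewrite et -cat_rcons mem_cat vt.
  rewrite inE => /orP[/eqP->|vs]; [by left|right].
  elim: s a ps vs {lb et Aa} => //= y s IH a /andP[ay ps].
  by rewrite inE => /orP[/eqP->|/(IH y ps)//]; exists a.
Qed.

(* a vertex in the hub or a single cluster cannot separate: the hub leads
   around the latter, and the two pairs lie in one block *)
Let avoid z : exists l b, to_set h A Bs l b /\ z \notin rcons l b.
Proof.
have ok a b : A a -> Bs b -> z != a -> reachable (delv h z) a b ->
    exists l b, to_set h A Bs l b /\ z \notin rcons l b.
  move=> Aa Bb za /(to_path Aa Bb)[u v /and3P[]//|l [b' [hl nl]]].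
  exists l, b'; split=> //; apply/negP => /nl[/eqP|[u /and3P[_ _]]].
    by rewrite (negbTE za).
  by rewrite eqxx.
have [zx1|zx1] := eqVneq z x1.
  apply: (ok x1' x2); rewrite /A /Bs ?inE ?eqxx ?orbT //.
    by apply/eqP => e; apply: (m1.1); rewrite -zx1 e; exact: reach_refl.
  apply: viaB; rewrite ?inE ?eqxx ?orbT //.
  - by apply/eqP => e; apply: (m1.1); rewrite -zx1 e; exact: reach_refl.
  - by apply/eqP => e; apply: n12; rewrite -zx1 e; exact: reach_refl.
  - by apply/negP => /(hB.1)/ciso[_]; rewrite zx1 inE eqxx.
have [zx2|zx2] := eqVneq z x2.
  apply: (ok x1 x2'); rewrite /A /Bs ?inE ?eqxx ?orbT //.
  apply: viaB; rewrite ?inE ?eqxx ?orbT //.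
  - by apply/eqP => e; apply: (m2.1); rewrite -zx2 e; exact: reach_refl.
  - by apply/negP => /(hB.1)/ciso[_]; rewrite zx2 !inE eqxx ?orbT.
have [zB|zB] := boolP (z \in B); last first.
  apply: (ok x1 x2); rewrite /A /Bs ?inE ?eqxx ?orbT //.
  by apply: viaB; rewrite ?inE ?eqxx ?orbT.
have [cz nz] := ciso (hB.1 _ zB).
have cnz v : v != z -> c v != z.
  move=> vz; apply/eqP => e; have [cX4|ev] := c_cases v; first by rewrite e (negbTE nz) in cX4.
  by rewrite -ev e eqxx in vz.
have [u [v [u1 v2 uz vz uv]]] := unsep z.
have cu : A (c u).
  by case: u1 => r; rewrite (cE _ r) /A ?inE ?eqxx ?orbT.
have cv : Bs (c v).
  by case: v2 => r; rewrite (cE _ r) /Bs ?inE ?eqxx ?orbT.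
apply: (ok _ _ cu cv); first by rewrite eq_sym cnz.
have : reachable (delv h z) (c u) (c v); last by [].
apply: (reach_closed (P := fun v => reachable (delv h z) (c u) (c v))) uv; last exact: reach_refl.
move=> p q up /and3P[pq pz qz]; apply: reach_trans up (reach1 _).
by rewrite /delv /= hc // !cnz.
Qed.

Let disjoint_paths : exists l1 b1 l2 b2, [/\ to_set h A Bs l1 b1, to_set h A Bs l2 b2 &
  apart (rcons l1 b1) (rcons l2 b2)].
Proof.
have [l [b [[sl Al Bb nl] _]]] := avoid x1.
have [x [s es]] : exists x s, rcons l b = x :: s.
  by case: l {sl Al nl} => [|x l]; [exists b, [::]|exists x, (rcons l b)].
have hx : head b l = x by case: l es {sl Al nl} => [|y l] [].
have ls : last x s = b by rewrite -[b](last_rcons x l b) es.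
have ps : path h x s by move: sl; rewrite es.
have [s' [ps' us' sub' ls']] : exists s', [/\ path h x s', uniq (x :: s'), {subset s' <= s} &
    last x s = last x s'].
  by case: (shortenP ps) => s' ps' us' sub'; exists s'.
have [||||l1 [l2 [q [h1 h2 ap]]]] := @two_disjoint_paths _ h A (size (belast x s')) Bs
    (belast x s') (last x s'); last by exists l1, (last x s'), l2, q.
- by [].
- by rewrite -lastI.
- split; [by rewrite -lastI| |by rewrite -ls' ls|].
    by case: (s') => [|? ?] /=; move: Al; rewrite hx.
  move=> z zs Bz; move: us'; rewrite lastI rcons_uniq => /andP[nz _].
  have : z \in rcons l b by rewrite es; have := mem_belast zs; rewrite !inE => /orP[->//|/sub'->]; rewrite orbT.
  rewrite mem_rcons inE => /orP[/eqP zb|/nl//].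
  by move: zs nz; rewrite zb -ls -ls' => ->.
- exact: avoid.
Qed.

(* both paths, read in the graph itself *)
Let wire_tokens a1 a2 b1 b2 (L1 L2 : seq G) :
  perm_eq [:: a1; a2] [:: x1; x1'] -> perm_eq [:: b1; b2] [:: x2; x2'] ->
  apart L1 L2 -> a1 \in L1 -> a2 \in L2 -> b1 \in L1 -> b2 \in L2 ->
  reachable [rel u v | [&& adj u v, c u \in L1 & c v \in L1]] a1 b1 ->
  reachable [rel u v | [&& adj u v, c u \in L2 & c v \in L2]] a2 b2 ->
  meet o a1 a2 -> meet o b1 b2 -> ~ reachable o a2 b2 -> ~ reachable o a2 b1 ->
  ~ reachable o a1 b2 -> ~ reachable o a1 b1 -> meet o a2 b2.
Proof.
move=> pa pb ap a1L a2L b1L b2L r1 r2 ma mb n22 n21 n12a n11.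
have aX z : z \in [:: a1; a2] -> z \in X4.
  by rewrite (perm_mem pa) !inE => /orP[]->; rewrite ?orbT.
have bX z : z \in [:: b1; b2] -> z \in X4.
  by rewrite (perm_mem pb) !inE => /orP[]->; rewrite ?orbT.
have X1 := aX a1 (mem_head _ _); have Y1 := bX b1 (mem_head _ _).
have X2 : a2 \in X4 by apply: aX; rewrite !inE eqxx orbT.
have Y2 : b2 \in X4 by apply: bX; rewrite !inE eqxx orbT.
have [|||u [s [v [au bv puv hs]]]] := reach_segment (P := fun z => reachable o a1 z)
   (Q := fun z => reachable o b1 z) _ _ _ r1; try exact: reach_refl.
  by move=> z h0 h1; apply: n11; apply: reach_trans h0 _; exact: reach_sym.
have sL z : z \in s -> c z \in L1.
  move=> zs; have zr : z \in rcons s v by rewrite mem_rcons inE zs orbT.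
  elim: (rcons s v) u puv zr {au} => //= y t IH u /andP[/and3P[_ _ yL] pt].
  by rewrite inE => /orP[/eqP->//|]; exact: IH pt.
apply: (wire Po ma mb n22 n21 n12a (u := u) (s := s) (v := v)) => //.
- by apply: sub_path puv => x y /and3P[].
- move=> z zs; have [h0 h1] := hs _ zs; split=> // r.
    by apply: (ap (c z)); [exact: sL|rewrite (cE X2 r)].
  by apply: (ap (c z)); [exact: sL|rewrite (cE Y2 r)].
- move=> X XE; apply: reach_mono r2 => x y /and3P[xy xL yL].
  have n z : c z \in L2 -> ~ X z.
    by move=> zL /XE[r|r|/sL zL1]; apply: (ap (c z)) => //; rewrite (cE _ r).
  by rewrite /= xy !asboolF//; exact: n.
Qed.

(** Menger's theorem in the contracted graph joins the pairs by two disjoint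
   paths. Opening either one puts the ends of the other into contact ([wire]), so
   that the four clusters form a square. *)
Lemma no_two_pairs : False.
Proof.
have [l1 [b1 [l2 [b2 [P1 P2 ap]]]]] := disjoint_paths.
have tok l b : to_set h A Bs l b -> exists a, [/\ A a, a \in rcons l b &
    reachable [rel u v | [&& adj u v, c u \in rcons l b & c v \in rcons l b]] a b].
  move=> [sl Al Bb nl]; have [x [s es]] : exists x s, rcons l b = x :: s.
    by case: l {sl Al nl} => [|x l]; [exists b, [::]|exists x, (rcons l b)].
  have hx : head b l = x by case: l es {sl Al nl} => [|y l] [].
  have ls : last x s = b by rewrite -[b](last_rcons x l b) es.
  rewrite hx in Al; exists x; split=> //; first by rewrite es mem_head.
  rewrite es -[X in reachable _ _ X]ls; apply: lift; [|by move: sl; rewrite es|by []].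
  by apply: cX; move: Al; rewrite /A !inE => /orP[]->; rewrite ?orbT.
have [a1 [A1 a1L r1]] := tok _ _ P1; have [a2 [A2 a2L r2]] := tok _ _ P2.
have b1L : b1 \in rcons l1 b1 by rewrite mem_rcons mem_head.
have b2L : b2 \in rcons l2 b2 by rewrite mem_rcons mem_head.
have B1 : Bs b1 by case: P1. have B2 : Bs b2 by case: P2.
have ap' : apart (rcons l2 b2) (rcons l1 b1) by move=> z z2 z1; exact: ap z1 z2.
have a12 : a1 != a2 by apply/eqP => e; apply: (ap a1) => //; rewrite e.
have b12 : b1 != b2 by apply/eqP => e; apply: (ap b1) => //; rewrite e.
have m1' := meet_sym lf so m1; have m2' := meet_sym lf so m2.
have nc a b : A a -> Bs b -> ~ reachable o a b.
  by rewrite /A /Bs !inE => /orP[]/eqP-> /orP[]/eqP->.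
have [pa ma] : perm_eq [:: a1; a2] [:: x1; x1'] /\ meet o a1 a2.
  move: A1 A2 a12; rewrite /A !inE => /orP[]/eqP-> /orP[]/eqP->; rewrite ?eqxx // => _.
  by split=> //; rewrite (perm_catC [:: x1'] [:: x1]).
have [pb mb] : perm_eq [:: b1; b2] [:: x2; x2'] /\ meet o b1 b2.
  move: B1 B2 b12; rewrite /Bs !inE => /orP[]/eqP-> /orP[]/eqP->; rewrite ?eqxx // => _.
  by split=> //; rewrite (perm_catC [:: x2'] [:: x2]).
have ma' := meet_sym lf so ma; have mb' := meet_sym lf so mb.
have s2 : meet o a2 b2.
  by apply: (wire_tokens pa pb ap) => //; exact: nc.
have s1 : meet o a1 b1.
  apply: (wire_tokens (a1 := a2) (b1 := b2) (L1 := rcons l2 b2) (L2 := rcons l1 b1)) => //;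
    try exact: nc.
  - by rewrite (perm_catC [:: a2] [:: a1]).
  - by rewrite (perm_catC [:: b2] [:: b1]).
apply: (no_square Po ma s2 mb' (meet_sym lf so s1)); first exact: nc.
exact: nc.
Qed.

End TwoPairs.


(** ** Contradiction *)

Hypothesis G_connected : connected_graph G.
Variable e0 : G * G.
Hypothesis e0_adj : adj e0.1 e0.2.

Lemma linked_sym (e f : G * G) : linked e f -> linked f e.
Proof.
move=> ef z; have [u [v [ue vf uz vz uv]]] := ef z; exists v, u; split=> //.
by apply: reach_sym uv; apply: delv_sym; exact: adj_sym.
Qed.

Lemma linked_trans (e f g : G * G) : adj f.1 f.2 -> linked e f -> linked f g -> linked e g.
Proof.
move=> fadj ef fg z; have [u [v [ue vf uz vz uv]]] := ef z.
have [v' [x [vf' xg vz' xz vx]]] := fg z; exists u, x; split=> //.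
apply: reach_trans uv (reach_trans _ vx).
have st a b : adj a b -> a != z -> b != z -> reachable (delv adj z) a b.
  by move=> ab az bz; apply: reach1; rewrite /delv /= ab az bz.
move: vf vf' vz vz'; rewrite !inE => /orP[]/eqP-> /orP[]/eqP-> h1 h2;
  first [exact: reach_refl | exact: st | by apply: st => //; rewrite adjC].
Qed.

(** All contacts between two clusters lie in the same block: a vertex cannot
   cut both clusters. *)
Lemma linked_contact o a b u v u' v' : Psi o -> ~ reachable o a b ->
  reachable o a u -> reachable o b v -> reachable o a u' -> reachable o b v' ->
  linked (u, v) (u', v').
Proof.
move=> Po nab au bv au' bv' z; have so := Psi_sym Po.
have inn x p q : reachable o x p -> reachable o x q -> ~ reachable o x z ->
    [/\ p != z, q != z & reachable (delv adj z) p q].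
  move=> xp xq nz; have ne y : reachable o x y -> y != z.
    by move=> xy; apply/eqP => yz; apply: nz; rewrite -yz.
  split; [exact: ne|exact: ne|].
  apply: (reach_transfer (e := o) (P := fun y => reachable o x y)) => // [y y' xy yy|].
    have xy' := reach_trans xy (reach1 yy); split=> //.
    by rewrite /delv /= (Psi_adj Po yy) !ne.
  by apply: reach_trans xq; exact: reach_sym.
have [az|naz] := pselect (reachable o a z).
  have [|p q r] := inn b v v' bv bv'.
    by move=> bz; apply: nab; apply: reach_trans az _; exact: reach_sym.
  by exists v, v'; rewrite !inE !eqxx !orbT.
have [p q r] := inn a u u' au au' naz.
by exists u, u'; rewrite !inE !eqxx.
Qed.

(** By [linked_contact] one contact in the block of [e0] brings all the others
   there. *)
Definition block_meet o a b : Prop := meet o a b /\ forall u v,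
  reachable o a u -> reachable o b v -> adj u v -> linked e0 (u, v).

Lemma block_meetP o a b u v : Psi o -> meet o a b ->
  reachable o a u -> reachable o b v -> adj u v -> linked e0 (u, v) -> block_meet o a b.
Proof.
move=> Po ab au bv uv l; split=> // u' v' au' bv' uv'.
apply: linked_trans l _ => //; exact: linked_contact ab.1 au bv au' bv'.
Qed.

Lemma block_meet_sym o a b : Psi o -> block_meet o a b -> block_meet o b a.
Proof.
move=> Po ab; have [u [v [au bv uv]]] := meet_contact ab.1; have so := Psi_sym Po.
apply: (block_meetP Po (meet_sym lf so ab.1) bv au); first by rewrite adjC.
move=> z; have [x [y [xe]]] := ab.2 u v au bv uv z.
by rewrite /= !inE orbC => yf *; exists x, y; split=> //; rewrite !inE.
Qed.

Hypothesis block_meet_ex : forall o, Psi o -> exists a b, meet o a b /\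
  exists u v, [/\ reachable o a u, reachable o b v, adj u v & linked e0 (u, v)].

Lemma block_meet_exists o : Psi o -> exists a b, block_meet o a b.
Proof.
move=> Po; have [a [b [ab [u [v [au bv uv l]]]]]] := block_meet_ex Po.
by exists a, b; exact: block_meetP ab au bv uv l.
Qed.

(** Merging finitely many clusters does not use up all pairs, so there is a
   further pair, possibly with one of the merged clusters. *)
Lemma next_pair o o' (Ms : seq G) : Psi o -> Psi o' ->
  (forall x y, o x y -> o' x y) ->
  (forall x y, x \in Ms -> y \in Ms -> reachable o' x y) ->
  let D z := exists2 d, d \in Ms & reachable o d z in
  (forall x y, o' x y -> o x y \/ D x /\ D y) ->
  exists f f', [/\ block_meet o f f', ~ D f' & ~ D f \/ f \in Ms].
Proof.
move=> Po Po' oo MM D oD; have so := Psi_sym Po; have so' := Psi_sym Po'.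
have [f0 [f0' b0]] := block_meet_exists Po'.
have Dst x y : D x -> reachable o x y -> D y.
  by move=> [d dM dx] xy; exists d => //; exact: reach_trans xy.
have same x : ~ D x -> forall z, reachable o' x z -> reachable o x z.
  move=> nx z; apply: (reach_closed (P := fun z => reachable o x z)); last exact: reach_refl.
  move=> u v xu /oD[uv|[Du _]]; first exact: reach_trans xu (reach1 uv).
  by case: nx; apply: Dst Du _; exact: reach_sym.
have up x z : reachable o x z -> reachable o' x z by apply: reach_mono.
have DD x y : D x -> D y -> reachable o' x y.
  move=> [d dM dx] [d' dM' dy]; apply: reach_trans (up _ _ dy).
  by apply: reach_trans (MM _ _ dM dM'); apply: (reach_sym so'); exact: up.
have [f [f' [bf nf']]] : exists f f', block_meet o' f f' /\ ~ D f'.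
  have [Df0'|] := pselect (D f0'); last by exists f0, f0'.
  exists f0', f0; split; first exact: block_meet_sym.
  by move=> Df0; apply: b0.1.1; exact: DD.
have [[nff [t t0 ict]] lf'] := bf.
have conc d (P : G -> Prop) : (forall z, P z -> reachable o' f z) ->
    (forall z, P z -> reachable o d z) ->
    infinitely (fun x => P x /\ contact o' t f f' x) -> ~ reachable o d f' ->
    block_meet o d f'.
  move=> Pf Pd iP ndf.
  have m : meet o d f'.
    split=> //; exists t => //; apply: infinitely_sub iP => x [Px [fx tx [y [xy ty fy]]]].
    by split=> //; [exact: Pd|exists y; split=> //; exact: same].
  have [x _ [Px [fx tx [y [xy ty fy]]]]] := iP [::].
  apply: (block_meetP Po m (Pd _ Px) (same _ nf' _ fy) xy).
  exact: lf'.
have [Df|nDf] := pselect (D f).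
  have [d dM id] : exists2 d, d \in Ms &
      infinitely (fun x => reachable o d x /\ contact o' t f f' x).
    apply: (infinitely_split (P := contact o' t f f')) => // x cx; have [fx _ _] := cx.
    have xs : D x -> exists2 d, d \in Ms & reachable o d x /\ contact o' t f f' x.
      by move=> [d dM dx]; exists d.
    apply: xs.
    have [//|nDx] := pselect (D x); have xf : reachable o' x f by exact: reach_sym.
    apply: Dst Df _; apply: (reach_sym so).
    exact: same.
  exists d, f'; split=> //; last by right.
  have Dd : D d by exists d => //; exact: reach_refl.
  apply: (conc d (fun x => reachable o d x)) => //.
    by move=> z dz; apply: reach_trans (up _ _ dz); exact: DD.
  by move=> df; apply: nf'; exact: Dst df.
exists f, f'; split=> //; last by left.
apply: (conc f (fun x => reachable o f x)) => //; first by move=> z; exact: up.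
  apply: infinitely_sub ict => x cx; split=> //; case: cx => fx _ _; exact: same.
by move=> /up.
Qed.

(** A finite set is contained in a finite connected one; closing all edges at
   the latter makes it a hub. *)
Lemma hub_ex (L : seq G) : exists B, {subset L <= B} /\
  (forall o, (forall z, z \in B -> isolated o z) -> hub o B).
Proof.
pose conn B := forall u v, u \in B -> v \in B -> reachable (inside B) u v.
suff [B [LB cB]] : exists B, {subset L <= B} /\ conn B.
  by exists B; split=> // o iB; split.
have isym B : symmetric (inside B).
  by move=> x y; rewrite /inside /= adjC [X in _ && X]andbC.
elim: L => [|x L [B [LB cB]]]; first by exists [::].
case: B LB cB => [|b B] LB cB.
  exists [:: x]; split.
    by move=> z; rewrite inE => /orP[/eqP->|/LB//]; exact: mem_head.
  by move=> u v; rewrite !inE => /eqP-> /eqP->; exact: reach_refl.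
have [s ps ls] := G_connected b x; pose B' := s ++ b :: B.
have sB z : z \in b :: s -> z \in B'.
  by rewrite /B' mem_cat !inE => /orP[->|->]; rewrite ?orbT.
exists B'; split.
  move=> z; rewrite inE => /orP[/eqP->|/LB zB].
    by apply: sB; rewrite -ls; exact: mem_last.
  by rewrite /B' mem_cat zB orbT.
have fromp t c : path adj c t -> {subset c :: t <= B'} ->
    forall z, z \in c :: t -> reachable (inside B') c z.
  elim: t c => [|y t IH] c /=; first by move=> _ _ z; rewrite inE => /eqP->; exact: reach_refl.
  move=> /andP[cy pt] sub z; rewrite inE => /orP[/eqP->|zt]; first exact: reach_refl.
  have subt : {subset y :: t <= B'} by move=> v vt; apply: sub; rewrite inE vt orbT.
  apply: reach_trans (IH y pt subt z zt); apply: reach1.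
  by rewrite /inside /= cy (sub _ (mem_head _ _)) (subt _ (mem_head _ _)).
have fromb z : z \in B' -> reachable (inside B') b z.
  rewrite /B' mem_cat => /orP[zs|zB]; last first.
    apply: reach_mono (cB _ _ (mem_head _ _) zB) => u v /and3P[uv uB vB].
    by rewrite /inside /= uv !mem_cat uB vB !orbT.
  by apply: (fromp s b ps sB); rewrite inE zs orbT.
by move=> u v /fromb bu /fromb bv; apply: reach_trans (reach_sym (isym B') bu) bv.
Qed.

(* pieces of a pair of clusters after all edges at [B] are closed *)
Let close_pair o B a b : Psi o -> hub (close B o) B -> block_meet o a b -> a \in B -> b \in B ->
  exists a' b', [/\ meet (close B o) a' b', reachable o a a', reachable o b b',
    touches B (close B o) a' /\ touches B (close B o) b' &
    exists u v, [/\ reachable (close B o) a' u, reachable (close B o) b' v, adj u v &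
      linked e0 (u, v)]].
Proof.
move=> Po hB [ab lab] aB bB; have so := Psi_sym Po.
have [a' [b' [[a'B b'B] aa bb m _]]] := meet_close B Po ab.
exists a', b'; split=> //.
  have [u [v h]] := close_boundary Po a'B aB (reach_sym so aa).
  have [u' [v' h']] := close_boundary Po b'B bB (reach_sym so bb).
  by split; [exists u, v|exists u', v'].
have [u [v [au bv uv]]] := meet_contact m; exists u, v; split=> //.
have dn x z : reachable (close B o) x z -> reachable o x z.
  by apply: reach_mono => p q; exact: close_sub.
by apply: lab => //; [exact: reach_trans aa (dn _ _ au)|exact: reach_trans bb (dn _ _ bv)].
Qed.

Let sep_close o B a b a' b' : Psi o -> ~ reachable o a b -> reachable o a a' ->
  reachable o b b' -> ~ reachable (close B o) a' b'.
Proof.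
move=> Po nab aa bb ab; apply: nab; apply: reach_trans aa _.
apply: (reach_trans (y := b')); last exact: reach_sym (Psi_sym Po) bb.
by apply: reach_mono ab => u v; exact: close_sub.
Qed.

Let two_pieces o B x1 x1' x2 x2' : Psi o -> hub o B ->
  meet o x1 x1' -> meet o x2 x2' ->
  ~ reachable o x1 x2 -> ~ reachable o x1 x2' -> ~ reachable o x1' x2 ->
  ~ reachable o x1' x2' -> touches B o x1 -> touches B o x1' -> touches B o x2 ->
  touches B o x2' ->
  (exists u v, [/\ reachable o x1 u, reachable o x1' v, adj u v & linked e0 (u, v)]) ->
  (exists u v, [/\ reachable o x2 u, reachable o x2' v, adj u v & linked e0 (u, v)]) ->
  False.
Proof.
move=> Po hB m1 m2 n1 n2 n3 n4 t1 t2 t3 t4 [u [v [xu xv uv luv]]] [p [q [xp xq pq lpq]]].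
apply: (no_two_pairs Po hB m1 m2 n1 n2 n3 n4 t1 t2 t3 t4) => z.
have [a [b [ae bf az bz ab]]] := linked_trans (e := (u, v)) e0_adj (linked_sym luv) lpq z.
exists a, b; split=> //.
  by move: ae; rewrite !inE => /orP[]/eqP->; [left|right].
by move: bf; rewrite !inE => /orP[]/eqP->; [left|right].
Qed.

(** Closing the edges at a hub that contains vertices of all four clusters leaves
   two pairs of pieces touching the hub. *)
Lemma no_disjoint_pairs o c1 c1' c2 c2' : Psi o ->
  block_meet o c1 c1' -> block_meet o c2 c2' ->
  ~ reachable o c1 c2 -> ~ reachable o c1 c2' -> ~ reachable o c1' c2 ->
  ~ reachable o c1' c2' -> False.
Proof.
move=> Po b1 b2 n12 n12' n1'2 n1'2'.
have [B [LB hB]] := hub_ex [:: c1; c1'; c2; c2'].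
have Po' := PsiC B Po; have {}hB := hB _ (@close_isolated o B).
have [||y1 [y1' [m1 r1 r1' [t1 t1'] l1]]] := close_pair Po hB b1.
- by apply: LB; rewrite !inE eqxx ?orbT.
- by apply: LB; rewrite !inE eqxx ?orbT.
have [||y2 [y2' [m2 r2 r2' [t2 t2'] l2]]] := close_pair Po hB b2.
- by apply: LB; rewrite !inE eqxx ?orbT.
- by apply: LB; rewrite !inE eqxx ?orbT.
apply: (two_pieces Po' hB m1 m2 _ _ _ _ t1 t1' t2 t2' l1 l2).
- exact: sep_close n12 r1 r2.
- exact: sep_close n12' r1 r2'.
- exact: sep_close n1'2 r1' r2.
- exact: sep_close n1'2' r1' r2'.
Qed.

Let hub_off o B m x y : Psi o -> hub o B -> meet o x m -> meet o y m ->
  touches B o x -> touches B o y -> reachable (off o m) x y.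
Proof.
move=> Po [iB cB] mx my [u [v [xu vB uv]]] [u' [v' [yu vB' uv']]]; have so := Psi_sym Po.
have nB z : z \in B -> ~ reachable o m z.
  by move=> /iB iz mz; exact: (meet_nisol so (meet_sym lf so mx) mz).
have arm z p q : meet o z m -> reachable o z p -> q \in B -> adj p q ->
    reachable (off o m) z q.
  move=> mz zp qB pq.
  have nz a : reachable o z a -> ~ reachable o m a.
    by move=> za ma; case: mz => + _; apply; apply: reach_trans za (reach_sym so ma).
  apply: (reach_trans (y := p)); last by apply: reach1; rewrite /off /= pq !asboolF//; [exact: nB|exact: nz].
  apply: (reach_transfer (P := fun a => reachable o z a)) zp; last exact: reach_refl.
  move=> a b za ab; have zb := reach_trans za (reach1 ab); split=> //.
  by rewrite /off /= (Psi_adj Po ab) !asboolF//; exact: nz.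
apply: reach_trans (arm _ _ _ mx xu vB uv) _.
apply: reach_trans (reach_sym (off_sym o m) (arm _ _ _ my yu vB' uv')).
apply: reach_mono (cB _ _ vB vB') => a b /and3P[ab aB bB].
by rewrite /off /= ab !asboolF//; exact: nB.
Qed.

(** After closing the edges at a hub, [m] contributes one piece for each of the
   three pairs. Two different pieces give two disjoint pairs; a common piece has
   three neighbours that are joined through the hub, against [no_three]. *)
Lemma no_star o m x1 x2 x3 : Psi o ->
  block_meet o m x1 -> block_meet o m x2 -> block_meet o m x3 ->
  ~ reachable o x1 x2 -> ~ reachable o x1 x3 -> ~ reachable o x2 x3 -> False.
Proof.
move=> Po b1 b2 b3 n12 n13 n23; have so := Psi_sym Po.
have [B [LB hB]] := hub_ex [:: m; x1; x2; x3].
have Po' := PsiC B Po; have {}hB := hB _ (@close_isolated o B).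
have so' := Psi_sym Po'.
have inB z : z \in [:: m; x1; x2; x3] -> z \in B by exact: LB.
have [||p1 [y1 [m1 r1 s1 [t1 t1'] l1]]] := close_pair Po hB b1;
  try by apply: LB; rewrite !inE eqxx ?orbT.
have [||p2 [y2 [m2 r2 s2 [t2 t2'] l2]]] := close_pair Po hB b2;
  try by apply: LB; rewrite !inE eqxx ?orbT.
have [||p3 [y3 [m3 r3 s3 [t3 t3'] l3]]] := close_pair Po hB b3;
  try by apply: LB; rewrite !inE eqxx ?orbT.
have sepm x y p : ~ reachable o m x -> reachable o x y -> reachable o m p ->
    ~ reachable (close B o) p y /\ ~ reachable (close B o) y p.
  move=> nmx xy mp; split; first exact: sep_close nmx mp xy.
  by apply: sep_close xy mp => // /(reach_sym so).
have nm1 := b1.1.1; have nm2 := b2.1.1; have nm3 := b3.1.1.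
pose tch := touches B (close B o).
pose lnk p y := exists u v, [/\ reachable (close B o) p u, reachable (close B o) y v,
  adj u v & linked e0 (u, v)].
have two pi yi (ti : tch pi) (ti' : tch yi) (li : lnk pi yi) xi pj yj (tj : tch pj)
    (tj' : tch yj) (lj : lnk pj yj) xj :
    (~ reachable (close B o) pi pj) -> meet (close B o) pi yi -> meet (close B o) pj yj ->
    ~ reachable o xi xj -> ~ reachable o m xi -> ~ reachable o m xj ->
    reachable o m pi -> reachable o m pj -> reachable o xi yi -> reachable o xj yj -> False.
  move=> npp mi mj nx ni nj ri rj si sj.
  exact: (two_pieces Po' hB mi mj npp (sepm _ _ _ nj sj ri).1 (sepm _ _ _ ni si rj).2
     (sep_close (B := B) Po nx si sj) ti ti' tj tj' li lj).
have [p12|np12] := pselect (reachable (close B o) p1 p2); last first.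
  exact: (two _ _ t1 t1' l1 _ _ _ t2 t2' l2 _ np12 m1 m2 n12 nm1 nm2 r1 r2 s1 s2).
have [p13|np13] := pselect (reachable (close B o) p1 p3); last first.
  exact: (two _ _ t1 t1' l1 _ _ _ t3 t3' l3 _ np13 m1 m3 n13 nm1 nm3 r1 r3 s1 s3).
have q1 : meet (close B o) y1 p1 by exact: meet_sym.
have q2 : meet (close B o) y2 p1.
  apply: meet_eq (meet_sym lf so' m2) => //; [exact: reach_refl|exact: reach_sym].
have q3 : meet (close B o) y3 p1.
  apply: meet_eq (meet_sym lf so' m3) => //; [exact: reach_refl|exact: reach_sym].
apply: (no_three Po' q1 q2 q3).
- exact: sep_close n12 s1 s2.
- exact: sep_close n13 s1 s3.
- exact: sep_close n23 s2 s3.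
- exact: hub_off q1 q2 t1' t2'.
- exact: hub_off q1 q3 t1' t3'.
Qed.

Let link_D o u v (D : G -> Prop) : D u -> D v -> forall o',
  (forall x y, o' x y -> o x y \/ D x /\ D y) ->
  forall x y, link u v o' x y -> o x y \/ D x /\ D y.
Proof.
move=> Du Dv o' h x y /or3P[/h//|/andP[/eqP-> /eqP->]|/andP[/eqP-> /eqP->]]; by right.
Qed.

(** Opening a contact of one pair merges it, and [next_pair] then provides a second
   pair, disjoint from the first or sharing the cluster [m] with it. In the
   latter case merge the three clusters: the third pair either shares [m] as well
   and completes a star, or is disjoint from one of the first two. *)
Theorem surgery_contradiction o : ~ Psi o.
Proof.
move=> Po; have so := Psi_sym Po.
have [c [c' b]] := block_meet_exists Po.
have [u [v [cu cv uv]]] := meet_contact b.1.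
have Dl Ms d z : d \in Ms -> reachable o d z -> exists2 d, d \in Ms & reachable o d z.
  by exists d.
have refl x := reach_refl o x.
(* a cluster [m] in contact with two others, or two disjoint pairs *)
have [m [x1 [x2 [b1 b2 n12]]]] : exists m x1 x2,
    [/\ block_meet o m x1, block_meet o m x2 & ~ reachable o x1 x2].
  have Po1 := PsiL Po uv; have so1 := Psi_sym Po1.
  have cc' : reachable (link u v o) c c'.
    apply: reach_trans (reach_link u v cu) _; apply: reach_trans (link_reach u v o) _.
    by apply: (reach_sym so1); exact: reach_link.
  have [||f [f' [bf nf' df]]] := next_pair (Ms := [:: c; c']) Po Po1 (@link_sub _ u v o).
  - move=> x y; rewrite !inE => /orP[]/eqP-> /orP[]/eqP-> //; try exact: reach_refl.
    exact: reach_sym.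
  - apply: link_D; last by left.
      by apply: Dl cu; rewrite mem_head.
    by apply: Dl cv; rewrite !inE eqxx orbT.
  have nD a d : ~ (exists2 d, d \in [:: c; c'] & reachable o d a) ->
     d \in [:: c; c'] -> ~ reachable o d a /\ ~ reachable o a d.
    move=> na dM; split=> [da|/(reach_sym so) da]; apply: na; by exists d.
  have cM : c \in [:: c; c'] by exact: mem_head.
  have cM' : c' \in [:: c; c'] by rewrite !inE eqxx orbT.
  case: df => [nf|].
    exfalso; apply: (no_disjoint_pairs Po b bf).
    - exact: (nD _ _ nf cM).1.
    - exact: (nD _ _ nf' cM).1.
    - exact: (nD _ _ nf cM').1.
    - exact: (nD _ _ nf' cM').1.
  rewrite !inE => /orP[]/eqP ef; subst f.
    by exists c, c', f'; split=> //; exact: (nD _ _ nf' cM').1.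
  exists c', c, f'; split=> //; first exact: block_meet_sym.
  exact: (nD _ _ nf' cM).1.
have [u1 [v1 [mu1 xv1 uv1]]] := meet_contact b1.1.
have [u2 [v2 [mu2 xv2 uv2]]] := meet_contact b2.1.
have Po1 := PsiL Po uv1; have Po2 := PsiL Po1 uv2; set o2 := link _ _ _ in Po2.
have so2 := Psi_sym Po2.
have up x y : reachable o x y -> reachable o2 x y by move=> xy; do 2 apply: reach_link.
have mx1 : reachable o2 m x1.
  apply: reach_trans (up _ _ mu1) _; apply: (reach_trans (y := v1)).
    by apply: reach_link; exact: link_reach.
  by apply: (reach_sym so2); exact: up.
have mx2 : reachable o2 m x2.
  apply: reach_trans (up _ _ mu2) _; apply: reach_trans (link_reach _ _ _) _.
  by apply: (reach_sym so2); exact: up.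
have mM d : d \in [:: m; x1; x2] -> reachable o2 m d.
  by rewrite !inE => /or3P[]/eqP->; [exact: reach_refl| |].
have [|||f [f' [bf nf' df]]] := next_pair (Ms := [:: m; x1; x2]) Po Po2.
- by move=> x y xy; do 2 apply: link_sub.
- by move=> x y /mM mx /mM my; apply: reach_trans (reach_sym so2 mx) my.
- apply: link_D; last apply: link_D; last by left.
  + by apply: Dl mu2; rewrite mem_head.
  + by apply: Dl xv2; rewrite !inE eqxx !orbT.
  + by apply: Dl mu1; rewrite mem_head.
  + by apply: Dl xv1; rewrite !inE eqxx !orbT.
have nD a d : ~ (exists2 d, d \in [:: m; x1; x2] & reachable o d a) ->
    d \in [:: m; x1; x2] -> ~ reachable o d a /\ ~ reachable o a d.
  move=> na dM; split=> [da|/(reach_sym so) da]; apply: na; by exists d.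
have M0 : m \in [:: m; x1; x2] by exact: mem_head.
have M1 : x1 \in [:: m; x1; x2] by rewrite !inE eqxx orbT.
have M2 : x2 \in [:: m; x1; x2] by rewrite !inE eqxx !orbT.
have nm1 := b1.1.1; have nm2 := b2.1.1.
have n21 : ~ reachable o x2 x1 by move/(reach_sym so).
have nm1' : ~ reachable o x1 m by move/(reach_sym so).
have nm2' : ~ reachable o x2 m by move/(reach_sym so).
case: df => [nf|].
  apply: (no_disjoint_pairs Po b1 bf).
  - exact: (nD _ _ nf M0).1.
  - exact: (nD _ _ nf' M0).1.
  - exact: (nD _ _ nf M1).1.
  - exact: (nD _ _ nf' M1).1.
rewrite !inE => /or3P[]/eqP ef; subst f.
- apply: (no_star Po b1 b2 bf n12); first exact: (nD _ _ nf' M1).1.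
  exact: (nD _ _ nf' M2).1.
- apply: (no_disjoint_pairs Po b2 bf) => //; first exact: (nD _ _ nf' M0).1.
  exact: (nD _ _ nf' M2).1.
- apply: (no_disjoint_pairs Po b1 bf) => //; first exact: (nD _ _ nf' M0).1.
  exact: (nD _ _ nf' M1).1.
Qed.

End Surgery.

(** * Sums over countable types *)

Section CountableSums.
Variables (R : realType) (I : choiceType).
Hypothesis cI : countable [set: I].
Implicit Types (a : I -> \bar R).

(* Series are indexed by natural numbers, so sums over a countable type are
   transferred along an injective numbering. *)
Lemma code_ex : exists f : I -> nat, injective f.
Proof.
have /countable_injP[f fi] := cI; exists f => x y xy.
by apply: fi => //; rewrite inE.
Qed.

Definition code : I -> nat := sval (cid code_ex).

Lemma code_inj : injective code.
Proof. by rewrite /code; case: cid. Qed.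

Definition decode (n : nat) : option I :=
  if pselect (exists x, code x = n) is left h then Some (sval (cid h)) else None.

Lemma codeK x : decode (code x) = Some x.
Proof.
rewrite /decode; case: pselect => [h|[]]; last by exists x.
by case: cid => y /= /code_inj->.
Qed.

Lemma decodeP n x : decode n = Some x -> code x = n.
Proof. by rewrite /decode; case: pselect => // h [<-]; case: cid. Qed.

Lemma esum_series a : (forall x, 0 <= a x)%E ->
  (\esum_(x in [set: I]) a x = \sum_(0 <= n <oo) (if decode n is Some x then a x else 0))%E.
Proof.
move=> a0; rewrite nneseries_esumT; last by move=> n; case: decode.
pose F n := (if decode n is Some x then a x else 0)%E.
have bij : set_bij [set: I] [set code x | x in [set: I]] code.
  by split=> [x _|x y _ _ /code_inj//|n [x _ <-]]; exists x.
have -> : (\esum_(x in [set: I]) a x = \esum_(n in [set code x | x in [set: I]]) F n)%E.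
  by rewrite (reindex_esum _ _ _ _ bij); apply: eq_esum => x _; rewrite /F codeK.
rewrite [RHS](esumID [set code x | x in [set: I]]); last by move=> n _; case: decode.
rewrite setTI [X in (_ + X)%E]esum1 ?adde0// => n [_ nI].
by case e : decode => [x|//]; case: nI; exists x => //; exact: decodeP.
Qed.

Lemma measure_esum d (T : measurableType d) (mu : {measure set T -> \bar R})
    (A : I -> set T) : (forall x, measurable (A x)) ->
  (forall x y t, A x t -> A y t -> x = y) ->
  mu (\bigcup_x A x) = (\esum_(x in [set: I]) mu (A x))%E.
Proof.
move=> mA dA; rewrite esum_series//.
pose A' n := if decode n is Some x then A x else set0.
have -> : \bigcup_x A x = \bigcup_n A' n.
  apply/seteqP; split=> t [x _]; first by exists (code x) => //; rewrite /A' codeK.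
  by rewrite /A'; case e : decode => [y|//] ?; exists y.
rewrite measure_bigcup//.
- apply: congr_lim; apply/funext => k; rewrite big_mkcond; apply: eq_bigr => n _; rewrite mem_setT /A'; by case: decode => //; rewrite measure0.
- by move=> n _; rewrite /A'; case: decode.
apply/trivIsetP => i j _ _ /eqP ij; apply/seteqP; split=> // t []; rewrite /A'.
case ei : (decode i) => [x|//]; case ej : (decode j) => [y|//] xt yt; apply: ij.
by rewrite -(decodeP ei) -(decodeP ej) (dA _ _ _ xt yt).
Qed.

Lemma esum_integral d (T : measurableType d) (mu : {measure set T -> \bar R})
    (f : I -> T -> \bar R) : (forall x, measurable_fun setT (f x)) ->
  (forall x t, 0 <= f x t)%E ->
  (\int[mu]_t (\esum_(x in [set: I]) f x t) = \esum_(x in [set: I]) (\int[mu]_t f x t))%E.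
Proof.
move=> mf f0; rewrite esum_series => [|x]; last exact: integral_ge0.
under eq_integral do rewrite esum_series//.
rewrite integral_nneseries//.
- apply: congr_lim; apply/funext => k; apply: eq_bigr => n _; by case: decode => // ; rewrite integral0.
- by move=> n; case: decode.
- by move=> n t _; case: decode.
Qed.

Lemma measurable_esum d (T : measurableType d) (f : I -> T -> \bar R) :
  (forall x, measurable_fun setT (f x)) -> (forall x t, 0 <= f x t)%E ->
  measurable_fun setT (fun t => \esum_(x in [set: I]) f x t)%E.
Proof.
move=> mf f0.
under eq_fun do rewrite esum_series//.
apply: ge0_emeasurable_sum => [n t _ _|n _]; first by case: decode.
by case: decode.
Qed.

Lemma esum_ae d (T : measurableType d) (mu : {measure set T -> \bar R})
    (f : I -> T -> \bar R) : (forall x, measurable_fun setT (f x)) ->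
  (forall x t, 0 <= f x t)%E -> (\esum_(x in [set: I]) (\int[mu]_t f x t) < +oo)%E ->
  {ae mu, forall t, (\esum_(x in [set: I]) f x t < +oo)%E}.
Proof.
move=> mf f0 fin.
have s0 t : (0 <= \esum_(x in [set: I]) f x t)%E by apply: esum_ge0.
have int : mu.-integrable setT (fun t => \esum_(x in [set: I]) f x t)%E.
  apply/integrableP; split; first exact: measurable_esum.
  under eq_integral do rewrite gee0_abs//.
  by rewrite esum_integral.
have := integrable_ae measurableT int; apply: filterS => t /(_ Logic.I).
by rewrite ge0_fin_numE.
Qed.

Lemma esum_finite a (P : I -> Prop) : (forall x, 0 <= a x)%E ->
  (\esum_(x in [set: I]) a x < +oo)%E -> (forall x, P x -> 1 <= a x)%E -> ~ infinitely P.
Proof.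
move=> a0 fin P1 iP.
have big n : exists s : seq I, [/\ uniq s, size s = n & forall x, x \in s -> P x].
  elim: n => [|n [s [us ss sP]]]; first by exists [::].
  have [x xs Px] := iP s; exists (x :: s); split=> /=; rewrite ?xs ?ss// => y.
  by rewrite inE => /orP[/eqP->|/sP].
have ge n : (n%:R%:E <= \esum_(x in [set: I]) a x)%E.
  have [s [us ss sP]] := big n.
  apply: esum_ge; exists [set` s]; first by split=> //; exact: finite_seq.
  rewrite -fsbig_seq//= -ss -(count_predT s) -[in X in (X <= _)%E]sum1_count natr_sum -sumEFin.
  by rewrite big_seq [leRHS]big_seq; apply: lee_sum => i /sP/P1.
move: (ge) fin; case: (\esum_(_ in _) _)%E => [r|/(_ 0)//|//] {}ge _; last first.
  by have := ge 0; rewrite leeNy_eq.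
have := ge (Num.bound r); rewrite lee_fin leNgt => /negP; apply.
by apply: le_lt_trans (ler_norm r) _; rewrite /Num.bound -[in ltRHS]normr_id archi_boundP.
Qed.

End CountableSums.

Section SumAlgebra.
Variables (R : realType) (I : choiceType).
Hypothesis cI : countable [set: I].

Lemma esumZ (c : R) (a : I -> \bar R) : 0 <= c -> (forall x, 0 <= a x)%E ->
  (\esum_(x in [set: I]) (c%:E * a x) = c%:E * \esum_(x in [set: I]) a x)%E.
Proof.
move=> c0 a0; rewrite !esum_series//; last by move=> x; rewrite mule_ge0.
rewrite -nneseriesZl; last by move=> n _; case: decode.
apply: congr_lim; apply/funext => k; apply: eq_bigr => n _.
by case: decode => //; rewrite mule0.
Qed.

Lemma esum_swap (J : choiceType) (a : I -> J -> \bar R) : (forall i j, 0 <= a i j)%E ->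
  (\esum_(i in [set: I]) (\esum_(j in [set: J]) a i j) =
   \esum_(j in [set: J]) (\esum_(i in [set: I]) a i j))%E.
Proof.
move=> a0; rewrite !esum_esum//.
rewrite (reindex_esum ([set: J] `*`` (fun=> [set: I])) ([set: I] `*`` (fun=> [set: J])) (fun p => (p.2, p.1)))//.
by split=> // [[i j] [i' j'] _ _ /= [-> ->]//|[i j] _]; exists (j, i).
Qed.

End SumAlgebra.

Definition at_most (T : eqType) (n : nat) (P : T -> Prop) : Prop :=
  exists2 s : seq T, (size s <= n)%N & forall x, P x -> x \in s.

Definition at_least (T : eqType) (n : nat) (P : T -> Prop) : Prop :=
  exists s : seq T, [/\ uniq s, size s = n & forall x, x \in s -> P x].

Lemma at_most_union (T I : eqType) (k n : nat) (l : seq I) (P : T -> Prop) (Q : I -> T -> Prop) :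
  (size l <= k)%N -> (forall i, i \in l -> at_most n (Q i)) ->
  (forall x, P x -> exists2 i, i \in l & Q i x) -> at_most (k * n) P.
Proof.
move=> lk Qn PQ; suff [s ss sP] : at_most (size l * n) P.
  by exists s => //; apply: leq_trans ss _; rewrite leq_mul2r lk orbT.
elim: l P Qn PQ {lk} => [|i l IH] P Qn PQ.
  by exists [::] => // x /PQ[].
have [s ss sP] := Qn i (mem_head i l).
have [||s' ss' sP'] := IH (fun x => exists2 j, j \in l & Q j x).
- by move=> j jl; apply: Qn; rewrite inE jl orbT.
- by [].
exists (s ++ s'); first by rewrite size_cat mulSn leq_add.
move=> x /PQ[j]; rewrite inE mem_cat => /orP[/eqP->/sP->//|jl Qjx].
by rewrite sP' ?orbT//; exists j.
Qed.

Section Counting.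
Variables (R : realType) (I : choiceType).
Hypothesis cI : countable [set: I].
Context d (T : measurableType d) (mu : {measure set T -> \bar R}).
Variable E : I -> set T.
Hypothesis mE : forall i, measurable (E i).

Lemma count_le n t : at_most n (fun i => E i t) ->
  (\esum_(i in [set: I]) (\1_(E i) t)%:E <= n%:R%:E :> \bar R)%E.
Proof.
move=> [s ss sP].
rewrite (esumID [set` undup s]); last by move=> i _; rewrite lee_fin.
rewrite setTI [X in (_ + X)%E]esum1 ?adde0; last first.
  move=> i [_ ni]; rewrite indicE memNset// => /sP; rewrite -mem_undup => h; exact: ni.
rewrite esum_fset; [|exact: finite_seq|by move=> i _; rewrite lee_fin].
rewrite -fsbig_seq ?undup_uniq//= sumEFin lee_fin.
apply: (@le_trans _ _ (\sum_(i <- undup s) 1%R)).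
  by apply: ler_sum => i _; rewrite indicE; case: (_ \in _).
by rewrite big_const_seq count_predT iter_addr_0 ler_nat; apply: leq_trans ss; exact: size_undup.
Qed.

Lemma count_ge n t : at_least n (fun i => E i t) ->
  (n%:R%:E <= \esum_(i in [set: I]) (\1_(E i) t)%:E :> \bar R)%E.
Proof.
move=> [s [us ss sP]]; apply: esum_ge; exists [set` s]; first by split=> //; exact: finite_seq.
rewrite -fsbig_seq//= sumEFin lee_fin -ss -sum1_size natr_sum big_seq [leRHS]big_seq.
by apply: ler_sum => i /sP Ei; rewrite indicE mem_set.
Qed.

Let mind i : measurable_fun setT (fun t => (\1_(E i) t)%:E : \bar R).
Proof. by apply/measurable_EFinP; exact: measurable_indic. Qed.

Lemma sum_measure : (\esum_(i in [set: I]) mu (E i) =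
  \int[mu]_t (\esum_(i in [set: I]) (\1_(E i) t)%:E))%E.
Proof.
rewrite (esum_integral cI mu mind) => [|i t]; last by rewrite lee_fin.
by apply: eq_esum => i _; rewrite integral_indic// setIT.
Qed.

Lemma measure_indicZ (n : nat) (F : set T) : measurable F ->
  (n%:R%:E * mu F = \int[mu]_t (n%:R * \1_F t)%:E)%E.
Proof.
move=> mF; under eq_integral do rewrite EFinM.
rewrite ge0_integralZl; try (by []); try (by move=> *; rewrite lee_fin);
  try (by apply/measurable_EFinP; exact: measurable_indic).
by rewrite integral_indic// setIT.
Qed.

Ltac int_side := first
  [ by move=> t _; rewrite lee_fin mulr_ge0
  | by apply/measurable_EFinP/measurable_funM => //; exact: measurable_indic
  | by move=> t _; apply: esum_ge0 => i _; rewrite lee_fin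
  | by apply: measurable_esum => // i t; rewrite lee_fin ].

(** Both estimates integrate the number of the events that occur. *)
Lemma sum_measure_le n (F : set T) : measurable F ->
  (forall i, E i `<=` F) -> (forall t, F t -> at_most n (fun i => E i t)) ->
  (\esum_(i in [set: I]) mu (E i) <= n%:R%:E * mu F)%E.
Proof.
move=> mF EF cnt; rewrite sum_measure.
rewrite measure_indicZ//.
apply: ge0_le_integral => //; try int_side.
move=> t _; have [Ft|nFt] := pselect (F t).
  rewrite [\1_F t]indicE mem_set// mulr1; apply: count_le; exact: cnt.
rewrite [\1_F t]indicE memNset// mulr0 esum1// => i _.
by rewrite indicE memNset// => /EF.
Qed.

Lemma sum_measure_ge n (F : set T) : measurable F ->
  (forall t, F t -> at_least n (fun i => E i t)) ->
  (n%:R%:E * mu F <= \esum_(i in [set: I]) mu (E i))%E.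
Proof.
move=> mF cnt; rewrite sum_measure.
rewrite measure_indicZ//.
apply: ge0_le_integral => //; try int_side.
move=> t _; have [Ft|nFt] := pselect (F t).
  rewrite [\1_F t]indicE mem_set// mulr1; apply: count_ge; exact: cnt.
by rewrite [\1_F t]indicE memNset// mulr0; apply: esum_ge0 => i _; rewrite lee_fin.
Qed.

End Counting.

(** * Distances and automorphisms *)

Section Counting.
Variable G : sgraph.
Hypotheses (conn : connected_graph G) (lf : locally_finite G).
Implicit Types (x y z : G).

Fixpoint ball (n : nat) x : seq G :=
  if n is k.+1 then x :: flatten [seq ball k y | y <- nbrs lf x] else [:: x].

(** [ball n x] is the list of ends of all paths of length at most [n], which is
   finite by local finiteness. *)
Lemma ballP n x y : gdist_le n x y -> y \in ball n x.
Proof.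
move=> [s [ps <- sz]]; elim: n x s ps sz => [|n IH] x [|z s] //=; rewrite ?inE ?eqxx //.
move=> /andP[xz ps] sz; apply/orP; right; apply/flattenP; exists (ball n z).
  by apply: map_f; exact: nbrsP.
exact: IH.
Qed.

Lemma gdist_ex x y : exists n, gdist_le n x y.
Proof. by have [s ps ls] := conn x y; exists (size s), s. Qed.

Lemma gdist_sym n x y : gdist_le n x y -> gdist_le n y x.
Proof.
move=> [s [ps <- sz]]; exists (rev (belast x s)); split.
- rewrite rev_path; apply: sub_path ps => a b; by rewrite /= adj_sym.
- by case: s {ps sz} => //= a s; rewrite rev_cons last_rcons.
- by rewrite size_rev size_belast.
Qed.

Lemma gdist1 x y : adj x y -> gdist_le 1 x y.
Proof. by move=> xy; exists [:: y]; rewrite /= xy. Qed.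

Lemma countable_vertex : countable [set: G].
Proof.
have [[x _]|nG] := pselect (exists x : G, True); last first.
  by rewrite (_ : [set: G] = set0)//; apply/seteqP; split=> x // _; case: nG; exists x.
have cU : countable (\bigcup_n [set` ball n x]).
  by apply: bigcup_countable => // n _; apply: finite_set_countable; exact: finite_seq.
have sub : [set: G] `<=` \bigcup_n [set` ball n x].
  by move=> y _; have [n xy] := gdist_ex x y; exists n => //; exact: ballP.
exact: sub_countable (subset_card_le sub) cU.
Qed.

Lemma aut_gdist (g : aut G) n x y : gdist_le n x y -> gdist_le n (g x) (g y).
Proof.
move=> [s [ps <- sz]]; exists (map g s); rewrite size_map last_map; split=> //.
elim: s x ps {sz} => //= z s IH x /andP[xz /IH->]; by rewrite (autP g).2 xz.
Qed.

Lemma orbit_reps : quasi_transitive G ->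
  exists os : seq G, forall x, exists2 o, o \in os & exists g : aut G, g o = x.
Proof.
move=> /finite_seqP[s es].
pose pick (A : set G) := if pselect (exists x, A = orbit_of x) is left h
  then Some (sval (cid h)) else None.
exists (pmap pick s) => x.
have xs : orbit_of x \in s.
  by have : [set` s] (orbit_of x) by rewrite -es; exists x.
have [z [pz xz]] : exists z, pick (orbit_of x) = Some z /\ orbit_of x = orbit_of z.
  rewrite /pick; case: pselect => [h|[]]; last by exists x.
  by exists (sval (cid h)); split=> //; case: cid.
exists z; first by rewrite mem_pmap -pz; exact: map_f.
have : orbit_of x x by exists (1%g : aut G).
by rewrite xz => -[g _ gz]; exists g.
Qed.

End Counting.

Section GroupFacts.
Variable G : sgraph.
Implicit Types (g h : aut G) (x y a b : G).

Lemma mulaE g h x : (g * h)%g x = g (h x). Proof. by []. Qed.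
Lemma autK g : cancel g (g^-1)%g.
Proof. by move=> x; rewrite -mulaE mulVg. Qed.
Lemma autVK g : cancel (g^-1)%g g.
Proof. by move=> x; rewrite -mulaE mulgV. Qed.
Lemma aut_inj g : injective g. Proof. exact: can_inj (autK g). Qed.
Lemma aut_adj g x y : adj (g x) (g y) = adj x y. Proof. exact: (autP g).2. Qed.

Definition carriers a b : set (aut G) := [set g | g a = b].

Lemma carriers_open a b : open (carriers a b).
Proof.
have op : open ((fun f : {ptws G -> discrete_topology G} => f a) @^-1` [set b]).
  apply: (@open_comp _ _ (fun f : {ptws G -> discrete_topology G} => f a)).
    by move=> f _; exact: (@proj_continuous _ (fun=> discrete_topology G) a f).
  exact: discrete_open.
by exists ((fun f : {ptws G -> discrete_topology G} => f a) @^-1` [set b]).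
Qed.

End GroupFacts.

(** * Weights of vertices and mass transport *)

Section Weights.
Variables (R : realType) (G : sgraph).
Hypotheses (conn : connected_graph G) (lf : locally_finite G) (qt : quasi_transitive G).
Variable m : {measure set (borel_aut G) -> \bar R}.
Hypothesis haar : haar_measure m.
Implicit Types (a b x y z o : G) (g h : aut G).
Let haarL : left_invariant m. Proof. by case: haar. Qed.
Let cG := countable_vertex conn lf.

Lemma carriers_measurable a b : measurable (carriers a b : set (borel_aut G)).
Proof. by apply: sub_sigma_algebra; exact: carriers_open. Qed.

Lemma carriersM g a b c (A : set (aut G)) : g a = b ->
  m ([set (g * h)%g | h in A `&` carriers c a] : set (borel_aut G)) =
  m ([set (g * h)%g | h in A] `&` carriers c b).
Proof.
move=> gab; congr (m _); apply/seteqP; split=> h.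
  by move=> [k [Ak kca] <-]; split; [exists k|rewrite /carriers /= ?mulaE kca].
move=> [[k Ak <-] kcb]; exists k => //; split=> //.
by apply: (aut_inj (g := g)); rewrite -mulaE kcb.
Qed.

Let W a := m (stabilizer a : set (borel_aut G)).

Lemma carriers_measure a b :
  m (carriers a b : set (borel_aut G)) = if `[< orbit_of a b >] then W a else 0%E.
Proof.
case: asboolP => [[g _ gab]|nab]; last first.
  rewrite (_ : carriers a b = set0) ?measure0//.
  by apply/seteqP; split=> // g gab; apply: nab; exists g.
rewrite /W -[RHS](haarL g); last exact: (carriers_measurable a a).
congr (m _); apply/seteqP; split=> h; last first.
  by move=> [k ka <-]; rewrite /carriers /= ?mulaE ka.
move=> hab; exists (g^-1 * h)%g; last by rewrite mulgA mulgV mul1g.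
by rewrite /stabilizer /= ?mulaE hab -gab autK.
Qed.

Lemma weight_gt0 a : (0 < W a)%E.
Proof.
case: haar => _ _; apply; first exact: (carriers_open a a).
by exists 1%g.
Qed.

(** An automorphism that fixes [b] moves [a] within a ball around [b]; hence finitely
   many translates of the stabilizer of [a] cover that of [b]. *)
Lemma weight_fin a b : (W a < +oo)%E -> (W b < +oo)%E.
Proof.
move=> fa; have [n ab] := gdist_ex conn a b.
pose U := foldr (fun z (V : set (borel_aut G)) => carriers a z `|` V) set0.
have mU s : measurable (U s).
  by elim: s => //= z s IH; apply: measurableU => //; exact: carriers_measurable.
have fU s : (m (U s) < +oo)%E.
  elim: s => [|z s IH] /=; first by rewrite measure0.
  apply: le_lt_trans (measureU2 _ (carriers_measurable a z) (mU s)) _.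
  have fz : (m (carriers a z : set (borel_aut G)) < +oo)%E.
    by rewrite carriers_measure; case: ifP.
  exact: lte_add_pinfty fz IH.
apply: le_lt_trans (fU (ball lf n b)); apply: le_measure; rewrite ?inE//.
  exact: (carriers_measurable b b).
move=> g gb; have : g a \in ball lf n b.
  by apply: ballP; rewrite -{1}[b]gb; apply: aut_gdist; exact: gdist_sym.
elim: (ball _ _ _) => //= z s IH; rewrite inE => /orP[/eqP gz|/IH]; first by left.
by right.
Qed.

(** By orbit counting the weights of [a] and [b] are [c a b] times the numbers of
   points in the orbit of [b] under the stabilizer of [a] and in the orbit of [a]
   under the stabilizer of [b]. These two numbers are the same for [g a], [g b], so
   that an automorphism scales all weights by one factor. *)
Lemma weight_cross g a b : (W a < +oo)%E -> (W (g a) * W b = W (g b) * W a)%E.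
Proof.
move=> fa0.
have fa c : (W c < +oo)%E by exact: weight_fin fa0.
pose c a b := m (carriers a a `&` carriers b b : set (borel_aut G)).
pose N a b := (\esum_(z in [set: G]) (`[< exists2 h : aut G, h a = a & h b = z >] : nat)%:R%:E)%E : \bar R.
have WE x y : W x = (c x y * N x y)%E.
  have mc z : measurable (carriers x x `&` carriers y z : set (borel_aut G)).
    by apply: measurableI; exact: carriers_measurable.
  have cf : c x y = (fine (c x y))%:E.
    rewrite fineK// ge0_fin_numE ?measure_ge0//; apply: le_lt_trans (fa x).
    by apply: le_measure; rewrite ?inE//; exact: (carriers_measurable x x).
  rewrite cf /N -esumZ//; last by rewrite fine_ge0 ?measure_ge0.
  transitivity (m (\bigcup_z (carriers x x `&` carriers y z : set (borel_aut G)))).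
    by congr (m _); apply/seteqP; split=> h; [move=> hx; exists (h y)|move=> [z _ []]].
  rewrite (measure_esum cG)//; last by move=> z z' h [_ <-] [_ <-].
  apply: eq_esum => z _; case: asboolP => [[h hx hy]|nh] /=; last first.
    rewrite mule0 (_ : _ `&` _ = set0) ?measure0//.
    by apply/seteqP; split=> // h [hx hy]; apply: nh; exists h.
  rewrite mule1 -cf /c -[RHS](haarL h); last exact: mc.
  rewrite (carriersM _ _ hy); congr (m (_ `&` _)).
  apply/seteqP; split=> k; last first.
    by move=> [l lx <-]; rewrite /carriers /= ?mulaE lx.
  move=> kx; exists (h^-1 * k)%g; last by rewrite mulgA mulgV mul1g.
  by rewrite /carriers /= ?mulaE kx -hx autK.
have cC x y : c x y = c y x by rewrite /c setIC.
have NE x y : N (g x) (g y) = N x y.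
  rewrite /N (reindex_esum [set: G] [set: G] g)//.
    apply: eq_esum => z _; congr ((_ : nat)%:R%:E); congr nat_of_bool.
    apply/asboolP/asboolP => -[h hx hy].
      by exists (g^-1 * h * g)%g; rewrite !mulaE ?hx ?hy autK.
    by exists (g * h * g^-1)%g; rewrite !mulaE autK ?hx ?hy.
  split=> // [x' y' _ _ /aut_inj//|z _]; exists (g^-1 z)%g => //; exact: autVK.
rewrite (WE (g a) (g b)) (WE (g b) (g a)) [in LHS](WE b a) [in RHS](WE a b) !NE.
rewrite (cC b a) (cC (g b)) muleACA [RHS]muleACA; congr (_ * _)%E.
by rewrite muleC.
Qed.

(** The mass transport principle, by counting the automorphisms that carry
   [o'] to [y] and [x] to [o] in two ways. *)
Lemma mass_transport (F : G -> G -> R) o o' : (forall x y, 0 <= F x y) ->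
  (forall g x y, F (g x) (g y) = F x y) ->
  (\esum_(y in [set: G]) ((F o y)%:E * m (carriers o' y : set (borel_aut G))) =
   \esum_(x in [set: G]) ((F x o')%:E * m (carriers x o : set (borel_aut G))))%E.
Proof.
move=> F0 FE.
have mI x y : measurable (carriers o' y `&` carriers x o : set (borel_aut G)).
  by apply: measurableI; exact: carriers_measurable.
transitivity (\esum_(y in [set: G]) (\esum_(x in [set: G])
    ((F o y)%:E * m (carriers o' y `&` carriers x o : set (borel_aut G)))))%E.
  apply: eq_esum => y _; rewrite esumZ//; congr (_ * _)%E.
  rewrite -(measure_esum cG)//; last first.
    by move=> x x' h [_ hx] [_ hx']; apply: (aut_inj (g := h)); rewrite hx hx'.
  congr (m _); apply/seteqP; split=> h; last by move=> [x _ []].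
  by move=> hy; exists (h^-1 o)%g => //; split=> //; exact: autVK.
rewrite esum_swap//; last by move=> *; rewrite mule_ge0 ?lee_fin.
apply: eq_esum => x _.
transitivity (\esum_(y in [set: G])
    ((F x o')%:E * m (carriers o' y `&` carriers x o : set (borel_aut G))))%E.
  apply: eq_esum => y _.
  have [[h [hy hx]]|n] := pselect (exists h, (carriers o' y `&` carriers x o) h).
    by rewrite -{1}hy -{1}hx FE.
  rewrite (_ : _ `&` _ = set0) ?measure0 ?mule0//.
  by apply/seteqP; split=> // h hh; apply: n; exists h.
rewrite esumZ//; congr (_ * _)%E.
rewrite -(measure_esum cG)//; last by move=> y y' h [<- _] [<- _].
congr (m _); apply/seteqP; split=> h; first by move=> [y _ []].
by move=> hx; exists (h o').
Qed.

Variable x0 : G.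
Hypothesis fx0 : (W x0 < +oo)%E.

Definition weight x : R := fine (m (stabilizer x : set (borel_aut G))).

Lemma weightE x : (weight x)%:E = W x.
Proof. by rewrite fineK// ge0_fin_numE ?measure_ge0//; exact: weight_fin fx0. Qed.

Lemma weight_pos x : 0 < weight x.
Proof. by rewrite -lte_fin weightE weight_gt0. Qed.

(** Up to conventions the modular function of the group, read off from the
   weights. *)
Definition modulus g : R := weight (g x0) / weight x0.

Lemma weight_modulus g x : weight (g x) = modulus g * weight x.
Proof.
have := @weight_cross g x x0 (weight_fin x fx0); rewrite -!weightE -!EFinM => -[e].
rewrite /modulus mulrAC -e mulfK//; exact: lt0r_neq0 (weight_pos x0).
Qed.

Definition orbit_rep x : G := xget x0 (orbit_of x).

Lemma orbit_repP x : exists g : aut G, g (orbit_rep x) = x.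
Proof.
rewrite /orbit_rep; case: xgetP => [y _ [g _ <-]|/(_ x)[]].
  by exists g^-1%g; exact: autK.
by exists 1%g.
Qed.

Lemma orbit_rep_aut g x : orbit_rep (g x) = orbit_rep x.
Proof.
congr xget; apply/seteqP; split=> y [h _ <-]; first by exists (h * g)%g.
by exists (h * g^-1)%g => //; rewrite mulaE autK.
Qed.

Definition reps : seq G := undup (map orbit_rep (sval (cid (orbit_reps qt)))).

Lemma reps_mem x : orbit_rep x \in reps.
Proof.
rewrite mem_undup; case: cid => os /= /(_ x)[c cos [g <-]].
by rewrite orbit_rep_aut; exact: map_f.
Qed.

Lemma sum_reps (z : G) (c : G -> \bar R) :
  (\sum_(o <- reps) (if `[< orbit_of o z >] then c o else 0) = c (orbit_rep z))%E.
Proof.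
rewrite (bigD1_seq (orbit_rep z)) ?reps_mem ?undup_uniq//=.
have [g gz] := orbit_repP z; rewrite asboolT; last by exists g.
rewrite big_seq_cond big1 ?adde0// => o /andP[oos onz].
case: asboolP => // -[h _ hoz]; move/eqP: onz; case.
move: oos; rewrite mem_undup => /mapP[y _ oy].
by rewrite -hoz orbit_rep_aut oy; have [k e] := orbit_repP y; rewrite -[in LHS]e orbit_rep_aut.
Qed.

(** A function that scales like the weights becomes invariant when divided by the
   weight of the sender. *)
Lemma mass_transport_pair (f : G -> G -> R) o o' : (forall x y, 0 <= f x y) ->
  (forall g x y, f (g x) (g y) = modulus g * f x y) ->
  (\esum_(y in [set: G]) (if `[< orbit_of o' y >] then (f o y / weight o)%:E else 0) =
   \esum_(x in [set: G]) (if `[< orbit_of o x >] then (f x o' / weight o')%:E else 0))%E.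
Proof.
move=> f0 fE; have wn x : weight x != 0 by exact: lt0r_neq0 (weight_pos x).
have Dn g : modulus g != 0 by rewrite mulf_neq0 ?invr_eq0.
have F0 x y : 0 <= f x y / weight x by apply: divr_ge0 => //; apply: ltW; exact: weight_pos.
have FE g x y : f (g x) (g y) / weight (g x) = f x y / weight x.
  by rewrite fE weight_modulus invfM mulrACA divff// mul1r.
have := congr1 (fun e => ((weight o')^-1)%:E * e)%E (mass_transport o o' F0 FE).
have i0 : 0 <= (weight o')^-1 by rewrite invr_ge0; apply: ltW; exact: weight_pos.
rewrite -!esumZ//; try (by move=> x; rewrite mule_ge0 ?measure_ge0 ?lee_fin).
move=> e; transitivity (\esum_(x in [set: G]) (((weight o')^-1)%:E *
    ((f o x / weight o)%:E * m (carriers o' x : set (borel_aut G)))))%E.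
  apply: eq_esum => y _; rewrite carriers_measure; case: ifP => _; last by rewrite !mule0.
  by rewrite -weightE -!EFinM [in RHS]mulrC mulfK.
rewrite {}e; apply: eq_esum => x _; rewrite carriers_measure.
have -> : `[< orbit_of x o >] = `[< orbit_of o x >].
  by apply/asboolP/asboolP => -[g _ <-]; exists (g^-1)%g => //; exact: autK.
case: ifP => _; last by rewrite !mule0.
by rewrite -weightE -!EFinM divfK// mulrC.
Qed.

(** The vertices [o] represent the finitely many orbits: what one vertex sends is
   at most what the representatives receive in total. *)
Lemma mass_transport_out (f : G -> G -> R) a : (forall x y, 0 <= f x y) ->
  (forall g x y, f (g x) (g y) = modulus g * f x y) ->
  (\esum_(z in [set: G]) (f a z / weight a)%:E <=
   \sum_(o <- reps) \esum_(y in [set: G]) (f y o / weight o)%:E)%E.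
Proof.
move=> f0 fE; have q0 x y z : 0 <= f x y / weight z by apply: divr_ge0 => //; apply: ltW; exact: weight_pos.
rewrite [leLHS](_ : _ = \sum_(o <- reps) \esum_(z in [set: G])
    (if `[< orbit_of o z >] then (f a z / weight a)%:E else 0))%E; last first.
  rewrite -esum_sum; last by move=> z o _ _; case: ifP => // _; rewrite lee_fin.
  by apply: eq_esum => z _; rewrite (sum_reps z (fun=> _)).
apply: lee_sum => o _; rewrite mass_transport_pair//.
by apply: le_esum => x _; case: ifP => // _; rewrite lee_fin.
Qed.

Lemma mass_transport_reps (f : G -> G -> R) : (forall x y, 0 <= f x y) ->
  (forall g x y, f (g x) (g y) = modulus g * f x y) ->
  (\sum_(o <- reps) \esum_(z in [set: G]) (f o z / weight o)%:E =
   \sum_(o <- reps) \esum_(y in [set: G]) (f y o / weight o)%:E)%E.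
Proof.
move=> f0 fE; have q0 x y z : 0 <= f x y / weight z by apply: divr_ge0 => //; apply: ltW; exact: weight_pos.
transitivity (\sum_(o <- reps) \sum_(o' <- reps) \esum_(z in [set: G])
    (if `[< orbit_of o' z >] then (f o z / weight o)%:E else 0))%E.
  apply: eq_bigr => o _; rewrite -esum_sum; last by move=> z o' _ _; case: ifP => // _; rewrite lee_fin.
  by apply: eq_esum => z _; rewrite (sum_reps z (fun=> _)).
rewrite exchange_big /=; apply: eq_bigr => o' _.
under eq_bigr => o _ do rewrite mass_transport_pair//.
rewrite -esum_sum; last by move=> z o _ _; case: ifP => // _; rewrite lee_fin.
by apply: eq_esum => z _; rewrite (sum_reps z (fun=> _)).
Qed.

(** By quasi-transitivity a monotone family of invariant properties that exhausts
   the vertices does so at one index. *)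
Lemma orbit_uniform (I : Type) (good : I -> G -> Prop) (le : I -> I -> Prop) (i0 : I) :
  (forall i j k, le i j -> le j k -> le i k) -> (forall i, le i i) ->
  (forall i j, exists k, le i k /\ le j k) ->
  (forall i j x, le i j -> good i x -> good j x) ->
  (forall x, exists i, good i x) -> (forall g i x, good i x -> good i (g x)) ->
  exists i, forall x, good i x.
Proof.
move=> ltr lrr dir mon ex inv.
suff [i iP] : exists i, forall o, o \in reps -> good i o.
  exists i => x; have [g <-] := orbit_repP x; apply: inv; apply: iP; exact: reps_mem.
elim: reps => [|o s [i iP]]; first by exists i0.
have [j jo] := ex o; have [k [ik jk]] := dir i j; exists k => o'.
by rewrite inE => /orP[/eqP->|/iP h]; [exact: mon jk jo|exact: mon ik h].
Qed.

Lemma ball_bound r : exists n, forall x, exists2 s : seq G,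
  (size s <= n)%N & forall y, gdist_le r x y -> y \in s.
Proof.
apply: (@orbit_uniform nat (fun n x => exists2 s : seq G, (size s <= n)%N &
  forall y, gdist_le r x y -> y \in s) leq 0%N) => //.
- by move=> i j k; exact: leq_trans.
- by move=> i j; exists (maxn i j); rewrite leq_maxl leq_maxr.
- by move=> i j x ij [s si sP]; exists s => //; exact: leq_trans ij.
- by move=> x; exists (size (ball lf r x)), (ball lf r x) => // y; exact: ballP.
move=> g i x [s si sP]; exists (map g s) => [|y /(aut_gdist g^-1%g)]; first by rewrite size_map.
by rewrite autK => /sP /(map_f g); rewrite autVK.
Qed.

Lemma weight_adj : exists2 k : R, 0 < k & forall x y, adj x y -> weight x <= k * weight y.
Proof.
have [k kP] : exists k : R, forall x, 0 < k /\ forall y, adj x y -> weight x <= k * weight y.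
  apply: (@orbit_uniform R (fun k x => 0 < k /\ forall y, adj x y -> weight x <= k * weight y)
    (fun i j => i <= j) 0) => //.
  - by move=> i j k; exact: le_trans.
  - by move=> i j; exists (Num.max i j); rewrite !le_max !lexx orbT.
  - move=> i j x ij [i0 iP]; split; first exact: lt_le_trans ij.
    move=> y /iP xy; apply: le_trans xy _; exact: ler_wpM2r (ltW (weight_pos y)) _ _ ij.
  - move=> x; have [k k0 kP] : exists2 k : R, 0 < k & forall y, y \in nbrs lf x -> weight x <= k * weight y.
      elim: (nbrs lf x) => [|z s [k k0 kP]]; first by exists 1.
      exists (k + weight x / weight z) => [|y].
        by rewrite addr_gt0 ?divr_gt0 ?weight_pos.
      rewrite inE => /orP[/eqP->|/kP h]; rewrite mulrDl; last first.
        by apply: le_trans h _; rewrite lerDl; have w0 v := ltW (weight_pos v); rewrite mulr_ge0 ?divr_ge0.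
      have w0 v := ltW (weight_pos v).
      by rewrite divfK ?lt0r_neq0 ?weight_pos// lerDr mulr_ge0 // ltW.
    by exists k; split=> // y /(nbrsP lf)/kP.
  move=> g k x [k0 kP]; split=> // y.
  rewrite -(autVK g y); set z := (g^-1)%g y; rewrite aut_adj => /kP h.
  have Dg : 0 < modulus g by apply: divr_gt0; exact: weight_pos.
  rewrite (weight_modulus g x) (weight_modulus g z) mulrCA.
  by apply: ler_wpM2l => //; exact: ltW.
have [[x _]|n] := pselect (exists x : G, True); last by exists 1 => // x; case: n; exists x.
by exists k; [case: (kP x)|move=> x' y; case: (kP x') => _; apply].
Qed.

End Weights.

(** * Percolation under automorphisms and under changes of one edge *)

Section Config.
Variable G : sgraph.
Hypotheses (conn : connected_graph G) (lf : locally_finite G).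
Implicit Types (g h : aut G) (x y z : G) (e f : edge G) (F H : {fset edge G}) (om : config G).

Lemma edge_subproof x y : adj x y -> `[< is_edge [fset x; y]%fset >].
Proof. by move=> xy; apply/asboolP; exists x, y. Qed.

Definition mkedge x y (xy : adj x y) : edge G := exist (fun e : {fset G} => is_true `[< is_edge e >]) _ (edge_subproof xy).

Lemma edgeP e : exists x y, adj x y /\ val e = [fset x; y]%fset.
Proof. by have /asboolP := valP e. Qed.

Lemma edge_fset_eq x y x' y' : [fset x; y]%fset = [fset x'; y']%fset ->
  (x = x' /\ y = y') \/ (x = y' /\ y = x').
Proof.
move=> e; have xin : x \in [fset x'; y']%fset by rewrite -e !inE eqxx.
have yin : y \in [fset x'; y']%fset by rewrite -e !inE eqxx orbT.
have xin' : x' \in [fset x; y]%fset by rewrite e !inE eqxx.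
have yin' : y' \in [fset x; y]%fset by rewrite e !inE eqxx orbT.
move: xin yin xin' yin'; rewrite !inE.
by do 4 (case/orP => /eqP ?); subst; auto.
Qed.

Lemma open_adjP om x y (xy : adj x y) : open_adj om x y = om (mkedge xy).
Proof.
apply/asboolP/idP => [[e ve oe]|oe]; last by exists (mkedge xy).
by have -> : mkedge xy = e by apply: val_inj.
Qed.

Lemma open_adj_sub om : substate (open_adj om).
Proof.
split=> [x y|x y /asboolP[e ve _]].
  by rewrite /open_adj; congr (`[< _ >]); apply/propext; split=> -[e ve oe]; exists e; rewrite // fsetUC.
have [a [b [ab]]] := edgeP e; rewrite ve => /edge_fset_eq[[-> ->]//|[-> ->]].
by rewrite adj_sym.
Qed.

Lemma countable_edge : countable [set: edge G].
Proof.
have c2 : countable [set: G * G] by rewrite -setXTT; apply: countableX; exact: countable_vertex conn lf.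
pose k (e : edge G) : G * G := (sval (cid (edgeP e)), sval (cid (svalP (cid (edgeP e))))).
have kv e : val e = [fset (k e).1; (k e).2]%fset.
  by rewrite /k /=; case: cid => x hx /=; case: cid => y [].
have ki : injective k by move=> e f ef; apply: val_inj; rewrite /= !kv ef.
have [c ci] := code_ex c2; apply/countable_injP; exists (c \o k).
by move=> e f _ _ /ci/ki.
Qed.

Lemma imfset_pair (k : G -> G) x y :
  [fset k z | z in [fset x; y]%fset]%fset = [fset k x; k y]%fset.
Proof.
apply/fsetP => z; apply/imfsetP/fset2P => [[t /fset2P[]-> ->]|[]->]; [by left|by right| |].
  by exists x; rewrite //= !inE eqxx.
by exists y; rewrite //= !inE eqxx orbT.
Qed.

Lemma eact_subproof g e : `[< is_edge [fset g x | x in val e]%fset >].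
Proof.
have [x [y [xy ->]]] := edgeP e; apply/asboolP; exists (g x), (g y).
by rewrite aut_adj; split=> //; rewrite imfset_pair.
Qed.

Definition eact g e : edge G := exist (fun e : {fset G} => is_true `[< is_edge e >]) _ (eact_subproof g e).

Lemma eact_mk g x y (xy : adj x y) (gxy : adj (g x) (g y)) : eact g (mkedge xy) = mkedge gxy.
Proof. by apply: val_inj; rewrite /= imfset_pair. Qed.

Lemma eactK g : cancel (eact g) (eact g^-1%g).
Proof.
move=> e; have [x [y [xy ve]]] := edgeP e.
have -> : e = mkedge xy by exact: val_inj.
have gxy : adj (g x) (g y) by rewrite aut_adj.
rewrite (eact_mk _ gxy); apply: val_inj; rewrite /= imfset_pair.
by rewrite !autK.
Qed.

Lemma eact_inj g : injective (eact g). Proof. exact: can_inj (eactK g). Qed.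

Definition act g om : config G := fun e => om (eact g^-1%g e).

Lemma act_open g om x y : open_adj (act g om) (g x) (g y) = open_adj om x y.
Proof.
have [xy|nxy] := boolP (adj x y).
  have gxy : adj (g x) (g y) by rewrite aut_adj.
  by rewrite !open_adjP /act -(eact_mk xy) eactK.
have [_ /(_ x y) h] := open_adj_sub om; have [_ /(_ (g x) (g y)) h'] := open_adj_sub (act g om).
rewrite aut_adj in h'.
by apply/idP/idP => [/h'|/h]; rewrite (negbTE nxy).
Qed.

(** These cylinders form a generating system that is stable under intersection,
   and the definition of percolation prescribes their probabilities. *)
Definition cyl F : set (config G) := [set om | forall e, e \in F -> om e].

Lemma cylI F H : cyl F `&` cyl H = cyl (F `|` H)%fset.
Proof.
apply/seteqP; split=> om.
  by move=> [hF hH] e; rewrite inE => /orP[/hF|/hH].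
by move=> h; split=> e eF; apply: h; rewrite inE eF ?orbT.
Qed.

Lemma cyl0 : cyl fset0 = setT.
Proof. by apply/seteqP; split=> om // _ e; rewrite inE. Qed.

Lemma open_event_measurable e : measurable (open_event e : set (config G)).
Proof. by apply: sub_sigma_algebra; exists e. Qed.

Lemma cyl_bigcap F : cyl F = \bigcap_(e in [set` F]) open_event e.
Proof. by []. Qed.

Lemma cyl_measurable F : measurable (cyl F).
Proof.
rewrite cyl_bigcap; apply: fin_bigcap_measurable => [|e _]; first exact: finite_fset.
exact: open_event_measurable.
Qed.

Lemma cyl_generate : @measurable _ (config G) = <<s range cyl >>.
Proof.
apply/seteqP; split.
  apply: smallest_sub; first exact: smallest_sigma_algebra.
  move=> _ [e _ <-]; apply: sub_sigma_algebra; exists [fset e]%fset => //.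
  apply/seteqP; split=> om; first by apply; rewrite inE.
  by move=> oe f; rewrite inE => /eqP->.
apply: smallest_sub; first exact: sigma_algebra_measurable.
by move=> _ [F _ <-]; exact: cyl_measurable.
Qed.

Lemma cyl_setI : setI_closed (range cyl).
Proof. by move=> _ _ [F _ <-] [H _ <-]; exists (F `|` H)%fset => //; rewrite cylI. Qed.

Lemma measurable_config d (T : measurableType d) (phi : T -> config G) :
  (forall e, measurable [set t | phi t e]) -> measurable_fun setT phi.
Proof.
move=> mphi; apply: (@measurability _ _ T (config G) _ _ (range (@open_event G))) => //.
by move=> _ [_ [e _ <-] <-]; rewrite setTI; exact: mphi.
Qed.

Lemma measurable_act g : measurable_fun setT (act g).
Proof. by apply: measurable_config => e; exact: open_event_measurable. Qed.

Definition upd e b om : config G := fun f => if f == e then b else om f.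

Lemma measurable_upd e b : measurable_fun setT (upd e b).
Proof.
apply: measurable_config => f; rewrite /upd; case: eqP => _; last exact: open_event_measurable.
by case: b; [rewrite (_ : mkset _ = setT)|rewrite (_ : mkset _ = set0)] => //; apply/seteqP; split.
Qed.

Lemma measure_eq_cyl (R : realType) (mu nu : {measure set (config G) -> \bar R}) :
  (mu setT < +oo)%E -> (forall F, mu (cyl F) = nu (cyl F)) ->
  forall A, measurable A -> mu A = nu A.
Proof.
move=> fin eq A mA; apply: (measure_unique (range cyl) (fun=> setT)) => //.
- exact: cyl_generate.
- exact: cyl_setI.
- by move=> _; exists fset0 => //; exact: cyl0.
- by apply/seteqP; split=> // t _; exists 0%N.
- by move=> _ [F _ <-].
Qed.

Section Bernoulli.
Variables (R : realType) (p : R) (P : probability (config G) R).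
Hypothesis P_bernoulli : bernoulli_percolation p P.

Lemma P_cyl F : P (cyl F) = (p ^+ #|` F|)%:E.
Proof.
rewrite cyl_bigcap P_bernoulli.2.
under eq_bigr => e _ do rewrite P_bernoulli.1.
by rewrite prodEFin big_const_seq count_predT iter_mulr_1.
Qed.

Lemma P_act g A : measurable A -> P (act g @^-1` A) = P A.
Proof.
move=> mA; pose mg : {mfun config G >-> config G} := mfun_Sub (mem_set (measurable_act g)).
apply: (@measure_eq_cyl _ (pushforward P mg) P) => // [|F].
  by rewrite /= /pushforward preimage_setT probability_setT ltry.
rewrite /= /pushforward (_ : _ @^-1` _ = cyl [fset eact g^-1%g e | e in F]%fset) ?P_cyl.
  by rewrite card_imfset//; exact: eact_inj.
apply/seteqP; split=> om h e.
  by move=> /imfsetP[f /= fF ->]; exact: h fF.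
by move=> eF; apply: h; exact: in_imfset.
Qed.

Lemma P_open e : P (open_event e) = p%:E. Proof. exact: P_bernoulli.1. Qed.

Lemma cyl1 e : cyl [fset e]%fset = open_event e.
Proof.
apply/seteqP; split=> om; first by apply; rewrite inE.
by move=> oe f; rewrite inE => /eqP->.
Qed.

(** [upd e true] forgets the state of [e], so the two events are independent. *)
Lemma P_upd_open e A : measurable A ->
  P (upd e true @^-1` A `&` open_event e) = (p%:E * P (upd e true @^-1` A))%E.
Proof.
move=> mA; pose mu : {mfun config G >-> config G} := mfun_Sub (mem_set (measurable_upd e true)); have me := open_event_measurable e.
have p0 : 0 <= p by rewrite -lee_fin -(P_open e).
have := @measure_eq_cyl _ (pushforward (mrestr P me) mu) (mscale (NngNum p0) (pushforward P mu)).
apply=> // [|F].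
  by rewrite /= /pushforward /mrestr preimage_setT setTI; apply: le_lt_trans (probability_le1 _ _) _; rewrite ?ltry.
rewrite /= /mscale /= /pushforward /mrestr /=.
have -> : upd e true @^-1` cyl F = cyl (F `\ e)%fset.
  apply/seteqP; split=> om h f.
    by rewrite !inE => /andP[fe /h]; rewrite /upd (negbTE fe).
  by move=> fF; rewrite /upd; case: eqP => // /eqP fe; apply: h; rewrite !inE fe.
rewrite -cyl1 cylI !P_cyl -EFinM -exprS; congr ((_ ^+ _)%:E).
by rewrite fsetUC cardfsU1 !inE eqxx.
Qed.

Hypothesis p01 : 0 < p < 1.

(** Insertion and deletion tolerance: for [0 < p < 1] a change at one edge cannot
   make a null event possible. *)
Lemma null_upd e b A : measurable A -> P A = 0 -> P (upd e b @^-1` A) = 0.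
Proof.
have [p0 p1] := andP p01 => mA A0; have me := open_event_measurable e.
have mu c : measurable (upd e c @^-1` A).
  by rewrite -[X in measurable X]setTI; exact: measurable_upd.
have upd_id c om : om e = c -> upd e c om = om.
  by move=> <-; apply/funext => f; rewrite /upd; case: eqP => [->|].
case: b.
  have : P (upd e true @^-1` A `&` open_event e) = 0.
    apply/eqP; rewrite eq_le measure_ge0 andbT -A0; apply: le_measure; rewrite ?inE//.
      exact: measurableI.
    by move=> om [/= h oe]; rewrite upd_id in h.
  rewrite P_upd_open// => /eqP; rewrite mule_eq0 eqe gt_eqF//= => /eqP.
  by [].
have e1 : upd e true @^-1` (upd e false @^-1` A) = upd e false @^-1` A.
  apply/seteqP; split=> om /=; rewrite (_ : upd e false (upd e true om) = upd e false om)//;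
  by apply/funext => f; rewrite /upd; case: eqP.
have := P_upd_open e (mu false); rewrite e1 => h.
have : P (upd e false @^-1` A) = (p%:E * P (upd e false @^-1` A))%E.
  transitivity (P (upd e false @^-1` A `\` open_event e) +
    P (upd e false @^-1` A `&` open_event e))%E; first exact: (measureDI P (mu false) me).
  rewrite h (_ : P (_ `\` _) = 0) ?add0e//.
  apply/eqP; rewrite eq_le measure_ge0 andbT -A0; apply: le_measure; rewrite ?inE//.
    exact: measurableD.
  move=> om [/= h' noe]; rewrite upd_id in h' => //.
  by apply/negbTE/negP.
have : P (upd e false @^-1` A) \is a fin_num by exact: fin_num_measure.
case: (P _) => // r _; rewrite -EFinM => -[] /eqP; rewrite -subr_eq0 -{1}[r]mul1r -mulrBl mulf_eq0.
by rewrite subr_eq0 gt_eqF//= => /eqP->.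
Qed.

End Bernoulli.

(** Intersecting two independent percolations gives a sparser percolation. *)
Lemma bernoulli_and (R : realType) (p q : R) (P Q : probability (config G) R) :
  bernoulli_percolation p P -> bernoulli_percolation q Q ->
  exists Q' : probability (config G) R, bernoulli_percolation (p * q) Q'.
Proof.
move=> bP bQ.
pose phi (t : config G * config G) : config G := fun e => t.1 e && t.2 e.
have mphi : measurable_fun setT phi.
  apply: measurable_config => e.
  rewrite (_ : mkset _ = open_event e `*` open_event e).
    by apply: measurableX; exact: open_event_measurable.
  by apply/seteqP; split=> t; [move/andP|move=> [/= h1 h2]; apply/andP].
pose X : {mfun (config G * config G)%type >-> config G} := mfun_Sub (mem_set mphi).
have XE F : distribution (P \x Q)%E X (cyl F) = ((p * q) ^+ #|` F|)%:E.
  rewrite /distribution /pushforward (_ : _ @^-1` _ = cyl F `*` cyl F).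
    transitivity (P (cyl F) * Q (cyl F))%E.
      by apply: product_measure1E; exact: cyl_measurable.
    by rewrite (P_cyl bP) (P_cyl bQ) exprMn EFinM.
  apply/seteqP; split=> t /=.
    by move=> h; split=> e /h /andP[].
  by move=> [h1 h2] e eF; apply/andP; split; [exact: h1|exact: h2].
have XE1 e : distribution (P \x Q)%E X (open_event e) = (p * q)%:E.
  by have := XE [fset e]%fset; rewrite cyl1 cardfs1 expr1.
exists (distribution (P \x Q)%E X); split=> [e|F]; first exact: XE1.
transitivity (((p * q) ^+ #|` F|)%:E); first exact: XE.
rewrite (eq_bigr (fun=> (p * q)%:E)); last by move=> e _; exact: XE1.
by rewrite prodEFin big_const_seq count_predT iter_mulr_1.
Qed.

Lemma bernoulli_exp (R : realType) (p : R) (P : probability (config G) R) (k : nat) :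
  bernoulli_percolation p P ->
  exists Q : probability (config G) R, bernoulli_percolation (p ^+ k.+1) Q.
Proof.
move=> bP; elim: k => [|k [Q bQ]]; first by exists P; rewrite expr1.
by rewrite exprS; exact: bernoulli_and bP bQ.
Qed.

End Config.

(** * The zero-one law *)

Section ZeroOne.
Variable G : sgraph.
Hypotheses (conn : connected_graph G) (lf : locally_finite G).
Variables (R : realType) (p : R) (P : probability (config G) R).
Hypothesis P_bernoulli : bernoulli_percolation p P.
Implicit Types (A B C : set (config G)) (F H : {fset edge G}) (g : aut G).

Let Pr A : R := fine (P A).

Let PrE A : measurable A -> P A = (Pr A)%:E.
Proof. by move=> mA; rewrite fineK// fin_num_measure. Qed.

Let PrU A B : measurable A -> measurable B -> A `&` B = set0 ->
  Pr (A `|` B) = Pr A + Pr B.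
Proof.
move=> mA mB AB; apply: EFin_inj; rewrite EFinD -!PrE ?measureU//; exact: measurableU.
Qed.

Let Pr_split A B : measurable A -> measurable B -> Pr B = Pr (A `&` B) + Pr (~` A `&` B).
Proof.
move=> mA mB; rewrite -PrU.
- by rewrite -setIUl setUv setTI.
- exact: measurableI.
- by apply: measurableI => //; exact: measurableC.
- by rewrite setIACA setICr set0I.
Qed.

Let Pr_ge0 A : 0 <= Pr A. Proof. by rewrite fine_ge0. Qed.

Let mcyl := @cyl_measurable G.

Definition translate g F : {fset edge G} := [fset eact g e | e in F]%fset.

Let Pr_translate g F : Pr (cyl (translate g F)) = Pr (cyl F).
Proof. by rewrite /Pr !(P_cyl P_bernoulli) card_imfset//; exact: eact_inj. Qed.

(** [C] is asymptotically independent of the far translates of [cyl F]. *)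
Let mixes F C := forall eps, 0 < eps -> exists H, forall g,
  (forall e, e \in F -> eact g e \notin H) ->
  `|Pr (C `&` cyl (translate g F)) - Pr C * Pr (cyl F)| <= eps.

Let mixes_cyl F K : mixes F (cyl K).
Proof.
move=> eps e0; exists K => g gK; rewrite cylI /Pr !(P_cyl P_bernoulli) /=.
have dis : (K `&` translate g F = fset0)%fset.
  apply/fsetP => e; rewrite !inE; apply/negP => /andP[eK /imfsetP[f /= fF ef]].
  by have := gK _ fF; rewrite -ef eK.
have := cardfsUI K (translate g F); rewrite dis cardfs0 addn0 => ->.
rewrite card_imfset; last exact: eact_inj.
by rewrite exprD subrr normr0 ltW.
Qed.

Let mixesC F C : measurable C -> mixes F C -> mixes F (~` C).
Proof.
move=> mC mix eps e0; have [H hH] := mix _ e0; exists H => g /hH.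
have := Pr_split mC (mcyl (translate g F)); rewrite Pr_translate => e1.
have := Pr_split mC (@measurableT _ (config G)); rewrite !setIT => e2.
have PT : Pr setT = 1 by rewrite /Pr probability_setT.
move: e1 e2; rewrite PT; set a := Pr (C `&` _); set b := Pr (~` C `&` _).
set c := Pr (cyl F); set d := Pr C; set d' := Pr (~` C) => e1 e2.
suff -> : b - d' * c = - (a - d * c) by rewrite normrN.
have -> : b = c - a by rewrite e1; ring.
have -> : d' = 1 - d by rewrite e2; ring.
ring.
Qed.

Let mixesU F C D : measurable C -> measurable D -> C `&` D = set0 ->
  mixes F C -> mixes F D -> mixes F (C `|` D).
Proof.
move=> mC mD CD mixC mixD eps e0.
have e2 : 0 < eps / 2 by rewrite divr_gt0.
have [H hH] := mixC _ e2; have [K hK] := mixD _ e2.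
exists (H `|` K)%fset => g gHK.
have h1 : forall e, e \in F -> eact g e \notin H.
  by move=> e /gHK; rewrite inE negb_or => /andP[].
have h2 : forall e, e \in F -> eact g e \notin K.
  by move=> e /gHK; rewrite inE negb_or => /andP[].
rewrite setIUl !PrU//; try exact: measurableI; last by rewrite setIACA CD set0I.
rewrite mulrDl opprD addrACA (splitr eps); apply: le_trans (ler_normD _ _) _.
by apply: lerD; [exact: hH|exact: hK].
Qed.

Let mixes_bigcup F (C : nat -> set (config G)) : (forall n, measurable (C n)) ->
  trivIset [set: nat] C -> (forall n, mixes F (C n)) -> mixes F (\bigcup_n C n).
Proof.
move=> mC tC mixC eps e0.
have mU : measurable (\bigcup_n C n) by exact: bigcupT_measurable.
pose U n := \big[setU/set0]_(i < n) C i.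
have mUn n : measurable (U n) by exact: bigsetU_measurable.
have UE : \bigcup_n U n = \bigcup_n C n.
  apply/seteqP; split=> om [n _]; first by rewrite /U -bigcup_mkord => -[i _ Ci]; exists i.
  by move=> Cn; exists n.+1 => //; rewrite /U -bigcup_mkord; exists n => /=.
have cv : P (U n) @[n --> \oo] --> P (\bigcup_n C n).
  rewrite -UE; apply: nondecreasing_cvg_mu => //; first by rewrite UE.
  move=> a b ab; apply/subsetPset; rewrite /U -!bigcup_mkord => om [i ia Ci].
  by exists i => //; exact: leq_trans ia ab.
have [n hn] : exists n, Pr (\bigcup_n C n) - Pr (U n) <= eps / 3.
  have e3 : 0 < eps / 3 by rewrite divr_gt0.
  have /fine_cvgP[_ /cvgrPdist_le/(_ _ e3)[n _ /(_ n (leqnn n))/= h]] : P (U n) @[n --> \oo] --> (Pr (\bigcup_n C n))%:E.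
    by rewrite -PrE.
  by exists n; apply: le_trans (ler_norm _) h.
have mixU : mixes F (U n).
  elim: n {hn} => [|n IH].
    move=> e e_0; exists fset0 => g _; rewrite /U big_ord0 set0I /Pr measure0 mul0r subrr normr0; exact: ltW.
  rewrite /U big_ord_recr /=; apply: mixesU (mUn n) (mC n) _ IH (mixC n).
  apply/seteqP; split=> // om []; rewrite /U -bigcup_mkord => -[i /= ilt Ci] Cn.
  have /trivIsetP/(_ i n Logic.I Logic.I) := tC; rewrite (ltn_eqF ilt) => /(_ isT) e.
  by have : (C i `&` C n) om by []; rewrite e.
have [H hH] := mixU _ (divr_gt0 e0 (ltr0n R 3)).
exists H => g /hH {hH}; set B := cyl (translate g F); move: hn.
have sub : U n `<=` \bigcup_n C n by rewrite -UE; exact: bigcup_sup.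
have mB : measurable B by exact: mcyl.
have mD : measurable (\bigcup_n C n `\` U n) by exact: measurableD.
have split X : measurable X ->
    Pr (\bigcup_n C n `&` X) = Pr (U n `&` X) + Pr ((\bigcup_n C n `\` U n) `&` X).
  move=> mX; rewrite -PrU; try exact: measurableI.
    by rewrite -setIUl setDUK.
  by apply/seteqP; split=> // om [[u _] [[_ nu] _]].
have := split _ mB; have := split setT measurableT; rewrite !setIT => -> ->.
set d := Pr (_ `\` _); set v := Pr (U n `&` B); set d' := Pr (_ `&` B); set u := Pr (U n).
have d'd : d' <= d.
  have mDB := measurableI _ _ mD mB; rewrite /d' /d -lee_fin -(PrE mD) -(PrE mDB).
  by apply: le_measure; rewrite ?inE//; exact: mD.
have d'0 : 0 <= d' by exact: Pr_ge0.
have c0 : 0 <= Pr (cyl F) by exact: Pr_ge0.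
have c1 : Pr (cyl F) <= 1 by rewrite -lee_fin -PrE// probability_le1.
move: c0 c1; set c := Pr (cyl F) => c0 c1.
rewrite addrAC subrr add0r => dle; rewrite !ler_norml => /andP[h1 h2].
have dc0 : 0 <= d * c by rewrite mulr_ge0// (le_trans d'0).
have dc1 : d * c <= d by rewrite ler_piMr// (le_trans d'0).
by apply/andP; split; rewrite mulrDl; lra.
Qed.

Let mixesP F C : measurable C -> mixes F C.
Proof.
rewrite cyl_generate => mC; apply: (dynkin_induction (G := range (@cyl G))) mC => //.
- exact: cyl_generate.
- exact: cyl_setI.
- by rewrite -cyl0; exact: mixes_cyl.
- by move=> _ [K _ <-]; exact: mixes_cyl.
- by move=> S mS; exact: mixesC.
- by move=> C' mC' tC' mixC'; exact: mixes_bigcup.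
Qed.

(** An event invariant under automorphisms that move finite sets of edges off
   each other is independent of every cylinder, hence of itself. *)
Lemma zero_one A (Gam : aut G -> Prop) : measurable A ->
  (forall g, Gam g -> act g @^-1` A = A) ->
  (forall F H, exists2 g, Gam g & forall e, e \in F -> eact g e \notin H) ->
  P A = 0%E \/ P A = 1%E.
Proof.
move=> mA inv far.
have ind F : Pr (A `&` cyl F) = Pr A * Pr (cyl F).
  apply/eqP; rewrite -subr_eq0 -normr_le0; apply/ler_addgt0Pr => eps e0; rewrite add0r.
  have [H hH] := mixesP F mA e0; have [g Gg gF] := far F H.
  apply: le_trans (hH g gF); rewrite le_eqVlt; apply/orP; left; apply/eqP.
  congr (`|_ - _|); apply: esym; rewrite /Pr -[in LHS](P_act P_bernoulli g); last exact: measurableI.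
  congr (fine (P _)); rewrite preimage_setI inv//; congr (_ `&` _).
  apply/seteqP; split=> om h e eF.
    by have := h (eact g e); rewrite /act eactK; apply; rewrite /translate; exact: in_imfset.
  by move: eF; rewrite /translate => /imfsetP[f /= fF ->]; rewrite /act eactK; exact: h.
have Pr0 := Pr_ge0 A.
have : P (A `&` A) = ((Pr A)%:E * P A)%E.
  have := @measure_eq_cyl _ R (mrestr P mA) (mscale (NngNum Pr0) P).
  rewrite {1}/mrestr /= /mrestr /mscale /= => /(_ _ _ A mA); apply.
    by rewrite setTI; apply: le_lt_trans (probability_le1 _ _) _; rewrite ?ltry.
  by move=> F; rewrite setIC !PrE//; [rewrite ind EFinM|exact: measurableI].
rewrite setIid PrE// -EFinM => -[] /eqP; rewrite -subr_eq0 -{1}[Pr A]mul1r -mulrBl mulf_eq0.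
by rewrite subr_eq0 => /orP[/eqP<-|/eqP->]; [right|left].
Qed.

End ZeroOne.

(** * Levels: percolation times Lebesgue measure *)

Section Scaling.
Variable R : realType.
Let lam : {measure set (measurableTypeR R) -> \bar R} := lebesgue_measure.

Lemma measurable_scale (c : R) : measurable_fun setT (fun t : measurableTypeR R => c * t : measurableTypeR R).
Proof. by apply: measurable_funM => //; exact: measurable_cst. Qed.

Lemma lebesgue_scale (c : R) (A : set (measurableTypeR R)) : 0 < c -> measurable A ->
  (c%:E * lam ((fun t => (c * t)%R) @^-1` A) = lam A)%E.
Proof.
move=> c0 mA; have c0' := ltW c0.
pose f : {mfun measurableTypeR R >-> measurableTypeR R} := mfun_Sub (mem_set (measurable_scale c)).
apply/esym; apply: (lebesgue_measure_unique (mu := mscale (NngNum c0') (pushforward lam f))) => //.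
move=> _ [[a b] _ <-]; rewrite /= /mscale /= /pushforward.
have -> : f @^-1` `]a, b]%classic = `](c^-1 * a), (c^-1 * b)]%classic.
  apply/seteqP; split=> t /=; rewrite !in_itv /= [c^-1 * a]mulrC [c^-1 * b]mulrC ltr_pdivrMr// ler_pdivlMr// mulrC//.
rewrite /lam !lebesgue_measure_itv /= !lte_fin ltr_pM2l ?invr_gt0//.
case: ifP => _; last by rewrite mule0.
by rewrite -!EFinB -EFinM -mulrBr mulrA divff ?mul1r// gt_eqF.
Qed.

End Scaling.

Section ProductUnique.
Context d1 d2 (T1 : measurableType d1) (T2 : measurableType d2) (R : realType).

Lemma product_measure_map (m1 : {sigma_finite_measure set T1 -> \bar R})
    (m2 : {sigma_finite_measure set T2 -> \bar R})
    (f1 : T1 -> T1) (f2 : T2 -> T2) (c : R) :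
  measurable_fun setT f1 -> measurable_fun setT f2 -> 0 <= c ->
  (forall A, measurable A -> m1 (f1 @^-1` A) = m1 A) ->
  (forall A, measurable A -> (c%:E * m2 (f2 @^-1` A) = m2 A)%E) ->
  forall E, measurable E ->
    (c%:E * (m1 \x m2) ((fun x : T1 * T2 => (f1 x.1, f2 x.2)) @^-1` E) = (m1 \x m2) E)%E.
Proof.
move=> mf1 mf2 c0 e1 e2 E mE.
have mf : measurable_fun setT (fun x : T1 * T2 => (f1 x.1, f2 x.2)).
  by apply/measurable_fun_pair; [exact: measurableT_comp mf1 measurable_fst|exact: measurableT_comp mf2 measurable_snd].
pose f : {mfun (T1 * T2)%type >-> (T1 * T2)%type} := mfun_Sub (mem_set mf).
apply/esym; apply: (product_measure_unique (m' := mscale (NngNum c0) (pushforward (m1 \x m2)%E f))) => //.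
move=> A1 A2 mA1 mA2; rewrite /= /mscale /= /pushforward.
rewrite (_ : f @^-1` _ = (f1 @^-1` A1) `*` (f2 @^-1` A2))//.
have m1' : measurable (f1 @^-1` A1) by rewrite -[X in measurable X]setTI; exact: mf1.
have m2' : measurable (f2 @^-1` A2) by rewrite -[X in measurable X]setTI; exact: mf2.
transitivity (c%:E * (m1 (f1 @^-1` A1) * m2 (f2 @^-1` A2)))%E.
  by congr (_ * _)%E; exact: product_measure1E.
by rewrite e1// muleCA e2.
Qed.

End ProductUnique.

Section NullSections.
Context d1 d2 (T1 : measurableType d1) (T2 : measurableType d2) (R : realType).
Variables (m1 : {measure set T1 -> \bar R}) (m2 : {sigma_finite_measure set T2 -> \bar R}).

(** The form of Fubini's theorem in which almost sure statements are moved between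
   a product and its factors. *)
Lemma null_xsection (N : set (T1 * T2)) : measurable N -> (m1 \x m2)%E N = 0%E <->
  {ae m1, forall x, m2 (xsection N x) = 0%E}.
Proof.
move=> mN; have mf := measurable_fun_xsection m2 mN.
have e0 : ((m1 \x m2) N = \int[m1]_x `|(m2 \o xsection N) x|)%E.
  by apply: eq_integral => x _; rewrite gee0_abs.
rewrite e0 (ae_eq_integral_abs m1 measurableT mf).
by split; apply: filterS => x /=; [move=> /(_ Logic.I)|].
Qed.

End NullSections.

(** What the probabilistic part uses of the weights [w] and the modular function
   [D]: scaling, mass transport with representatives [os] of the orbits, and
   uniform local bounds. *)
Record transports (R : realType) (G : sgraph) (w : G -> R) (D : aut G -> R) (os : seq G) : Prop := {
  tr_pos : forall x, 0 < w x;
  tr_mod : forall (g : aut G) (x : G), w (g x) = D g * w x;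
  tr_out : forall (f : G -> G -> R), (forall x y, 0 <= f x y) ->
    (forall (g : aut G) x y, f (g x) (g y) = D g * f x y) -> forall a,
    (\esum_(z in [set: G]) (f a z / w a)%:E <=
     \sum_(o <- os) \esum_(y in [set: G]) (f y o / w o)%:E)%E;
  tr_reps : forall (f : G -> G -> R), (forall x y, 0 <= f x y) ->
    (forall (g : aut G) x y, f (g x) (g y) = D g * f x y) ->
    (\sum_(o <- os) \esum_(z in [set: G]) (f o z / w o)%:E =
     \sum_(o <- os) \esum_(y in [set: G]) (f y o / w o)%:E)%E;
  tr_orbit : forall x, exists2 o, o \in os & exists g : aut G, g o = x;
  tr_ball : forall r, exists n, forall x : G, at_most n (gdist_le r x);
  tr_adj : exists2 k : R, 0 < k & forall x y : G, adj x y -> w x <= k * w y }.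

Section System.
Variables (R : realType) (G : sgraph).
Hypotheses (conn : connected_graph G) (lf : locally_finite G).
Variables (w : G -> R) (D : aut G -> R) (os : seq G).
Hypothesis tr : transports w D os.
Variables (p q : R) (P Q : probability (config G) R).
Hypotheses (bP : bernoulli_percolation p P) (bQ : bernoulli_percolation q Q).
Implicit Types (a b x y z : G) (g : aut G).
Let cG := countable_vertex conn lf.
Let lam : {sigma_finite_measure set (measurableTypeR R) -> \bar R} := lebesgue_measure.

(** A point of the system is a configuration, an independent second configuration
   used as a source of marks, and a level. *)
Definition sys : Type := ((config G * config G) * measurableTypeR R)%type.
HB.instance Definition _ := Measurable.on sys.

Definition mu : {measure set sys -> \bar R} := ((P \x Q) \x lam)%E.

Definition state (t : sys) : rel G := open_adj t.1.1.
Definition marks (t : sys) : rel G := open_adj t.1.2.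
Definition level (t : sys) : R := t.2.
Definition sact g (t : sys) : sys := ((act g t.1.1, act g t.1.2), D g * t.2).

(** A vertex is visible for a set of levels of Lebesgue measure its weight. Thus
   counting visible vertices is weighing them, and the set of visible vertices is
   invariant when levels are scaled by the modular function. *)
Definition vis x (t : sys) : Prop := 0 < level t <= w x.

Lemma modulus_gt0 g x : 0 < D g.
Proof.
have := tr_pos tr (g x); rewrite (tr_mod tr) pmulr_lgt0//; exact: tr_pos tr x.
Qed.

Lemma vis_measurable x : measurable [set t | vis x t].
Proof.
rewrite (_ : [set t | vis x t] = setT `*` `]0, w x]%classic).
  by apply: measurableX => //; exact: measurable_itv.
by apply/seteqP; split=> t; rewrite /vis /= in_itv/= => // -[].
Qed.

Lemma mu_rect (A B : set (config G)) (C : set (measurableTypeR R)) :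
  measurable A -> measurable B -> measurable C ->
  mu ((A `*` B) `*` C) = (P A * Q B * lam C)%E.
Proof.
move=> mA mB mC; rewrite /mu /=.
transitivity ((P \x Q)%E (A `*` B) * lam C)%E; first by apply: product_measure1E => //; exact: measurableX.
by congr (_ * _)%E; exact: product_measure1E.
Qed.

Lemma lam_oc (c : R) : 0 < c -> lam `]0, c]%classic = c%:E.
Proof.
move=> c0; have := lebesgue_measure_itv (Interval (BRight 0) (BRight c)).
by rewrite /= lte_fin c0 oppr0 adde0.
Qed.

Lemma lam_oo (c : R) : 0 < c -> lam `]0, c[%classic = c%:E.
Proof.
move=> c0; have := lebesgue_measure_itv (Interval (BRight 0) (BLeft c)).
by rewrite /= lte_fin c0 oppr0 adde0.
Qed.

Lemma mu_vis x : mu [set t | vis x t] = (w x)%:E.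
Proof.
rewrite (_ : [set t | vis x t] = (setT `*` setT) `*` `]0, w x]%classic).
  by rewrite mu_rect// !probability_setT !mul1e lam_oc//; exact: tr_pos tr x.
by apply/seteqP; split=> t; rewrite /vis /= in_itv/= => // -[].
Qed.

(** The factor is the one by which weights scale, so the measures of an invariant
   family of events are of the form that mass transport handles. *)
Lemma mu_sact g x (E : set sys) : measurable E -> ((D g)%:E * mu (sact g @^-1` E) = mu E)%E.
Proof.
move=> mE; have Dg := modulus_gt0 g x.
have m2 : measurable_fun setT (fun c : config G * config G => (act g c.1, act g c.2)).
  apply/measurable_fun_pair; first exact: measurableT_comp (measurable_act g) measurable_fst.
  exact: measurableT_comp (measurable_act g) measurable_snd.
have inv2 A : measurable A -> (P \x Q)%E ((fun c => (act g c.1, act g c.2)) @^-1` A) = (P \x Q)%E A.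
  move=> mA; rewrite -[LHS]mul1e.
  have eQ B : measurable B -> (1%:E * Q (act g @^-1` B))%E = Q B.
    by move=> mB; rewrite mul1e (P_act bQ).
  exact: (@product_measure_map _ _ _ _ _ P Q (act g) (act g) 1 (measurable_act g)
    (measurable_act g) ler01 (P_act bP g) eQ A mA).
pose PQ : probability (config G * config G)%type R := (P \x Q)%E.
have h := (@product_measure_map _ _ _ _ _ PQ lam _ (fun t => D g * t) (D g) m2
  (measurable_scale (D g)) (ltW Dg) inv2 (fun A mA => lebesgue_scale Dg mA) E mE).
exact: h.
Qed.

(** A kernel is a transport of mass: [x] sends unit mass to [y] where [K x y t]. *)
Record kernel (K : G -> G -> sys -> Prop) : Prop := {
  ker_meas : forall x y, measurable [set t | K x y t];
  ker_inv : forall g x y t, K (g x) (g y) (sact g t) <-> K x y t;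
  ker_vis : forall x y t, K x y t -> vis x t /\ vis y t }.

Section Kernel.
Variable K : G -> G -> sys -> Prop.
Hypothesis kK : kernel K.

Let f x y : R := fine (mu [set t | K x y t]).

Lemma kernel_fin x y : mu [set t | K x y t] = (f x y)%:E.
Proof.
rewrite fineK// ge0_fin_numE//; apply: le_lt_trans (ltry (w x)).
rewrite -mu_vis; apply: le_measure; rewrite ?inE.
- exact: ker_meas.
- exact: vis_measurable.
- by move=> t /(ker_vis kK)[].
Qed.

Lemma kernel_ge0 x y : 0 <= f x y. Proof. by rewrite fine_ge0. Qed.

Lemma kernel_equi g x y : f (g x) (g y) = D g * f x y.
Proof.
apply: EFin_inj; rewrite EFinM -!kernel_fin -(mu_sact g x) ; last exact: ker_meas.
congr (_ * mu _)%E; apply/seteqP; split=> t /=; first by move/(ker_inv kK).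
by move=> h; exact/(ker_inv kK).
Qed.

Lemma column_le (F : G -> set sys) n x : measurable (F x) ->
  (forall y t, K y x t -> F x t) ->
  (forall t, F x t -> at_most n (fun y => K y x t)) ->
  (\esum_(y in [set: G]) mu [set t | K y x t] <= n%:R%:E * mu (F x))%E.
Proof.
move=> mF KF cnt; apply: sum_measure_le => //; first by move=> y; exact: ker_meas.
Qed.

Lemma esum_div (a : G -> R) c : 0 < c -> (forall x, 0 <= a x) ->
  (\esum_(x in [set: G]) (a x / c)%:E = (c^-1)%:E * \esum_(x in [set: G]) (a x)%:E)%E.
Proof.
move=> c0 a0; rewrite -esumZ//; last by rewrite invr_ge0 ltW.
by apply: eq_esum => x _; rewrite -EFinM mulrC.
Qed.

(** A vertex [x] receives at most [n * w x] in total, that is [n] per unit weight, and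
   mass transport bounds what is sent per unit weight by what the finitely many
   representatives receive. *)
Lemma mass_sent_fin n a : (forall x t, at_most n (fun y => K y x t)) ->
  (\esum_(x in [set: G]) mu [set t | K a x t] < +oo)%E.
Proof.
move=> cnt.
have col x : (\esum_(y in [set: G]) (f y x / w x)%:E <= n%:R%:E)%E.
  rewrite esum_div ?(tr_pos tr)//; last by move=> y; exact: kernel_ge0.
  have -> : (\esum_(y in [set: G]) (f y x)%:E = \esum_(y in [set: G]) mu [set t | K y x t])%E.
    by apply: eq_esum => y _; rewrite kernel_fin.
  rewrite lee_pdivrMl ?(tr_pos tr)//; apply: le_trans (@column_le (fun x => [set t | vis x t]) n x _ _ _) _.
  - exact: vis_measurable.
  - by move=> y t /(ker_vis kK)[].
  - by [].
  - by rewrite mu_vis -!EFinM mulrC.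
have := tr_out tr kernel_ge0 kernel_equi a.
rewrite esum_div ?(tr_pos tr)//; last by move=> y; exact: kernel_ge0.
have -> : (\esum_(x in [set: G]) (f a x)%:E = \esum_(x in [set: G]) mu [set t | K a x t])%E.
  by apply: eq_esum => y _; rewrite kernel_fin.
move=> h; have : (((w a)^-1)%:E * (\esum_(x in [set: G]) mu [set t | K a x t]) < +oo)%E.
  apply: le_lt_trans h _; apply: (@le_lt_trans _ _ (\sum_(o <- os) n%:R%:E)%E).
    by apply: lee_sum => o _; exact: col.
  by rewrite sumEFin ltry.
case: (\esum_(_ in _) _)%E => [r|//|//]; rewrite ?ltry//.
by rewrite mulry gtr0_sg ?mul1e ?ltxx// invr_gt0; exact: tr_pos tr a.
Qed.

(** The heart of the nonunimodular mass transport: if each visible vertex receives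
   from boundedly many visible vertices, then the expected weight that [a] sends is
   finite, so almost surely [a] sends to finitely many visible vertices. *)
Lemma visible_finite n : (forall x t, at_most n (fun y => K y x t)) ->
  {ae mu, forall t, forall a, ~ infinitely (fun x => K a x t)}.
Proof.
move=> cnt.
suff all_a : forall a, {ae mu, forall t, ~ infinitely (fun x => K a x t)}.
  pose c := code cG; have : {ae mu, forall t, forall k a, decode cG k = Some a -> ~ infinitely (fun x => K a x t)}.
    apply/ae_foralln => k; case e : (decode cG k) => [b|]; last by apply: aeW => t a.
    by apply: filterS (all_a b) => t h a [<-].
  by apply: filterS => t h a; apply: (h (code cG a)); exact: codeK.
move=> a; have mi x : measurable_fun setT (fun t => (\1_[set t | K a x t] t)%:E : \bar R).
  by apply/measurable_EFinP; apply: measurable_indic; exact: ker_meas.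
have i0 x t : (0 <= (\1_[set t | K a x t] t)%:E :> \bar R)%E by rewrite lee_fin.
have := @esum_ae R G cG _ sys mu (fun x t => (\1_[set t | K a x t] t)%:E) mi i0.
rewrite (_ : \esum_(x in [set: G]) _ = \esum_(x in [set: G]) mu [set t | K a x t])%E; last first.
  by apply: eq_esum => x _; rewrite integral_indic ?setIT//; exact: ker_meas.
move=> /(_ (mass_sent_fin a cnt)); apply: filterS => t fin.
apply: (esum_finite (fun x => i0 x t) fin) => x Kx.
by rewrite indicE mem_set.
Qed.

End Kernel.

(** By Fubini's theorem the bad levels of almost every configuration are null, and
   what is claimed at a given level can be derived from a lower one. *)
Lemma ae_levels (N : set sys) : mu.-negligible N ->
  {ae (P \x Q)%E, forall c, forall t : R, 0 < t -> exists2 t', 0 < t' < t & ~ N (c, t')}.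
Proof.
move=> [N' [mN' N0 NN']].
have /(null_xsection (P \x Q)%E lam mN') := N0.
apply: filterS => c N'c t t0; apply: contrapT => no.
have sub : `]0, t[%classic `<=` xsection N' c.
  move=> t' /=; rewrite in_itv /= => /andP[t'0 t't]; rewrite /xsection /= inE.
  by apply: NN'; apply: contrapT => h; apply: no; exists t'; rewrite ?t'0.
have : (lam `]0%R, t[%classic <= lam (xsection N' c))%E.
  by apply: le_measure; rewrite ?inE; [exact: measurable_itv|exact: measurable_xsection|].
by rewrite N'c lam_oo// lee_fin leNgt t0.
Qed.

Lemma ae_fst (N : set (config G)) : (P \x Q)%E.-negligible [set c | N c.1] -> P.-negligible N.
Proof.
move=> [N' [mN' N0 NN']]; have /(null_xsection P Q mN') := N0.
apply: negligibleS => om Nom /= h.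
have : xsection N' om = setT.
  by apply/seteqP; split=> // S _; rewrite /xsection /= inE; exact: NN'.
by move=> e; move: h; rewrite e probability_setT => /eqP; rewrite onee_eq0.
Qed.

End System.

(** * Measurability of random relations *)

Section MeasurablePredicates.
Context d (T : measurableType d).
Implicit Types (A B : T -> Prop).

(** Phrased for predicates rather than sets, so that measurability can be proved
   by recursion over the logical structure of a definition: all quantifiers that
   occur range over countable types. *)
Definition mp A : Prop := measurable [set t | A t].

Lemma mp_iff A B : (forall t, A t <-> B t) -> mp B -> mp A.
Proof. by move=> AB; rewrite /mp (_ : [set t | A t] = [set t | B t])//; apply/seteqP; split=> t /AB. Qed.

Lemma mp_const (c : Prop) : mp (fun=> c).
Proof.
have [hc|hc] := pselect c; first by apply: (@mp_iff _ (fun=> True)) => //; exact: measurableT.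
by apply: (@mp_iff _ (fun=> False)) => //; rewrite /mp (_ : mkset _ = set0)//; apply/seteqP; split.
Qed.

Lemma mp_not A : mp A -> mp (fun t => ~ A t).
Proof. by move=> mA; exact: measurableC. Qed.

Lemma mp_and A B : mp A -> mp B -> mp (fun t => A t /\ B t).
Proof. exact: measurableI. Qed.

Lemma mp_or A B : mp A -> mp B -> mp (fun t => A t \/ B t).
Proof. exact: measurableU. Qed.

Lemma mp_imp A B : mp A -> mp B -> mp (fun t => A t -> B t).
Proof.
move=> mA mB; apply: mp_iff (mp_or (mp_not mA) mB) => t.
by split=> [h|[//|//]]; have [/h|] := pselect (A t); [right|left].
Qed.

Lemma mp_and3 A B (C : T -> Prop) : mp A -> mp B -> mp C -> mp (fun t => [/\ A t, B t & C t]).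
Proof.
by move=> mA mB mC; apply: mp_iff (mp_and mA (mp_and mB mC)) => t; split=> [[]|[? []]].
Qed.

Lemma mp_and4 A B (C C' : T -> Prop) : mp A -> mp B -> mp C -> mp C' ->
  mp (fun t => [/\ A t, B t, C t & C' t]).
Proof.
by move=> mA mB mC mC'; apply: mp_iff (mp_and mA (mp_and3 mB mC mC')) => t; split=> [[]|[? []]].
Qed.

Lemma mp_and5 A B (C C' C'' : T -> Prop) : mp A -> mp B -> mp C -> mp C' -> mp C'' ->
  mp (fun t => [/\ A t, B t, C t, C' t & C'' t]).
Proof.
by move=> mA mB mC mC' mC''; apply: mp_iff (mp_and mA (mp_and4 mB mC mC' mC'')) => t;
  split=> [[]|[? []]].
Qed.

Lemma mp_ex (I : choiceType) (cI : countable [set: I]) (F : T -> I -> Prop) :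
  (forall i, mp (fun t => F t i)) -> mp (fun t => exists i, F t i).
Proof.
move=> mF; pose F' n t := if decode cI n is Some i then F t i else False.
apply: (@mp_iff _ (fun t => exists n, F' n t)).
  move=> t; split=> [[i Fi]|[n]]; first by exists (code cI i); rewrite /F' codeK.
  by rewrite /F'; case: decode => // i Fi; exists i.
rewrite /mp (_ : mkset _ = \bigcup_n [set t | F' n t]).
  apply: bigcupT_measurable => n; rewrite /F'; case: decode => [i|]; first exact: mF.
  exact: mp_const.
by apply/seteqP; split=> t [n]; exists n.
Qed.

Lemma mp_ex2 (I : choiceType) (cI : countable [set: I]) (F H : T -> I -> Prop) :
  (forall i, mp (fun t => F t i)) -> (forall i, mp (fun t => H t i)) ->
  mp (fun t => exists2 i, F t i & H t i).
Proof.
move=> mF mH; apply: (@mp_iff _ (fun t => exists i, F t i /\ H t i)).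
  by move=> t; split=> [[i]|[i []]]; exists i.
by apply: mp_ex => // i; exact: mp_and.
Qed.

Lemma mp_all (I : choiceType) (cI : countable [set: I]) (F : T -> I -> Prop) :
  (forall i, mp (fun t => F t i)) -> mp (fun t => forall i, F t i).
Proof.
move=> mF; apply: (@mp_iff _ (fun t => ~ exists i, ~ F t i)).
  by move=> t; split=> [h [i]|h i]; [apply; exact: h|apply: contrapT => n; apply: h; exists i].
by apply: mp_not; apply: mp_ex => // i; apply: mp_not.
Qed.

Lemma mp_andb (a b : T -> bool) : mp (fun t => a t) -> mp (fun t => b t) ->
  mp (fun t => a t && b t).
Proof.
move=> ma mb; apply: mp_iff (mp_and ma mb) => t; by split=> [/andP|/andP].
Qed.

Lemma mp_negb (a : T -> bool) : mp (fun t => a t) -> mp (fun t => ~~ a t).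
Proof. by move=> ma; apply: mp_iff (mp_not ma) => t; split=> /negP. Qed.

Lemma mp_asbool A : mp A -> mp (fun t => `[< A t >]).
Proof. by apply: mp_iff => t; split=> /asboolP. Qed.

End MeasurablePredicates.

Lemma countable_seqs (I : choiceType) : countable [set: I] -> countable [set: seq I].
Proof.
move=> cI; apply/countable_injP; exists (fun s => choice.pickle (map (code cI) s)) => s s' _ _.
by move=> /(pcan_inj choice.pickleK)/(inj_map (@code_inj _ cI)).
Qed.

Lemma countable_nats : countable [set: nat].
Proof. by apply/countable_injP; exists id => x y _ _. Qed.

Ltac mstep cdb := match goal with
  | |- mp (fun _ => ?c) => exact: mp_const
  | |- mp (fun t => is_true (_ && _)) => apply: mp_andb
  | |- mp (fun t => is_true (~~ _)) => apply: mp_negb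
  | |- mp (fun t => is_true (`[< _ >])) => apply: mp_asbool
  | |- mp (fun t => _ /\ _) => apply: mp_and
  | |- mp (fun t => _ \/ _) => apply: mp_or
  | |- mp (fun t => and3 _ _ _) => apply: mp_and3
  | |- mp (fun t => and4 _ _ _ _) => apply: mp_and4
  | |- mp (fun t => and5 _ _ _ _ _) => apply: mp_and5
  | |- mp (fun t => ~ _) => apply: mp_not
  | |- mp (fun t => ex _) => apply: mp_ex; [by cdb|intros ?; cbv beta]
  | |- mp (fun t => ex2 _ _) => apply: mp_ex2; [by cdb|intros ?; cbv beta|intros ?; cbv beta]
  | |- mp (fun t => (_ : Prop) -> _) => apply: mp_imp
  | |- mp (fun t => forall x : _, _) => apply: mp_all; [by cdb|intros ?; cbv beta]
  end.

Section RandomGraphs.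
Context d (T : measurableType d).
Variables (R : realType) (G : sgraph).
Hypotheses (conn : connected_graph G) (lf : locally_finite G).
Variable w : G -> R.
Let cG := countable_vertex conn lf.
Let cS := countable_seqs cG.
Let cN := countable_nats.

Ltac cdb := first [exact: cG | exact: cS | exact: cN].
Ltac ms := repeat mstep cdb.

Definition mrel (o : T -> rel G) := forall u v, mp (fun t => o t u v).

Lemma mp_path o x s : mrel o -> mp (fun t => path (o t) x s).
Proof. by move=> mo; elim: s x => [|y s IH] x /=; [exact: mp_const|apply: mp_andb]. Qed.

Lemma mp_reach o x y : mrel o -> mp (fun t => reachable (o t) x y).
Proof. by move=> mo; rewrite /reachable; ms; exact: mp_path. Qed.

Lemma mp_infinitely (F : T -> G -> Prop) : (forall x, mp (fun t => F t x)) ->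
  mp (fun t => infinitely (F t)).
Proof. by move=> mF; rewrite /infinitely; ms. Qed.

Lemma mp_at_most n (F : T -> G -> Prop) : (forall x, mp (fun t => F t x)) ->
  mp (fun t => at_most n (F t)).
Proof. by move=> mF; rewrite /at_most; ms. Qed.

Lemma mrel_delv o y : mrel o -> mrel (fun t => delv (o t) y).
Proof. by move=> mo u v; rewrite /delv /=; ms. Qed.

Lemma mrel_off o m : mrel o -> mrel (fun t => off (o t) m).
Proof. by move=> mo u v; rewrite /off /=; ms; exact: mp_reach. Qed.

Definition mlevel (l : T -> R) := forall c : R, mp (fun t => l t <= c).

Lemma mp_contact o l a b x : mrel o -> mlevel l -> mp (fun t => contact w (o t) (l t) a b x).
Proof. by move=> mo ml; rewrite /contact; ms; first [exact: mp_reach|exact: ml]. Qed.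

(** Levels may be taken in a countable set. *)
Lemma meetE o a b : meet w o a b <->
  ~ reachable o a b /\ exists n : nat, infinitely (contact w o n.+1%:R^-1 a b).
Proof.
split=> -[nab]; last by move=> [n h]; split=> //; exists n.+1%:R^-1.
move=> [t t0 h]; split=> //; exists (Num.bound t^-1).
apply: infinitely_sub h => x; apply: contact_le.
rewrite invf_ple ?posrE// ltW//; apply: lt_le_trans (_ : (Num.bound t^-1)%:R <= _); last by rewrite ler_nat.
by apply: archi_boundP; rewrite invr_ge0 ltW.
Qed.

Lemma mp_meet o a b : mrel o -> mp (fun t => meet w (o t) a b).
Proof.
move=> mo; apply: mp_iff (fun t => meetE (o t) a b) _; ms; first exact: mp_reach.
by apply: mp_infinitely => x; apply: mp_contact => // c; exact: mp_const.
Qed.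

Lemma mp_arm o l b y x : mrel o -> mlevel l -> mp (fun t => arm w (o t) (l t) b y x).
Proof.
move=> mo ml; rewrite /arm; ms; first exact: mp_reach.
apply: mp_infinitely => z; ms; first by apply: mp_reach; exact: mrel_delv.
exact: mp_contact.
Qed.

Lemma mp_split3 o l b y : mrel o -> mlevel l -> mp (fun t => split3 w (o t) (l t) b y).
Proof.
move=> mo ml; rewrite /split3; ms; first [exact: ml|exact: mp_arm|apply: mp_reach => //; exact: mrel_delv].
Qed.

End RandomGraphs.

(** * The relations that drive the mass transports *)

Section Kernels.
Variables (R : realType) (G : sgraph) (w : G -> R).
Implicit Types (o s : rel G) (t : R) (a b c x y z m u v : G) (n r : nat).

(** In each kernel the vertex [a] sends mass to [x], and the definition makes the
   number of senders to one receiver bounded. In [ker_top] the heaviest contacts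
   between two clusters send to all contacts between them. *)
Definition touch o x y a := reachable o x a /\ exists c, adj a c /\ reachable o y c.
Definition top o x y a := touch o x y a /\ forall c, touch o x y c -> w c <= w a.
Definition ker_top n o a x := exists y,
  [/\ adj x y, ~ reachable o x y, top o x y a & at_most n (top o x y)].

(** The edges of [s] are marks, and a piece is a component of the cluster without
   the marked edges. In [ker_piece] the end [a] of a marked bridge sends to those
   vertices of its piece that have near them a vertex beyond the bridge. *)
Definition minus o s : rel G := [rel u v | o u v && ~~ s u v].
Definition cut o a b : rel G :=
  [rel u v | o u v && ~~ ((u == a) && (v == b) || (u == b) && (v == a))].
Definition ker_piece r o s a x := exists b, exists c,
  [/\ adj a b, o a b && s a b, gdist_le r x c, reachable (minus o s) x a &
      reachable (cut o a b) b c /\ ~ reachable (cut o a b) a b].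

(** A spot is a trifurcation near the other cluster; by the nearness only boundedly
   many clusters [b] concern a given spot. In [ker_near] the spot nearest to [x]
   sends to [x]. *)
Definition spot r o t b y := split3 w o t b y /\ exists c, reachable o b c /\ gdist_le r y c.
Definition odist o n x a := exists s : seq G, [/\ path o x s, last x s = a & (size s <= n)%N].
Definition ker_near r o t a x := exists b, adj x b /\ exists n,
  [/\ odist o n x a, spot r o t b a & forall c, spot r o t b c -> odist o n x c -> c = a].

(** Inside a piece the spots belonging to [b] are the nodes of a tree: removing a
   branching [branch3] leaves them in at least three classes, removing an end
   [end1] in one. *)
Definition spots r o s t b y z := reachable (minus o s) y z /\ spot r o t b z.
Definition branch3 o (V : G -> Prop) v := exists u0, exists u1, exists u2,
  [/\ [/\ V u0, V u1 & V u2], [/\ u0 != v, u1 != v & u2 != v],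
    ~ reachable (delv o v) u0 u1, ~ reachable (delv o v) u0 u2 &
    ~ reachable (delv o v) u1 u2].
Definition end1 o (V : G -> Prop) v := forall u, V u -> forall u', V u' ->
  u != v -> u' != v -> reachable (delv o v) u u'.
Definition exactly n (A : G -> Prop) := exists l : seq G,
  uniq l && (size l == n) /\ forall x, x \in l <-> A x.
(** The contact with [b] entails that the piece has finitely many spots; finiteness is
   recorded here so that the density estimate is deterministic. *)
Definition attached r o s t b y :=
  (exists a, exists c, [/\ reachable (minus o s) y a, adj a c, reachable o b c,
     t <= w a & t <= w c]) /\ exists n, exactly n (spots r o s t b y).
(** In [ker_branch] each branching sends to all ends of its piece. The number [n] of
   ends is fixed: a branching then sends [n], and an end receives less than a
   multiple of [n], as there are fewer branchings than ends. *)
Definition has_branch r n o s t y := exists b,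
  [/\ spots r o s t b y y, attached r o s t b y, branch3 o (spots r o s t b y) y &
      exactly n (fun v => spots r o s t b y v /\ end1 o (spots r o s t b y) v)].
Definition is_end r n o s t z := exists b,
  [/\ spots r o s t b z z, attached r o s t b z, end1 o (spots r o s t b z) z &
      exactly n (fun v => spots r o s t b z v /\ end1 o (spots r o s t b z) v)].
Definition ker_branch r n o s t y z := exists b,
  [/\ spots r o s t b y y, attached r o s t b y, branch3 o (spots r o s t b y) y,
      exactly n (fun v => spots r o s t b y v /\ end1 o (spots r o s t b y) v) &
      spots r o s t b y z /\ end1 o (spots r o s t b y) z].

(** If a cluster [m] has exactly two neighbours on one side, and these have finitely
   many contacts with each other, then those contacts form a finite set attached
   to [m]; in [ker_sel] they send to all the contacts with [m]. *)
Definition selected o m x x1 := [/\ meet w o x m, meet w o x1 m, ~ reachable o x x1,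
  reachable (off o m) x x1 & forall c, meet w o c m -> reachable (off o m) x c ->
    reachable o x c \/ reachable o x1 c].
Definition ker_sel n o t a x := exists m, exists x1,
  [/\ adj x m, selected o m x x1, contact w o t x x1 a & at_most n (contact w o t x x1)].

End Kernels.

Section KernelsMeasurable.
Context d (T : measurableType d).
Variables (R : realType) (G : sgraph).
Hypotheses (conn : connected_graph G) (lf : locally_finite G).
Variable w : G -> R.
Let cG := countable_vertex conn lf.
Let cS := countable_seqs cG.
Let cN := countable_nats.
Variables (o s : T -> rel G) (l : T -> R).
Hypotheses (mo : mrel o) (ms : mrel s) (ml : mlevel l).

Ltac cdb := first [exact: cG | exact: cS | exact: cN].

Lemma mrel_minus : mrel (fun t => minus (o t) (s t)).
Proof. by move=> u v; rewrite /minus /=; repeat mstep cdb. Qed.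
Lemma mrel_cut a b : mrel (fun t => cut (o t) a b).
Proof. by move=> u v; rewrite /cut /=; repeat mstep cdb. Qed.

Ltac leaf := first [exact: mo | exact: ms | exact: ml
  | (apply: (mp_reach conn lf); first [exact: mo | exact: mrel_minus | exact: mrel_cut
      | exact: mrel_delv | exact: (mrel_off conn lf)])
  | exact: (mp_path _ _ mo)
  | exact: (mp_contact conn lf) | exact: (mp_meet conn lf) | exact: (mp_split3 conn lf)
  | (apply: (mp_at_most conn lf); intros ?; cbv beta)].
Ltac go := repeat first [mstep cdb | leaf].

Lemma mp_top n a x : mp (fun t => ker_top w n (o t) a x).
Proof. by rewrite /ker_top /top /touch; go. Qed.
Lemma mp_piece r a x : mp (fun t => ker_piece r (o t) (s t) a x).
Proof. by rewrite /ker_piece; go. Qed.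
Lemma mp_spot r b y : mp (fun t => spot w r (o t) (l t) b y).
Proof. by rewrite /spot; go. Qed.
Lemma mp_odist n x a : mp (fun t => odist (o t) n x a).
Proof. by rewrite /odist; go. Qed.
Lemma mp_near r a x : mp (fun t => ker_near w r (o t) (l t) a x).
Proof. by rewrite /ker_near; repeat first [exact: mp_spot | exact: mp_odist | go]. Qed.
Lemma mp_spots r b y z : mp (fun t => spots w r (o t) (s t) (l t) b y z).
Proof. by rewrite /spots; repeat first [exact: mp_spot | go]. Qed.
Lemma mp_branch3 r b y v :
  mp (fun t => branch3 (o t) (spots w r (o t) (s t) (l t) b y) v).
Proof. by rewrite /branch3; repeat first [exact: mp_spots | go]. Qed.
Lemma mp_end1 r b y v :
  mp (fun t => end1 (o t) (spots w r (o t) (s t) (l t) b y) v).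
Proof. by rewrite /end1; repeat first [exact: mp_spots | go]. Qed.
Lemma mp_exactly n (A : T -> G -> Prop) : (forall x, mp (fun t => A t x)) ->
  mp (fun t => exactly n (A t)).
Proof. by move=> mA; rewrite /exactly; repeat first [exact: mA | rewrite /iff; go]. Qed.
Lemma mp_attached r b y : mp (fun t => attached w r (o t) (s t) (l t) b y).
Proof.
rewrite /attached; apply: mp_and; first by go.
apply: mp_ex; first exact: cN.
by move=> n; apply: mp_exactly => x; exact: mp_spots.
Qed.
Lemma mp_ends r b y n : mp (fun t => exactly n (fun v =>
  spots w r (o t) (s t) (l t) b y v /\ end1 (o t) (spots w r (o t) (s t) (l t) b y) v)).
Proof. by apply: mp_exactly => x; apply: mp_and; [exact: mp_spots|exact: mp_end1]. Qed.
Ltac go2 := repeat first [exact: mp_spots | exact: mp_attached | exact: mp_branch3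
  | exact: mp_ends | exact: mp_end1 | go].
Lemma mp_has_branch r n y : mp (fun t => has_branch w r n (o t) (s t) (l t) y).
Proof. by rewrite /has_branch; go2. Qed.
Lemma mp_is_end r n y : mp (fun t => is_end w r n (o t) (s t) (l t) y).
Proof. by rewrite /is_end; go2. Qed.
Lemma mp_branch r n y z : mp (fun t => ker_branch w r n (o t) (s t) (l t) y z).
Proof. by rewrite /ker_branch; go2. Qed.
Lemma mp_sel n a x : mp (fun t => ker_sel w n (o t) (l t) a x).
Proof. by rewrite /ker_sel /selected; go. Qed.

End KernelsMeasurable.

Section Equivariance.
Variables (R : realType) (G : sgraph) (w : G -> R) (g : aut G) (k : R).
Hypotheses (k0 : 0 < k) (wg : forall x, w (g x) = k * w x).

(* Invariance is proved by the same recursion: vertices in bound and free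
   positions are moved by [g], and levels are multiplied by [k]. *)
Lemma eqi_and (A A' B B' : Prop) : (A <-> A') -> (B <-> B') -> (A /\ B <-> A' /\ B').
Proof. tauto. Qed.
Lemma eqi_or (A A' B B' : Prop) : (A <-> A') -> (B <-> B') -> (A \/ B <-> A' \/ B').
Proof. tauto. Qed.
Lemma eqi_imp (A A' B B' : Prop) : (A <-> A') -> (B <-> B') -> ((A -> B) <-> (A' -> B')).
Proof. tauto. Qed.
Lemma eqi_not (A A' : Prop) : (A <-> A') -> (~ A <-> ~ A').
Proof. tauto. Qed.
Lemma eqi_and3 (A A' B B' C C' : Prop) : (A <-> A') -> (B <-> B') -> (C <-> C') ->
  ([/\ A, B & C] <-> [/\ A', B' & C']).
Proof. by move=> a b c; split=> -[]; split; tauto. Qed.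
Lemma eqi_and4 (A A' B B' C C' E E' : Prop) : (A <-> A') -> (B <-> B') -> (C <-> C') ->
  (E <-> E') -> ([/\ A, B, C & E] <-> [/\ A', B', C' & E']).
Proof. by move=> a b c e; split=> -[]; split; tauto. Qed.
Lemma eqi_and5 (A A' B B' C C' E E' F F' : Prop) : (A <-> A') -> (B <-> B') -> (C <-> C') ->
  (E <-> E') -> (F <-> F') -> ([/\ A, B, C, E & F] <-> [/\ A', B', C', E' & F']).
Proof. by move=> a b c e f; split=> -[]; split; tauto. Qed.
Lemma eqi_exG (A A' : G -> Prop) : (forall y, A' (g y) <-> A y) ->
  ((exists y, A' y) <-> (exists y, A y)).
Proof.
move=> h; split=> -[y]; last by move=> Ay; exists (g y); apply/h.
by rewrite -(autVK g y) => /h; exists (g^-1 y)%g.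
Qed.
Lemma eqi_allG (A A' : G -> Prop) : (forall y, A' (g y) <-> A y) ->
  ((forall y, A' y) <-> (forall y, A y)).
Proof. by move=> h; split=> H y; [apply/h|rewrite -(autVK g y); apply/h]. Qed.
Lemma eqi_ex2G (A A' B B' : G -> Prop) : (forall y, A' (g y) <-> A y) ->
  (forall y, B' (g y) <-> B y) -> ((exists2 y, A' y & B' y) <-> (exists2 y, A y & B y)).
Proof.
move=> h h'; split=> -[y]; last by move=> Ay By; exists (g y); [apply/h|apply/h'].
by rewrite -(autVK g y) => /h ? /h' ?; exists (g^-1 y)%g.
Qed.
Lemma map_autVK : cancel (map (g^-1)%g) (map g).
Proof. by move=> s; rewrite -map_comp map_id_in// => x _; exact: autVK. Qed.
Lemma eqi_exS (A A' : seq G -> Prop) : (forall y, A' (map g y) <-> A y) ->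
  ((exists y, A' y) <-> (exists y, A y)).
Proof.
move=> h; split=> -[y]; last by move=> Ay; exists (map g y); apply/h.
by rewrite -(map_autVK y) => /h; exists (map (g^-1)%g y).
Qed.
Lemma eqi_allS (A A' : seq G -> Prop) : (forall y, A' (map g y) <-> A y) ->
  ((forall y, A' y) <-> (forall y, A y)).
Proof. by move=> h; split=> H y; [apply/h|rewrite -(map_autVK y); apply/h]. Qed.
Lemma eqi_ex2S (A A' B B' : seq G -> Prop) : (forall y, A' (map g y) <-> A y) ->
  (forall y, B' (map g y) <-> B y) -> ((exists2 y, A' y & B' y) <-> (exists2 y, A y & B y)).
Proof.
move=> h h'; split=> -[y]; last by move=> Ay By; exists (map g y); [apply/h|apply/h'].
by rewrite -(map_autVK y) => /h ? /h' ?; exists (map (g^-1)%g y).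
Qed.
Lemma eqi_exN (A A' : nat -> Prop) : (forall y, A' y <-> A y) ->
  ((exists y, A' y) <-> (exists y, A y)).
Proof. by move=> h; split=> -[y /h]; exists y. Qed.

Definition requi (o' o : rel G) := forall x y, o' (g x) (g y) = o x y.

Lemma eqi_bool (a a' : bool) : a = a' -> (a <-> a').
Proof. by move=> ->. Qed.

Lemma eqi_path o' o x s : requi o' o -> path o' (g x) (map g s) = path o x s.
Proof. by move=> h; elim: s x => //= y s IH x; rewrite h IH. Qed.

Lemma eqi_mem x s : (g x \in map g s) = (x \in s).
Proof. exact: mem_map (@aut_inj _ g) _ _. Qed.

Lemma eqi_eq x y : (g x = g y) <-> (x = y).
Proof. by split=> [/aut_inj|->]. Qed.

Lemma eqi_eqb x y : (g x == g y) = (x == y).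
Proof. exact: inj_eq (@aut_inj _ g) _ _. Qed.

Ltac estep := match goal with
  | |- ?A <-> ?A => exact: iff_refl
  | |- (_ /\ _) <-> (_ /\ _) => apply: eqi_and
  | |- (_ \/ _) <-> (_ \/ _) => apply: eqi_or
  | |- and3 _ _ _ <-> and3 _ _ _ => apply: eqi_and3
  | |- and4 _ _ _ _ <-> and4 _ _ _ _ => apply: eqi_and4
  | |- and5 _ _ _ _ _ <-> and5 _ _ _ _ _ => apply: eqi_and5
  | |- (~ _) <-> (~ _) => apply: eqi_not
  | |- (is_true _) <-> (is_true _) => apply: eqi_bool; rewrite ?eqi_mem ?eqi_eqb ?aut_adj ?size_map; done
  | |- ex _ <-> ex _ => first [apply: eqi_exG; intros ? | apply: eqi_exS; intros ? | apply: eqi_exN; intros ?]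
  | |- ex2 _ _ <-> ex2 _ _ => first [apply: eqi_ex2G; intros ? | apply: eqi_ex2S; intros ?]
  | |- (_ -> _) <-> (_ -> _) => apply: eqi_imp
  | |- (forall _, _) <-> (forall _, _) => first [apply: eqi_allG; intros ? | apply: eqi_allS; intros ?]
  end.

Lemma eqi_last x s y : (last (g x) (map g s) = g y) <-> (last x s = y).
Proof. by rewrite last_map; exact: eqi_eq. Qed.

Lemma eqi_reach o' o x y : requi o' o -> (reachable o' (g x) (g y) <-> reachable o x y).
Proof.
move=> h; rewrite /reachable; apply: eqi_ex2S => s; last exact: eqi_last.
by rewrite (eqi_path _ _ h).
Qed.

Lemma eqi_gdist r x y : gdist_le r (g x) (g y) <-> gdist_le r x y.
Proof. by split=> [/(aut_gdist g^-1%g)|/(aut_gdist g)//]; rewrite !autK. Qed.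

Lemma eqi_infinitely (A' A : G -> Prop) : (forall x, A' (g x) <-> A x) ->
  (infinitely A' <-> infinitely A).
Proof. by move=> h; rewrite /infinitely; repeat first [apply: h | estep]. Qed.

Lemma eqi_at_most n (A' A : G -> Prop) : (forall x, A' (g x) <-> A x) ->
  (at_most n A' <-> at_most n A).
Proof. by move=> h; rewrite /at_most; repeat first [apply: h | estep]. Qed.

Lemma eqi_exactly n (A' A : G -> Prop) : (forall x, A' (g x) <-> A x) ->
  (exactly n A' <-> exactly n A).
Proof.
move=> h; rewrite /exactly; apply: eqi_exS => l; apply: eqi_and.
  by rewrite map_inj_uniq ?size_map//; exact: aut_inj.
by apply: eqi_allG => x; rewrite eqi_mem; split=> [[a b]|[a b]]; split=> [/a/h//|/h/b//].
Qed.

Lemma requi_delv o' o y : requi o' o -> requi (delv o' (g y)) (delv o y).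
Proof. by move=> h u v; rewrite /delv /= h !eqi_eqb. Qed.

Lemma requi_off o' o m : requi o' o -> requi (off o' (g m)) (off o m).
Proof.
move=> h u v; rewrite /off /= aut_adj; congr [&& _, ~~ _ & ~~ _];
by apply/asboolP/asboolP => /(eqi_reach _ _ h).
Qed.

Lemma requi_minus o' o s' s : requi o' o -> requi s' s -> requi (minus o' s') (minus o s).
Proof. by move=> h h' u v; rewrite /minus /= h h'. Qed.

Lemma requi_cut o' o a b : requi o' o -> requi (cut o' (g a) (g b)) (cut o a b).
Proof. by move=> h u v; rewrite /cut /= h !eqi_eqb. Qed.

Lemma eqi_w x y : (w (g x) <= w (g y)) <-> (w x <= w y).
Proof. by rewrite !wg ler_pM2l. Qed.

Lemma eqi_lev (t : R) x : (k * t <= w (g x)) <-> (t <= w x).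
Proof. by rewrite wg ler_pM2l. Qed.

Section Moved.
Variables (o' o s' s : rel G) (t : R).
Hypotheses (ho : requi o' o) (hs : requi s' s).

Ltac eleaf := first [exact: eqi_eq | exact: eqi_lev | exact: eqi_w | exact: eqi_gdist | exact: eqi_last
  | (apply: eqi_reach; first [exact: ho | exact: requi_delv | exact: requi_off
      | exact: requi_minus | exact: requi_cut])
  | (by rewrite (eqi_path _ _ ho))
  | (by rewrite ?ho ?hs)
  | (apply: eqi_infinitely; intros ?; cbv beta) | (apply: eqi_at_most; intros ?; cbv beta)].
Ltac ego := repeat first [estep | eleaf].

Lemma eqi_contact a b x : contact w o' (k * t) (g a) (g b) (g x) <-> contact w o t a b x.
Proof. by rewrite /contact; ego. Qed.
Lemma eqi_arm b y x : arm w o' (k * t) (g b) (g y) (g x) <-> arm w o t b y x.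
Proof. by rewrite /arm; repeat first [exact: eqi_contact | ego]. Qed.
Lemma eqi_split3 b y : split3 w o' (k * t) (g b) (g y) <-> split3 w o t b y.
Proof. by rewrite /split3; repeat first [exact: eqi_arm | ego]. Qed.
Lemma eqi_top n a x : ker_top w n o' (g a) (g x) <-> ker_top w n o a x.
Proof. by rewrite /ker_top /top /touch; ego. Qed.
Lemma eqi_piece r a x : ker_piece r o' s' (g a) (g x) <-> ker_piece r o s a x.
Proof. by rewrite /ker_piece; ego. Qed.
Lemma eqi_spot r b y : spot w r o' (k * t) (g b) (g y) <-> spot w r o t b y.
Proof. by rewrite /spot; repeat first [exact: eqi_split3 | ego]. Qed.
Lemma eqi_odist n x a : odist o' n (g x) (g a) <-> odist o n x a.
Proof. by rewrite /odist; ego. Qed.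
Lemma eqi_near r a x : ker_near w r o' (k * t) (g a) (g x) <-> ker_near w r o t a x.
Proof. by rewrite /ker_near; repeat first [exact: eqi_spot | exact: eqi_odist | ego]. Qed.
Lemma eqi_spots r b y z :
  spots w r o' s' (k * t) (g b) (g y) (g z) <-> spots w r o s t b y z.
Proof. by rewrite /spots; repeat first [exact: eqi_spot | ego]. Qed.
Lemma eqi_attached r b y : attached w r o' s' (k * t) (g b) (g y) <-> attached w r o s t b y.
Proof.
rewrite /attached; apply: eqi_and; first by ego.
by apply: eqi_exN => n; apply: eqi_exactly => x; exact: eqi_spots.
Qed.
Lemma eqi_branch3 r b y v : branch3 o' (spots w r o' s' (k * t) (g b) (g y)) (g v) <->
  branch3 o (spots w r o s t b y) v.
Proof. by rewrite /branch3; repeat first [exact: eqi_spots | ego]. Qed.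
Lemma eqi_end1 r b y v : end1 o' (spots w r o' s' (k * t) (g b) (g y)) (g v) <->
  end1 o (spots w r o s t b y) v.
Proof. by rewrite /end1; repeat first [exact: eqi_spots | ego]. Qed.
Lemma eqi_ends r b y n : exactly n (fun v => spots w r o' s' (k * t) (g b) (g y) v /\
    end1 o' (spots w r o' s' (k * t) (g b) (g y)) v) <->
  exactly n (fun v => spots w r o s t b y v /\ end1 o (spots w r o s t b y) v).
Proof. by apply: eqi_exactly => x; apply: eqi_and; [exact: eqi_spots|exact: eqi_end1]. Qed.
Ltac ego2 := repeat first [exact: eqi_spots | exact: eqi_attached | exact: eqi_branch3
  | exact: eqi_ends | exact: eqi_end1 | ego].
Lemma eqi_branch r n y z :
  ker_branch w r n o' s' (k * t) (g y) (g z) <-> ker_branch w r n o s t y z.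
Proof. by rewrite /ker_branch; ego2. Qed.
Lemma eqi_meet a b : meet w o' (g a) (g b) <-> meet w o a b.
Proof.
rewrite /meet; apply: eqi_and; first by ego.
split=> -[u u0 h].
  exists (k^-1 * u); first by rewrite mulr_gt0 ?invr_gt0.
  have := h; rewrite -{1}(mulVKf (lt0r_neq0 k0) u); apply: iffLR.
  by apply: eqi_infinitely => x; rewrite /contact; ego.
exists (k * u); first by rewrite mulr_gt0.
have := h; apply: iffRL.
by apply: eqi_infinitely => x; rewrite /contact; ego.
Qed.
Lemma eqi_sel n a x : ker_sel w n o' (k * t) (g a) (g x) <-> ker_sel w n o t a x.
Proof. by rewrite /ker_sel /selected; repeat first [exact: eqi_meet | exact: eqi_contact | ego]. Qed.

End Moved.
End Equivariance.

(** * Bounded degrees of the kernels *)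

Lemma at_most1 (T : eqType) (A : T -> Prop) : (forall x y, A x -> A y -> x = y) -> at_most 1 A.
Proof.
move=> uni; have [[x Ax]|no] := pselect (exists x, A x).
  by exists [:: x] => // y Ay; rewrite inE (uni _ _ Ay Ax).
by exists [::] => // x Ax; case: no; exists x.
Qed.

Lemma at_most_sub (T : eqType) n (A B : T -> Prop) :
  (forall x, A x -> B x) -> at_most n B -> at_most n A.
Proof. by move=> AB [s sn sP]; exists s => // x /AB/sP. Qed.

Lemma at_most_if (T : eqType) n (A : T -> Prop) : at_most n (fun x => A x /\ at_most n A).
Proof.
have [h|h] := pselect (at_most n A); first by apply: at_most_sub h => x [].
by exists [::] => // x [].
Qed.

Section KernelCounts.
Variables (R : realType) (G : sgraph) (w : G -> R).
Hypothesis ball : forall r, exists n, forall x : G, at_most n (gdist_le r x).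
Implicit Types (o s : rel G) (t : R) (a b c x y z m u v : G).

Lemma cut_sym o a b : symmetric o -> symmetric (cut o a b).
Proof. by move=> so u v; rewrite /cut /= so; congr (_ && ~~ _); rewrite orbC andbC [X in _ || X]andbC. Qed.

Lemma minus_sym o s : symmetric o -> symmetric s -> symmetric (minus o s).
Proof. by move=> so ss u v; rewrite /minus /= so ss. Qed.

Lemma minus_cut o s a b u v : symmetric s -> s a b -> reachable (minus o s) u v ->
  reachable (cut o a b) u v.
Proof.
move=> ss sab; apply: reach_mono => y z /andP[oyz nyz]; rewrite /cut /= oyz /=.
by apply: contra nyz => /orP[/andP[/eqP-> /eqP->]//|/andP[/eqP-> /eqP->]]; rewrite ss.
Qed.

(** On the ways from [x] to [c] the first marked bridge is the same for all of them,
   and only its near end is in the piece of [x]. *)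
Lemma piece_unique o s r c x a a' : substate o -> substate s ->
  let Q a := exists b, [/\ adj a b, o a b && s a b, gdist_le r x c,
    reachable (minus o s) x a & reachable (cut o a b) b c /\ ~ reachable (cut o a b) a b] in
  Q a -> Q a' -> a = a'.
Proof.
move=> [so _] [ss _] Q [b [_ /andP[oab sab] _ xa [bc nab]]] [b' [_ /andP[oab' sab'] _ xa' [bc' nab']]].
apply/eqP/negPn/negP => aa'.
have aa1 : reachable (cut o a b) a a'.
  by apply: reach_trans (minus_cut ss sab xa'); apply: reach_sym (minus_cut ss sab xa); exact: cut_sym.
have aa2 : reachable (cut o a' b') a a'.
  by apply: reach_trans (minus_cut ss sab' xa'); apply: reach_sym (minus_cut ss sab' xa); exact: cut_sym.
have ab1 : reachable (cut o a b) a b'.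
  apply: (reach_trans aa1 (reach1 _)); rewrite /cut /= oab' /= negb_or !negb_and.
  rewrite eq_sym aa' /=; apply/orP; case: (eqVneq a' b) => [e|]; last by left.
  by case: nab; move: aa1; rewrite e.
have [ac _] : reachable (cut o a b) a c /\ reachable (cut o a' b') b' c.
  apply: (reach_closed (P := fun z => reachable (cut o a b) a z /\ reachable (cut o a' b') b' z)) bc'; last first.
    by split=> //; exact: reach_refl.
  move=> u v [au bu] uv; split; last exact: reach_trans bu (reach1 uv).
  have [/= cuv|] := boolP (cut o a b u v); first exact: reach_trans au (reach1 cuv).
  have /andP[ouv _] := uv; rewrite /cut /= ouv /= negbK => /orP[]/andP[/eqP ue /eqP ve].
    case: nab'; apply: reach_sym; first exact: cut_sym.
    by apply: reach_trans aa2; rewrite -ue.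
  by case: nab; move: au; rewrite ue.
by case: nab; apply: reach_trans ac (reach_sym _ bc); exact: cut_sym.
Qed.

Lemma piece_at_most r : exists n, forall o s x, substate o -> substate s ->
  at_most n (fun a => ker_piece r o s a x).
Proof.
have [n nP] := ball r; exists (n * 1)%N => o s x so ss; have [l ln lP] := nP x.
apply: (at_most_union (Q := fun c a => exists b, [/\ adj a b, o a b && s a b, gdist_le r x c,
    reachable (minus o s) x a & reachable (cut o a b) b c /\ ~ reachable (cut o a b) a b]) ln).
  by move=> c _; apply: at_most1 => a a'; exact: piece_unique.
by move=> a [b [c [h1 h2 h3 h4 h5]]]; exists c; [exact: lP|exists b].
Qed.

Lemma top_at_most n : exists n', forall o x, at_most n' (fun a => ker_top w n o a x).
Proof.
have [k kP] := ball 1; exists (k * n)%N => o x; have [l lk lP] := kP x.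
apply: (at_most_union (Q := fun y a => top w o x y a /\ at_most n (top w o x y)) lk).
  by move=> y _; exact: at_most_if.
by move=> a [y [xy _ ta na]]; exists y => //; apply: lP; exact: gdist1.
Qed.

(** For each of the boundedly many clusters next to [x] there is at most one nearest
   spot. *)
Lemma near_at_most r : exists n', forall o t x, at_most n' (fun a => ker_near w r o t a x).
Proof.
have [k kP] := ball 1; exists (k * 1)%N => o t x; have [l lk lP] := kP x.
apply: (at_most_union (Q := fun b a => exists n, [/\ odist o n x a, spot w r o t b a &
    forall c, spot w r o t b c -> odist o n x c -> c = a]) lk).
  move=> b _; apply: at_most1 => a a' [n [d sa h]] [n' [d' sa' h']].
  have mono i j z : (i <= j)%N -> odist o i x z -> odist o j x z.
    by move=> ij [q [pq lq sq]]; exists q; split=> //; exact: leq_trans ij.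
  have [nn|/ltnW nn] := leqP n n'; first by apply: h' => //; exact: mono d.
  by apply/esym; apply: h => //; exact: mono d'.
by move=> a [b [xb h]]; exists b => //; apply: lP; exact: gdist1.
Qed.

(** The neighbour [m] determines the cluster of [x1], hence the contacts. *)
Lemma sel_at_most n : exists n', forall o t x, substate o ->
  at_most n' (fun a => ker_sel w n o t a x).
Proof.
have [k kP] := ball 1; exists (k * n)%N => o t x so; have [l lk lP] := kP x.
apply: (at_most_union (Q := fun m a => exists x1, [/\ selected w o m x x1,
  contact w o t x x1 a & at_most n (contact w o t x x1)]) lk); last first.
  by move=> a [m [x1 [xm h1 h2 h3]]]; exists m; [apply: lP; exact: gdist1|exists x1].
move=> m _; have [[x1 [a0 [sel ca na]]]|no] := pselect (exists x1, exists a, [/\ selected w o m x x1,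
  contact w o t x x1 a & at_most n (contact w o t x x1)]); last first.
  by exists [::] => // a [x1 h]; case: no; exists x1, a.
apply: at_most_sub na => a [x1' [[h1 h2 h3 h4 h5] ca' _]].
case: sel => _ h2' _ h4' h5'; have [/h3//|x11] := h5' _ h2 h4.
by apply: contact_eq ca'; [exact: reach_refl|exact: x11].
Qed.

End KernelCounts.

Section Deductions.
Variables (R : realType) (G : sgraph).
Hypotheses (conn : connected_graph G) (lf : locally_finite G).
Variables (w : G -> R) (D : aut G -> R) (os : seq G).
Hypothesis tr : transports w D os.
Variables (p q : R) (P Q : probability (config G) R).
Hypotheses (bP : bernoulli_percolation p P) (bQ : bernoulli_percolation q Q).
Implicit Types (a b x y z : G) (g : aut G).
Let cG := countable_vertex conn lf.
Let ms := mu P Q.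

Lemma mp_open_adj u v : mp (fun om : config G => open_adj om u v).
Proof.
have [uv|nuv] := boolP (adj u v).
  by apply: mp_iff (open_event_measurable (mkedge uv)) => om; rewrite open_adjP.
apply: mp_iff (mp_const _ False) => om; split=> // /(open_adj_sub om).2.
by rewrite (negbTE nuv).
Qed.

Lemma mp_comp d1 d2 (T1 : measurableType d1) (T2 : measurableType d2) (f : T1 -> T2)
  (A : T2 -> Prop) : measurable_fun setT f -> mp A -> mp (fun t => A (f t)).
Proof. by move=> mf mA; rewrite /mp -[X in measurable X]setTI; exact: mf. Qed.

Lemma mrel_state : mrel (@state R G).
Proof.
move=> u v; apply: (mp_comp (f := fun t : sys R G => t.1.1) _ (mp_open_adj u v)).
exact: measurableT_comp measurable_fst measurable_fst.
Qed.

Lemma mrel_marks : mrel (@marks R G).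
Proof.
move=> u v; apply: (mp_comp (f := fun t : sys R G => t.1.2) _ (mp_open_adj u v)).
exact: measurableT_comp measurable_snd measurable_fst.
Qed.

Lemma mlevel_level : mlevel (@level R G).
Proof.
move=> c; rewrite /mp (_ : mkset _ = setT `*` `]-oo, c]%classic).
  by apply: measurableX => //; exact: measurable_itv.
by apply/seteqP; split=> t; rewrite /= in_itv //= => -[].
Qed.

Lemma requi_state g t : requi g (state (sact D g t)) (state t).
Proof. by move=> x y; exact: act_open. Qed.

Lemma requi_marks g t : requi g (marks (sact D g t)) (marks t).
Proof. by move=> x y; exact: act_open. Qed.

(** Restricting to vertices visible at the same level turns an invariant relation into
   a kernel. *)
Definition seen (K : rel G -> rel G -> R -> G -> G -> Prop) a x (t : sys R G) : Prop :=
  [/\ vis w a t, vis w x t & K (state t) (marks t) (level t) a x].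

Lemma vis_sact g x t : vis w (g x) (sact D g t) <-> vis w x t.
Proof.
have Dg := modulus_gt0 tr g x; rewrite /vis /level /sact /= (tr_mod tr).
by rewrite pmulr_rgt0// ler_pM2l.
Qed.

Lemma seen_kernel K : (forall a x, mp (fun t : sys R G => K (state t) (marks t) (level t) a x)) ->
  (forall g o' o s' s t a x, requi g o' o -> requi g s' s ->
    (K o' s' (D g * t) (g a) (g x) <-> K o s t a x)) -> kernel w D (seen K).
Proof.
move=> mK eK; split=> [x y|g x y t|x y t [//]].
  change (mp (fun t : sys R G => [/\ vis w x t, vis w y t & K (state t) (marks t) (level t) x y])).
  by apply: mp_and3 => //; exact: vis_measurable.
have e := eK g _ _ _ _ (level t) x y (requi_state g t) (requi_marks g t).
by split=> -[/vis_sact h1 /vis_sact h2 /e h3]; split=> //; exact/vis_sact.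
Qed.

Lemma seen_finite K n : kernel w D (seen K) ->
  (forall o s t x, substate o -> substate s -> at_most n (fun a => K o s t a x)) ->
  {ae ms, forall t, forall a, ~ infinitely (fun x => seen K a x t)}.
Proof.
move=> kK cnt; apply: (visible_finite conn lf tr bP bQ kK (n := n)) => x t.
by apply: at_most_sub (cnt _ _ (level t) x (open_adj_sub t.1.1) (open_adj_sub t.1.2)) => a [].
Qed.

Lemma top_kernel n : kernel w D (seen (fun o _ _ => ker_top w n o)).
Proof.
apply: seen_kernel => [a x|g o' o s' s t a x ho _].
  by apply: (mp_top conn lf); exact: mrel_state.
by apply: (eqi_top (modulus_gt0 tr g a)) => // y; exact: tr_mod tr _ _.
Qed.

Lemma piece_kernel r : kernel w D (seen (fun o s _ => ker_piece r o s)).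
Proof.
apply: seen_kernel => [a x|g o' o s' s t a x ho hs].
  by apply: (mp_piece conn lf); [exact: mrel_state|exact: mrel_marks].
exact: eqi_piece.
Qed.

Lemma near_kernel r : kernel w D (seen (fun o _ t => ker_near w r o t)).
Proof.
apply: seen_kernel => [a x|g o' o s' s t a x ho _].
  by apply: (mp_near conn lf); [exact: mrel_state|exact: mlevel_level].
by apply: (eqi_near (modulus_gt0 tr g a)) => // y; exact: tr_mod tr _ _.
Qed.

Lemma sel_kernel n : kernel w D (seen (fun o _ t => ker_sel w n o t)).
Proof.
apply: seen_kernel => [a x|g o' o s' s t a x ho _].
  by apply: (mp_sel conn lf); [exact: mrel_state|exact: mlevel_level].
by apply: (eqi_sel (modulus_gt0 tr g a)) => // y; exact: tr_mod tr _ _.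
Qed.

Lemma branch_kernel r n : kernel w D (seen (fun o s t => ker_branch w r n o s t)).
Proof.
apply: seen_kernel => [a x|g o' o s' s t a x ho hs].
  by apply: (mp_branch conn lf); [exact: mrel_state|exact: mrel_marks|exact: mlevel_level].
by apply: (eqi_branch (modulus_gt0 tr g a)) => // y; exact: tr_mod tr _ _.
Qed.

Lemma piece_finite : {ae ms, forall t, forall r a,
  ~ infinitely (fun x => seen (fun o s _ => ker_piece r o s) a x t)}.
Proof.
apply/ae_foralln => r; have [n nP] := piece_at_most (tr_ball tr) r.
by apply: (seen_finite (n := n)) (piece_kernel r) _ => o s _ x; exact: nP.
Qed.

Lemma near_finite : {ae ms, forall t, forall r a,
  ~ infinitely (fun x => seen (fun o _ t => ker_near w r o t) a x t)}.
Proof.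
apply/ae_foralln => r; have [n nP] := near_at_most w (tr_ball tr) r.
by apply: (seen_finite (n := n)) (near_kernel r) _ => o s t x _ _; exact: nP.
Qed.

Lemma sel_finite : {ae ms, forall t, forall n a,
  ~ infinitely (fun x => seen (fun o _ t => ker_sel w n o t) a x t)}.
Proof.
apply/ae_foralln => k; have [n nP] := sel_at_most w (tr_ball tr) k.
by apply: (seen_finite (n := n)) (sel_kernel k) _ => o s t x so _; exact: nP.
Qed.

Lemma ae_good_levels (A : sys R G -> Prop) : {ae ms, forall t, A t} ->
  {ae (P \x Q)%E, forall c, forall t : R, 0 < t -> exists2 t', 0 < t' < t & A (c, t')}.
Proof.
move=> h; have := ae_levels h; apply: filterS => c cP t /cP[t' ht' nn]; exists t' => //.
by apply: contrapT.
Qed.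

(** As the sender is at least as heavy as the receiver [x], both are visible for a
   set of levels of measure [w x], and finite mass sent means that the weights of
   the receivers are summable. *)
Lemma top_summable : {ae P, forall om, forall n a,
  (\esum_(x in [set: G]) (w x * \1_[set om | ker_top w n (open_adj om) a x] om)%:E < +oo)%E}.
Proof.
apply/ae_foralln => n.
have mt a x : measurable [set om : config G | ker_top w n (open_adj om) a x].
  change (mp (fun om : config G => ker_top w n (open_adj om) a x)).
  by apply: (mp_top conn lf); exact: mp_open_adj.
suff all_a a : {ae P, forall om, (\esum_(x in [set: G])
    (w x * \1_[set om | ker_top w n (open_adj om) a x] om)%:E < +oo)%E}.
  have : {ae P, forall om, forall k a, decode cG k = Some a -> (\esum_(x in [set: G])
    (w x * \1_[set om | ker_top w n (open_adj om) a x] om)%:E < +oo)%E}.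
    apply/ae_foralln => k; case e : (decode cG k) => [b|]; last by apply: aeW => t a.
    by apply: filterS (all_a b) => t h a [<-].
  by apply: filterS => t h a; apply: (h (code cG a)); exact: codeK.
have w0 x : 0 <= w x by exact: ltW (tr_pos tr x).
apply: (esum_ae cG) => [x|x om|].
- apply/measurable_EFinP/measurable_funM; first exact: measurable_cst.
  exact: measurable_indic.
- by rewrite lee_fin mulr_ge0.
have [n' nP] := top_at_most w (tr_ball tr) n.
have := @mass_sent_fin R G conn lf w D os tr p q P Q bP bQ _ (top_kernel n) n' a.
rewrite (_ : \esum_(x in [set: G]) _ = \esum_(x in [set: G])
    (\int[P]_om (w x * \1_[set om | ker_top w n (open_adj om) a x] om)%:E))%E; last first.
  apply: eq_esum => x _.
  under [RHS]eq_integral do rewrite EFinM.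
  rewrite ge0_integralZl; try (by []); try (by rewrite lee_fin); try (by move=> *; rewrite lee_fin);
    try (by apply/measurable_EFinP; exact: measurable_indic).
  rewrite integral_indic// setIT.
  rewrite (_ : [set t | _] = ([set om | ker_top w n (open_adj om) a x] `*` setT) `*` `]0, w x]%classic).
    rewrite mu_rect; try exact: mt; try exact: measurableT; try exact: measurable_itv.
    by rewrite probability_setT mule1 lam_oc ?(tr_pos tr)// muleC.
  apply/seteqP; split=> -[[om S] t] /=.
    move=> [v1 v2 h]; rewrite in_itv /=; split=> //; split=> //.
  rewrite in_itv /= => -[[h _] /andP[t0 tx]]; split=> //.
    apply/andP; split=> //; apply: le_trans tx _.
    have [y [xy nxy [_ ta] _]] := h; apply: ta; split; first exact: reach_refl.
    by exists y; split=> //; exact: reach_refl.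
  by apply/andP.
move=> h; apply: h => x t; by apply: at_most_sub (nP (state t) x) => b [].
Qed.

End Deductions.

(** * Heavy contacts, arms and selections *)

Section TouchMeet.
Variables (R : realType) (G : sgraph).
Variables (w : G -> R) (o : rel G).
Hypotheses (w0 : forall x, 0 < w x) (so : substate o).
Hypothesis w_adj : exists2 k : R, 0 < k & forall x y : G, adj x y -> w x <= k * w y.
Implicit Types (a b c x y z : G).

Lemma seq_max (s : seq G) (A : G -> Prop) x : A x -> x \in s -> exists2 a, A a &
  forall c, A c -> c \in s -> w c <= w a.
Proof.
elim: s x => // z s IH x Ax; rewrite inE => xs.
have [[y [Ay ys]]|no] := pselect (exists y, A y /\ y \in s); last first.
  exists x => // c Ac; rewrite inE => /orP[/eqP cz|cs]; last by case: no; exists c.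
  by case/orP: xs => [/eqP->|xs]; [rewrite cz|case: no; exists x].
have [a Aa aP] := IH _ Ay ys; have [Az|nAz] := pselect (A z); last first.
  by exists a => // c Ac; rewrite inE => /orP[/eqP cz|]; [case: nAz; rewrite -cz|exact: aP].
have [wza|/ltW waz] := leP (w z) (w a).
  by exists a => // c Ac; rewrite inE => /orP[/eqP->//|]; exact: aP.
exists z => // c Ac; rewrite inE => /orP[/eqP->//|cs]; exact: le_trans (aP _ Ac cs) waz.
Qed.

(** If only finitely many contacts had a weight above any given level, then there
   would be a heaviest contact, among finitely many, and it would send to all
   contacts, whose weights would be summable. *)
Lemma touch_meet a b : ~ reachable o a b ->
  (forall n c, (\esum_(x in [set: G]) (w x * (`[< ker_top w n o c x >] : nat)%:R)%:E < +oo)%E) ->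
  (\esum_(x in [set x | touch o a b x]) (w x)%:E = +oo)%E -> meet w o a b.
Proof.
move=> nab fin inf; have [sym _] := so; apply: contrapT => nmeet.
have [k k_0 kP] := w_adj.
have fint t : 0 < t -> exists s : seq G, forall x, touch o a b x -> t <= w x -> x \in s.
  move=> t0; pose t' := Num.min t (t / k).
  have t'0 : 0 < t' by rewrite lt_min t0 divr_gt0.
  have ni : ~ infinitely (contact w o t' a b) by move=> h; apply: nmeet; split=> //; exists t'.
  have [s sP] := (infinitelyNE _).1 ni; exists s => x [ax [y [xy bY]]] tx; apply: sP; split=> //.
    by rewrite ge_min tx.
  exists y; split=> //; rewrite ge_min; apply/orP; right.
  by rewrite ler_pdivrMr// mulrC; apply: le_trans tx _; exact: kP.
have [x1 x1t] : exists x, touch o a b x.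
  apply: contrapT => no; have : (\esum_(x in [set x | touch o a b x]) (w x)%:E = 0)%E.
    by apply: esum1 => x tx; case: no; exists x.
  by rewrite inf.
have [s sP] := fint _ (w0 x1).
have [c [ct c1] cm] := @seq_max s (fun x => touch o a b x /\ w x1 <= w x) x1 (conj x1t (lexx _)) (sP _ x1t (lexx _)).
have top_c y : touch o a b y -> w y <= w c.
  move=> ty; have [h|/ltW h] := leP (w x1) (w y); last exact: le_trans h c1.
  by apply: cm; [split|exact: sP].
have touchE x y z : reachable o a x -> reachable o b y -> touch o x y z <-> touch o a b z.
  move=> ax bY; split=> -[h1 [d [h2 h3]]]; split.
  - exact: reach_trans ax h1.
  - by exists d; split=> //; exact: reach_trans bY h3.
  - exact: reach_trans (reach_sym sym ax) h1.
  - by exists d; split=> //; exact: reach_trans (reach_sym sym bY) h3.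
have send x : touch o a b x -> ker_top w (size s) o c x.
  move=> [ax [y [xy bY]]]; exists y; split=> //.
  - by move=> xy'; apply: nab; apply: reach_trans (reach_trans ax xy') (reach_sym sym bY).
  - by split=> [|z]; rewrite touchE//; exact: top_c.
  - exists s => // z [/(touchE _ _ _ ax bY) tz zm]; apply: sP => //; apply: le_trans c1 _.
    by apply: zm; apply/(touchE _ _ _ ax bY).
have := fin (size s) c; rewrite ltNge => /negP; apply.
rewrite -inf esum_mkcond; apply: le_esum => x _; case: ifPn => [|_].
  by rewrite inE => /send h; rewrite asboolT// mulr1.
by rewrite lee_fin mulr_ge0// ltW.
Qed.

End TouchMeet.

Section UpdateGraph.
Variable G : sgraph.
Implicit Types (om : config G) (a b u v : G).

Lemma open_adj_nadj om u v : ~~ adj u v -> open_adj om u v = false.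
Proof.
move=> nuv; apply/negbTE/negP => h.
by move/(open_adj_sub _).2: h; rewrite (negbTE nuv).
Qed.

Lemma upd_link om a b (ab : adj a b) :
  open_adj (upd (mkedge ab) true om) = link a b (open_adj om).
Proof.
apply/funext => u; apply/funext => v.
transitivity [|| open_adj om u v, (u == a) && (v == b) | (u == b) && (v == a)] => //.
have [uv|nuv] := boolP (adj u v); last first.
  transitivity false; first exact: open_adj_nadj.
  apply/esym/negbTE; rewrite (open_adj_nadj om nuv) /= negb_or; apply/andP; split.
  - by apply: contra nuv => /andP[/eqP-> /eqP->].
  - by apply: contra nuv => /andP[/eqP-> /eqP->]; rewrite adj_sym.
rewrite !open_adjP /upd; case: eqP => [e|ne].
  apply/esym; have [[/eqP ua /eqP vb]|[/eqP ub /eqP va]] := edge_fset_eq (congr1 val e).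
    by rewrite ua vb orbT.
  by rewrite ub va !orbT.
rewrite [X in _ = _ || X](_ : _ = false) ?orbF//; apply/negbTE/negP => /orP[]/andP[/eqP eu /eqP ev].
  by apply: ne; apply: val_inj; rewrite /= eu ev.
by apply: ne; apply: val_inj; rewrite /= eu ev fsetUC.
Qed.

Lemma upd_cut om a b (ab : adj a b) :
  open_adj (upd (mkedge ab) false om) = cut (open_adj om) a b.
Proof.
apply/funext => u; apply/funext => v.
transitivity (open_adj om u v && ~~ ((u == a) && (v == b) || (u == b) && (v == a))) => //.
have [uv|nuv] := boolP (adj u v); last first.
  transitivity false; first exact: open_adj_nadj.
  by rewrite (open_adj_nadj om nuv).
rewrite !open_adjP /upd; case: eqP => [e|ne].
  apply/esym; have [[/eqP ua /eqP vb]|[/eqP ub /eqP va]] := edge_fset_eq (congr1 val e).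
    by rewrite ua vb andbF.
  by rewrite ub va orbT andbF.
rewrite (_ : ~~ _ = true) ?andbT//; apply/negP => /orP[]/andP[/eqP eu /eqP ev].
  by apply: ne; apply: val_inj; rewrite /= eu ev.
by apply: ne; apply: val_inj; rewrite /= eu ev fsetUC.
Qed.

End UpdateGraph.

Section UpdateAe.
Variables (R : realType) (G : sgraph).
Variables (p q : R) (P Q : probability (config G) R).
Hypotheses (bP : bernoulli_percolation p P) (bQ : bernoulli_percolation q Q).
Hypotheses (p01 : 0 < p < 1) (q01 : 0 < q < 1).

Lemma ae_upd (A : config G -> Prop) e b : {ae P, forall om, A om} ->
  {ae P, forall om, A (upd e b om)}.
Proof.
move=> [N [mN N0 AN]]; exists (upd e b @^-1` N); split.
- by rewrite -[X in measurable X]setTI; exact: measurable_upd.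
- exact: (null_upd bP p01).
- by move=> om; exact: AN.
Qed.

(** The configuration and the marks may be changed at one edge simultaneously. *)
Lemma ae_upd2 (A : config G * config G -> Prop) e b b' : {ae (P \x Q)%E, forall c, A c} ->
  {ae (P \x Q)%E, forall c, A (upd e b c.1, upd e b' c.2)}.
Proof.
move=> [N [mN N0 AN]].
pose f (c : config G * config G) := (upd e b c.1, upd e b' c.2).
have mf : measurable_fun setT f.
  apply/measurable_fun_pair; first exact: measurableT_comp (measurable_upd e b) measurable_fst.
  exact: measurableT_comp (measurable_upd e b') measurable_snd.
have mfN : measurable (f @^-1` N) by rewrite -[X in measurable X]setTI; exact: mf.
exists (f @^-1` N); split=> //; last by move=> c; exact: AN.
apply/(null_xsection P Q mfN); have /(null_xsection P Q mN)/(ae_upd e b) := N0.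
apply: filterS => om h.
rewrite (_ : xsection _ _ = upd e b' @^-1` xsection N (upd e b om)).
  by apply: (null_upd bQ q01) => //; exact: measurable_xsection.
by apply/seteqP; split=> S; rewrite /xsection /= !inE.
Qed.

End UpdateAe.

Section AlmostSure.
Variables (R : realType) (G : sgraph).
Hypotheses (conn : connected_graph G) (lf : locally_finite G).
Variables (w : G -> R) (D : aut G -> R) (os : seq G).
Hypothesis tr : transports w D os.
Variables (p q : R) (P Q : probability (config G) R).
Hypotheses (bP : bernoulli_percolation p P) (bQ : bernoulli_percolation q Q).
Hypotheses (p01 : 0 < p < 1) (q01 : 0 < q < 1).
Implicit Types (a b x y z : G) (g : aut G).
Let ms := mu P Q.

Lemma heavy_meet : {ae P, forall om, forall a b, ~ reachable (open_adj om) a b ->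
  (\esum_(x in [set x | touch (open_adj om) a b x]) (w x)%:E = +oo)%E ->
  meet w (open_adj om) a b}.
Proof.
have := top_summable conn lf tr bP bP; apply: filterS => om h a b nab.
apply: (touch_meet (tr_pos tr) (open_adj_sub om) (tr_adj tr) nab).
by move=> n c; have := h n c; congr (_ < _)%E; apply: eq_esum => x _.
Qed.

Lemma piece_levels : {ae (P \x Q)%E, forall c, forall t r a, 0 < t -> t <= w a ->
  ~ infinitely (fun x => t <= w x /\ ker_piece r (open_adj c.1) (open_adj c.2) a x)}.
Proof.
have := ae_good_levels (piece_finite conn lf tr bP bQ); apply: filterS => c h t r a t0 ta.
have [t' /andP[t'0 /ltW t't] fin] := h _ t0 => inf; apply: (fin r a).
apply: infinitely_sub inf => x [tx kx]; split=> //=.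
  by rewrite /vis /level /= t'0 (le_trans t't).
by rewrite /vis /level /= t'0 (le_trans t't).
Qed.

(** Open the contact edge [ab] and mark it. It becomes a marked bridge, so [a]
   sends to all vertices of its piece near the other cluster, which are now near
   a vertex beyond the bridge. *)
Lemma near_piece : {ae (P \x Q)%E, forall c, forall a b, adj a b ->
  ~ reachable (open_adj c.1) a b -> forall t r, 0 < t -> t <= w a ->
  ~ infinitely (fun x => [/\ t <= w x, reachable (minus (open_adj c.1) (open_adj c.2)) a x &
     exists z, reachable (open_adj c.1) b z /\ gdist_le r x z])}.
Proof.
pose cE := countable_edge conn lf.
have all_e : {ae (P \x Q)%E, forall c, forall k e, decode cE k = Some e ->
  forall t r a, 0 < t -> t <= w a -> ~ infinitely (fun x => t <= w x /\
    ker_piece r (open_adj (upd e true c.1)) (open_adj (upd e true c.2)) a x)}.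
  apply/ae_foralln => k; case: (decode cE k) => [e|]; last by apply: aeW.
  have := ae_upd2 bP bQ p01 q01 e true true piece_levels.
  by apply: filterS => c h e' [<-]; exact: h.
apply: filterS all_e => -[om S] h a b ab nab t r t0 ta inf /=.
have := h (code cE (mkedge ab)) _ (codeK _ _) t r a t0 ta; apply.
rewrite /= !upd_link; move: nab inf => /=; set o := open_adj om; set s := open_adj S.
have [so _] : substate o := open_adj_sub om; have [ss _] : substate s := open_adj_sub S.
move=> nab; apply: infinitely_sub => x [tx ax [z [bz xz]]]; split=> //.
have noab : o a b = false by apply/negbTE/negP => /reach1.
have noba : o b a = false by rewrite so.
have cutE u v : cut (link a b o) a b u v = o u v.
  rewrite /cut /link /=; case: ((u == a) && (v == b)) / andP => [[/eqP-> /eqP->]|_]; first by rewrite noab andbF.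
  case: ((u == b) && (v == a)) / andP => [[/eqP-> /eqP->]|_]; first by rewrite noba andbF.
  by rewrite /= ?orbF ?andbT; case: (o u v).
have cutr u v : reachable (cut (link a b o) a b) u v <-> reachable o u v.
  by split; apply: reach_mono => y y'; rewrite cutE.
exists b, z; split=> //.
- by rewrite /link /= !eqxx !orbT.
- apply: reach_sym; first by apply: minus_sym; exact: link_sym.
  apply: reach_mono ax => u v /andP[ouv nsuv]; rewrite /minus /link /= ouv (negbTE nsuv) /=.
  apply/negP => /orP[]/andP[/eqP eu /eqP ev]; first by rewrite eu ev noab in ouv.
  by rewrite eu ev noba in ouv.
- by split; [apply/cutr|move/cutr].
Qed.

Lemma delv_avoid (o : rel G) y x s : path o x s -> y \notin x :: s ->
  reachable (delv o y) x (last x s).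
Proof.
move=> ps ny; exists s => //; elim: s x ps ny => //= z s IH x /andP[xz ps].
rewrite !inE !negb_or => /and3P[yx yz ys]; rewrite /delv /= xz eq_sym yx eq_sym yz /=.
by apply: IH => //; rewrite inE negb_or yz.
Qed.

Lemma split3_eq (o : rel G) t b b' y : symmetric o -> reachable o b b' ->
  split3 w o t b y -> split3 w o t b' y.
Proof.
move=> so bb [ty nyb [x0 [x1 [x2 [[a0 a1 a2] h1 h2 h3]]]]]; split=> //.
  by move=> yb'; apply: nyb; exact: reach_trans yb' (reach_sym so bb).
have arm_eq x : arm w o t b y x -> arm w o t b' y x.
  move=> [xy yx inf]; split=> //; apply: infinitely_sub inf => z [xz cz]; split=> //.
  by apply: contact_eq cz; [exact: reach_refl|exact: reach_sym].
by exists x0, x1, x2; split=> //; split; exact: arm_eq.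
Qed.

Lemma spot_eq r (o : rel G) t b b' y : symmetric o -> reachable o b b' ->
  spot w r o t b y -> spot w r o t b' y.
Proof.
move=> so bb [sy [c [bc yc]]]; split; first exact: split3_eq sy.
by exists c; split=> //; apply: reach_trans bc; exact: reach_sym.
Qed.

(** Otherwise infinitely many contacts of the arm would have [y] as the
   nearest spot. *)
Lemma arm_spot : {ae ms, forall t, forall r b y x, 0 < level t ->
  spot w r (state t) (level t) b y -> arm w (state t) (level t) b y x ->
  exists z, [/\ z != y, reachable (delv (state t) y) x z & spot w r (state t) (level t) b z]}.
Proof.
have := near_finite conn lf tr bP bQ; apply: filterS => t h r b y x t0 sy [xy yx inf].
apply: contrapT => no; apply: (h r y).
have [so _] : substate (state t) := open_adj_sub t.1.1.
apply: infinitely_sub inf => z [xz [yz tz [c [zc tc bc]]]].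
have [[ty _ _] _] := sy.
split; [by rewrite /vis t0|by rewrite /vis t0|exists c; split=> //].
have exn : exists n, `[< odist (state t) n z y >].
  have [s ps ls] := reach_sym so yz; exists (size s); apply/asboolP; by exists s.
have := ex_minnP exn => -[n /asboolP dn nmin]; exists n; split=> //; first exact: spot_eq sy.
move=> d sd [s [ps ls ss]]; apply: contrapT => /eqP dy; apply: no; exists d; split=> //; last first.
  by apply: spot_eq sd => //; exact: reach_sym.
apply: (reach_trans xz); rewrite -ls; apply: delv_avoid => //; apply/negP.
have yd : y != last z s by rewrite ls eq_sym.
rewrite inE => /orP[/eqP yz'|ys].
  have d0 : odist (state t) 0 z y by exists [::]; rewrite /= yz'.
  have := nmin 0%N; rewrite asboolT// leqn0 => /(_ isT)/eqP n0.
  by move: ss; rewrite n0 leqn0 => /nilP s0; move: yd; rewrite s0 /= yz' eqxx.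
case/splitPr: ys ps yd ss ls => s1 s2; rewrite cat_path last_cat /= => /and3P[p1 ly p2] yd ss ls.
have h1 : `[< odist (state t) (size s1).+1 z y >].
  by apply/asboolP; exists (rcons s1 y); rewrite rcons_path p1 ly last_rcons size_rcons; split.
have h2 := nmin _ h1; move: ss; rewrite size_cat /= addnS => ss.
have := leq_trans ss h2; rewrite ltnS -{2}[size s1]addn0 leq_add2l leqn0 => /nilP s20.
by move: yd; rewrite s20 eqxx.
Qed.

(** Finitely many contacts between [x0] and [x1] would send to the infinitely many
   contacts of [x0] with [m]. *)
Lemma no_selection : {ae P, forall om, forall m x0 x1, meet w (open_adj om) x0 m ->
  meet w (open_adj om) x1 m -> ~ reachable (open_adj om) x0 x1 ->
  reachable (off (open_adj om) m) x0 x1 ->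
  (exists u v, [/\ reachable (open_adj om) x0 u, reachable (open_adj om) x1 v & adj u v]) ->
  (forall x, meet w (open_adj om) x m -> reachable (off (open_adj om) m) x0 x ->
    reachable (open_adj om) x0 x \/ reachable (open_adj om) x1 x) ->
  meet w (open_adj om) x0 x1}.
Proof.
apply: (@ae_fst R G P P).
have := ae_good_levels (sel_finite conn lf tr bP bP).
apply: filterS => -[om S] /= good m x0 x1 m0 m1 n01 r01 [u [v [x0u x1v uv]]] only.
apply: contrapT => nm; have [so oadj] := open_adj_sub om.
have [n0m [t0 t0_0 inf]] := m0.
have t1_0 : 0 < Num.min t0 (Num.min (w u) (w v)) by rewrite !lt_min t0_0 !(tr_pos tr).
have [t' /andP[t'0 t't] fin] := good _ t1_0.
move: t't; rewrite !lt_min => /and3P[/ltW t't0 /ltW t'u /ltW t'v].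
have ni : ~ infinitely (contact w (open_adj om) t' x0 x1) by move=> h; apply: nm; split=> //; exists t'.
have [s sP] := (infinitelyNE _).1 ni.
apply: (fin (size s) u); apply: infinitely_sub inf => x [x0x tx [m' [xm' tm' mm']]].
rewrite /seen /vis /level /= t'0 t'u (le_trans t't0 tx); split=> //.
have r_x : reachable (off (open_adj om) m) x x0.
  apply: reach_sym; first exact: off_sym.
  apply: (reach_transfer (P := fun z => reachable (open_adj om) x0 z)) x0x; last exact: reach_refl.
  move=> y z x0y yz; have x0z : reachable (open_adj om) x0 z by exact: reach_trans x0y (reach1 yz).
  have nom c : reachable (open_adj om) x0 c -> ~~ `[< reachable (open_adj om) m c >].
    by move=> x0c; apply/negP => /asboolP mc; apply: n0m; exact: reach_trans x0c (reach_sym so mc).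
  by split=> //; rewrite /off /= (oadj _ _ yz) !nom.
have mmE c : `[< reachable (open_adj om) m' c >] = `[< reachable (open_adj om) m c >].
  apply/asboolP/asboolP => h; first exact: reach_trans mm' h.
  exact: reach_trans (reach_sym so mm') h.
have offE : off (open_adj om) m' = off (open_adj om) m.
  by apply/funext => y; apply/funext => z; rewrite /off /= !mmE.
have ceq a : contact w (open_adj om) t' x0 x1 a <-> contact w (open_adj om) t' x x1 a.
  by split; apply: contact_eq; rewrite //; try exact: reach_refl; exact: reach_sym.
exists m', x1; split=> //.
- split.
  + exact: (meet_eq so x0x mm' m0).
  + exact: (meet_eq so (reach_refl _ _) mm' m1).
  + by move=> xx1; apply: n01; exact: (reach_trans x0x xx1).
  + by rewrite offE; exact: (reach_trans r_x r01).
  + move=> c cm; rewrite offE => xc; have [||h|h] := only c.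
    * exact: (meet_eq so (reach_refl _ _) (reach_sym so mm') cm).
    * by apply: (reach_trans _ xc); apply: reach_sym r_x; exact: off_sym.
    * by left; exact: (reach_trans (reach_sym so x0x) h).
    * by right.
- by apply/ceq; split=> //; exists v.
- by exists s => // a /ceq/sP.
Qed.

End AlmostSure.

(** * Branchings and ends in a cluster *)

Section BranchesAndEnds.
Variables (G : sgraph) (o : rel G).
Hypothesis so : symmetric o.
Variables (A : G -> Prop) (l : seq G).
Hypotheses (ul : uniq l) (lA : forall x, x \in l <-> A x).
Hypothesis Aconn : forall u v, A u -> A v -> reachable o u v.
Variable v0 : G.
Hypothesis Av0 : A v0.
Implicit Types (u v x y : G).

Let dsym v : symmetric (delv o v) := delv_sym v so.

Lemma cut_vertex u v v' s : path o u s -> last u s = v -> v' != u ->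
  ~ reachable (delv o v') u v ->
  exists s1 s2, s = s1 ++ v' :: s2 /\ last v' s2 = v.
Proof.
move=> ps ls v'u nr; have : v' \in u :: s.
  by apply/negPn/negP => nin; apply: nr; rewrite -ls; exact: delv_avoid.
rewrite inE (negbTE v'u) /= => v's; case/splitPr: v's ps ls => s1 s2 _.
by rewrite last_cat /= => ls; exists s1, s2.
Qed.

(** [v] is the last member of [A] on the way from the root [v0] to [u]. *)
Definition parent v u : Prop := [/\ u != v, ~ reachable (delv o v) u v0 &
  forall v', A v' -> v' != u -> v' != v -> reachable (delv o v') u v].

Lemma no_mutual_cut n x y s : (size s < n)%N -> x != y ->
  ~ reachable (delv o y) x v0 -> ~ reachable (delv o x) y v0 ->
  path o x s -> last x s = v0 -> False.
Proof.
elim: n x y s => // n IH x y s sn xy nx ny ps ls.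
have yx : y != x by rewrite eq_sym.
have [s1 [s2 [es ls2]]] := cut_vertex ps ls yx nx.
apply: (IH y x s2) => //.
  by move: sn; rewrite es size_cat /= addnS !ltnS; apply: leq_trans; exact: leq_addl.
by move: ps; rewrite es cat_path /= => /and3P[].
Qed.

Lemma parent_unique v v' u : A u -> A v -> A v' -> parent v u -> parent v' u -> v = v'.
Proof.
move=> Au Av Av' [uv nv h] [uv' nv' h']; apply/eqP/negPn/negP => vv'.
have uv1 : reachable (delv o v') u v by apply: h; rewrite // eq_sym.
have uv2 : reachable (delv o v) u v' by apply: h'; rewrite // eq_sym.
have [s ps ls] := Aconn Av Av0.
apply: (@no_mutual_cut (size s).+1 v v' s) => //.
- by move=> r; apply: nv'; exact: reach_trans uv1 r.
- by move=> r; apply: nv; exact: reach_trans uv2 r.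
Qed.

Lemma child_ex n v u s : (size s <= n)%N -> path o u s -> uniq (u :: s) -> last u s = v ->
  A u -> A v -> u != v -> ~ reachable (delv o v) u v0 ->
  exists c, [/\ A c, reachable (delv o v) u c & parent v c].
Proof.
elim: n u s => [|n IH] u s sn ps us ls Au Av uv nv.
  by move: sn ls uv; rewrite leqn0 => /nilP-> /= ->; rewrite eqxx.
have [h|/existsNP[v' /not_implyP[Av' /not_implyP[v'u /not_implyP[v'v nr]]]]] :=
  pselect (forall v', A v' -> v' != u -> v' != v -> reachable (delv o v') u v).
  by exists u; split=> //; exact: reach_refl.
have [s1 [s2 [es ls2]]] := cut_vertex ps ls v'u nr.
move: ps us sn; rewrite es => ps us sn.
have vin : v \in v' :: s2 by rewrite -ls2 mem_last.
have uv' : reachable (delv o v) u v'.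
  have := @delv_avoid _ o v u (rcons s1 v'); rewrite last_rcons; apply.
    by move: ps; rewrite cat_path rcons_path /= => /and3P[-> ->].
  rewrite -rcons_cons mem_rcons !inE negb_or eq_sym v'v /= negb_or eq_sym uv /=.
  move: us; rewrite /= => /andP[_]; rewrite cat_uniq => /and3P[_ /hasPn nh _].
  exact: nh.
have [||||c [Ac v'c pc]] := IH v' s2 _ _ _ ls2 Av' Av v'v.
- by move: sn; rewrite size_cat /= addnS ltnS; apply: leq_trans; exact: leq_addl.
- by move: ps; rewrite cat_path /= => /and3P[].
- by move: us; rewrite /= => /andP[_]; rewrite cat_uniq => /and3P[].
- by move=> r; apply: nv; exact: reach_trans uv' r.
by exists c; split=> //; exact: reach_trans uv' v'c.
Qed.

Let children v := [seq u <- l | `[< parent v u >]].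

Lemma child_of v u : A v -> A u -> u != v -> ~ reachable (delv o v) u v0 ->
  exists2 c, c \in children v & reachable (delv o v) u c.
Proof.
move=> Av Au uv nv; have [s ps ls] := Aconn Au Av.
case/shortenP: ps ls => s' ps' us' _ ls.
have [c [Ac uc pc]] := child_ex (leqnn _) ps' us' ls Au Av uv nv.
by exists c => //; rewrite mem_filter asboolT//; exact/lA.
Qed.

Lemma two_children v : A v -> branch3 o A v -> (1 < size (children v))%N.
Proof.
move=> Av [u0 [u1 [u2 [[A0 A1 A2] [n0 n1 n2] h01 h02 h12]]]].
have two u u' : A u -> A u' -> u != v -> u' != v -> ~ reachable (delv o v) u u' ->
    ~ reachable (delv o v) u v0 -> ~ reachable (delv o v) u' v0 -> (1 < size (children v))%N.
  move=> Au Au' nu nu' huu' h h'.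
  have [c cin uc] := child_of Av Au nu h; have [c' cin' uc'] := child_of Av Au' nu' h'.
  have cc' : c != c'.
    apply/eqP => e; apply: huu'; apply: (reach_trans uc); rewrite e; exact: reach_sym uc'.
  apply: (@uniq_leq_size _ [:: c; c']); first by rewrite /= inE cc'.
  by move=> x; rewrite !inE => /orP[]/eqP->.
have [r0|nr0] := pselect (reachable (delv o v) u0 v0).
  apply: (two u1 u2) => // r; first by apply: h01; apply: reach_trans r0 (reach_sym _ r).
  by apply: h02; apply: reach_trans r0 (reach_sym _ r).
have [r1|nr1] := pselect (reachable (delv o v) u1 v0); last exact: (two u0 u1).
by apply: (two u0 u2) => // r; apply: h12; apply: reach_trans r1 (reach_sym _ r).
Qed.

Lemma no_child_end v : A v -> children v = [::] -> end1 o A v.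
Proof.
move=> Av nc u Au u' Au' nu nu'.
have root x : A x -> x != v -> reachable (delv o v) x v0.
  move=> Ax xv; apply: contrapT => n; have [c] := child_of Av Ax xv n.
  by rewrite nc.
exact: reach_trans (root _ Au nu) (reach_sym (dsym v) (root _ Au' nu')).
Qed.

(** Every member of [A] but the root has at most one parent, so there are fewer
   children than members; but a branching has at least two children, and only an
   end can have none. *)
Lemma branch_lt_end : (size [seq v <- l | `[< branch3 o A v >]] <
  size [seq v <- l | `[< end1 o A v >]])%N.
Proof.
have v0l : v0 \in l by apply/lA.
have le1 : (\sum_(v <- l) size (children v) < size l)%N.
  have -> : (\sum_(v <- l) size (children v) =
      \sum_(u <- l) \sum_(v <- l) (`[< parent v u >] : nat))%N.
    rewrite exchange_big /=; apply: eq_bigr => v _.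
    by rewrite /children size_filter -sum1_count [RHS]big_mkcond /= [LHS]big_mkcond /=; apply: eq_bigr => u _; case: ifP.
  rewrite (perm_big _ (perm_to_rem v0l)) /= big_cons big1 ?add0n => [|v _]; last first.
    by rewrite asboolF// => -[_ []]; exact: reach_refl.
  have sl : size l = (size (rem v0 l)).+1 by rewrite (perm_size (perm_to_rem v0l)).
  rewrite sl ltnS -sum1_size [leqLHS]big_seq [leqRHS]big_seq.
  apply: leq_sum => u /mem_rem ul'.
  have [[v [vl pv]]|no] := pselect (exists v, v \in l /\ parent v u); last first.
    by rewrite big_seq big1// => v vl; rewrite asboolF// => pv; apply: no; exists v.
  rewrite (bigD1_seq v)//= big_seq_cond big1 ?addn0 => [|v' /andP[v'l v'v]]; first by case: (`[< _ >]).
  rewrite asboolF// => pv'; move/eqP: v'v; apply.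
  by apply: (parent_unique _ _ _ pv' pv); exact/lA.
have le2 : (size l + size [seq v <- l | `[< branch3 o A v >]] <=
    \sum_(v <- l) size (children v) + size [seq v <- l | `[< end1 o A v >]])%N.
  have cE (B : pred G) : size [seq v <- l | B v] = (\sum_(v <- l) (B v : nat))%N.
    by rewrite size_filter -sum1_count big_mkcond; apply: eq_bigr => v _; case: (B v).
  rewrite !cE -[X in (X + _ <= _)%N]sum1_size -!big_split /=.
  rewrite [leqLHS]big_seq [leqRHS]big_seq; apply: leq_sum => v /lA Av.
  case: (asboolP (branch3 o A v)) => [b3|_] /=.
    exact: leq_trans (two_children Av b3) (leq_addr _ _).
  case e : (children v) => [|c cs]; last by [].
  by rewrite asboolT//; exact: no_child_end.
by move: le1 le2; lia.
Qed.

End BranchesAndEnds.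

(** * Densities of branchings and of ends *)

Section Branching.
Variables (R : realType) (G : sgraph).
Hypotheses (conn : connected_graph G) (lf : locally_finite G).
Variables (w : G -> R) (D : aut G -> R) (os : seq G).
Hypothesis tr : transports w D os.
Variables (p q : R) (P Q : probability (config G) R).
Hypotheses (bP : bernoulli_percolation p P) (bQ : bernoulli_percolation q Q).
Hypotheses (p01 : 0 < p < 1) (q01 : 0 < q < 1).
Variables (r k : nat).
Hypothesis kP : forall x : G, at_most k (gdist_le r x).
Implicit Types (a b x y z : G) (g : aut G).
Let cG := countable_vertex conn lf.
Let ms := mu P Q.
Notation S t := (state t) (only parsing).

Let V (t : sys R G) b y := spots w r (state t) (marks t) (level t) b y.
Let att (t : sys R G) b y := attached w r (state t) (marks t) (level t) b y.

Lemma V_eq t b b' y y' : reachable (state t) b b' ->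
  reachable (minus (state t) (marks t)) y y' -> forall z, V t b y z <-> V t b' y' z.
Proof.
have [so _] : substate (state t) := open_adj_sub t.1.1.
have [ss _] : substate (marks t) := open_adj_sub t.1.2.
move=> bb yy z; have yy' := reach_sym (minus_sym so ss) yy; split=> -[yz sz]; split.
- exact: reach_trans yy' yz.
- exact: spot_eq so bb sz.
- exact: reach_trans yy yz.
- exact: spot_eq so (reach_sym so bb) sz.
Qed.

Lemma V_ext t b b' y y' : reachable (state t) b b' ->
  reachable (minus (state t) (marks t)) y y' -> V t b y = V t b' y'.
Proof. by move=> bb yy; apply/funext => z; apply/propext; exact: V_eq. Qed.

Lemma att_eq t b b' y y' : reachable (state t) b b' ->
  reachable (minus (state t) (marks t)) y y' -> att t b y -> att t b' y'.
Proof.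
have [so _] : substate (state t) := open_adj_sub t.1.1.
have [ss _] : substate (marks t) := open_adj_sub t.1.2.
move=> bb yy [[a [c [ya ac bc ta tc]]] fin]; split; last first.
  by have := fin; rewrite -!/(V t _ _) (V_ext bb yy).
exists a, c; split=> //; last exact: reach_trans (reach_sym so bb) bc.
exact: reach_trans (reach_sym (minus_sym so ss) yy) ya.
Qed.

Lemma spot_vis t b y : spot w r (state t) (level t) b y -> level t <= w y.
Proof. by case=> -[]. Qed.

Lemma exactly_size n n' (A : G -> Prop) : exactly n A -> exactly n' A -> n = n'.
Proof.
move=> [l [/andP[ul /eqP<-] lA]] [l' [/andP[ul' /eqP<-] lA']].
apply/eqP; rewrite eqn_leq; apply/andP; split; apply: uniq_leq_size => // x.
  by move=> /lA/lA'.
by move=> /lA'/lA.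
Qed.

Lemma branch_count t b y n : V t b y y -> att t b y ->
  exactly n (fun v => V t b y v /\ end1 (state t) (V t b y) v) ->
  exists2 l : seq G, (size l < n)%N & forall x, V t b y x -> branch3 (state t) (V t b y) x -> x \in l.
Proof.
have [so _] : substate (state t) := open_adj_sub t.1.1.
have [ss _] : substate (marks t) := open_adj_sub t.1.2.
move=> Vy [_ [N [lV [/andP[uV _] VP]]]] [l [/andP[ul /eqP<-] lP]].
have sub u v : reachable (minus (state t) (marks t)) u v -> reachable (state t) u v.
  by apply: reach_mono => x x' /andP[].
have cn u v : V t b y u -> V t b y v -> reachable (state t) u v.
  move=> [yu _] [yv _]; apply: sub; apply: reach_trans yv.
  by apply: reach_sym yu; exact: minus_sym.
have lt := branch_lt_end so uV VP cn Vy.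
exists [seq v <- lV | `[< branch3 (state t) (V t b y) v >]]; last first.
  by move=> x Vx bx; rewrite mem_filter asboolT//; exact/VP.
apply: leq_trans lt _; apply: uniq_leq_size; first exact: filter_uniq.
by move=> x; rewrite mem_filter => /andP[/asboolP ex /VP Vx]; apply/lP.
Qed.

Let Dn n y : set (sys R G) := [set t | vis w y t /\ has_branch w r n (state t) (marks t) (level t) y].
Let En n y : set (sys R G) := [set t | vis w y t /\ is_end w r n (state t) (marks t) (level t) y].
Definition Dall y : set (sys R G) := [set t | vis w y t /\ exists b,
  [/\ V t b y y, att t b y & branch3 (state t) (V t b y) y]].
Definition Eall y : set (sys R G) := [set t | vis w y t /\ exists b,
  [/\ V t b y y, att t b y & end1 (state t) (V t b y) y]].

Let m1 := @mrel_state R G.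
Let m2 := @mrel_marks R G.
Let m3 := @mlevel_level R G.

Lemma Dn_measurable n y : measurable (Dn n y).
Proof.
change (mp (fun t : sys R G => vis w y t /\ has_branch w r n (state t) (marks t) (level t) y)).
by apply: mp_and; [exact: vis_measurable|exact: (mp_has_branch conn lf w m1 m2 m3)].
Qed.

Lemma En_measurable n y : measurable (En n y).
Proof.
change (mp (fun t : sys R G => vis w y t /\ is_end w r n (state t) (marks t) (level t) y)).
by apply: mp_and; [exact: vis_measurable|exact: (mp_is_end conn lf w m1 m2 m3)].
Qed.

Lemma Dall_measurable y : measurable (Dall y).
Proof.
change (mp (fun t : sys R G => vis w y t /\ exists b,
  [/\ V t b y y, att t b y & branch3 (state t) (V t b y) y])).
apply: mp_and; first exact: vis_measurable.
apply: mp_ex => // b; apply: mp_and3.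
- exact: (mp_spots conn lf w m1 m2 m3).
- exact: (mp_attached conn lf w m1 m2 m3).
- exact: (mp_branch3 conn lf w m1 m2 m3).
Qed.

Lemma Eall_measurable y : measurable (Eall y).
Proof.
change (mp (fun t : sys R G => vis w y t /\ exists b,
  [/\ V t b y y, att t b y & end1 (state t) (V t b y) y])).
apply: mp_and; first exact: vis_measurable.
apply: mp_ex => // b; apply: mp_and3.
- exact: (mp_spots conn lf w m1 m2 m3).
- exact: (mp_attached conn lf w m1 m2 m3).
- exact: (mp_end1 conn lf w m1 m2 m3).
Qed.

Let K n := seen w (fun o s t => ker_branch w r n o s t).

Lemma branch_row n y t : Dn n y t -> at_least n (fun z => K n y z t).
Proof.
move=> [vy [b [Vy ay by_ [l [/andP[ul /eqP sl] lP]]]]]; exists l; split=> // z /lP[Vz ez].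
split=> //; last by exists b; split=> //; exists l; rewrite ul sl eqxx.
by case/andP: vy => t0 _; rewrite /vis t0 (spot_vis Vz.2).
Qed.

Lemma branch_col n z t : at_most (k * n) (fun y => K n y z t).
Proof.
have [so _] : substate (state t) := open_adj_sub t.1.1.
have [l lk lP] := kP z.
apply: (at_most_union (Q := fun c y => [/\ V t c y y, att t c y,
    branch3 (state t) (V t c y) y, V t c y z &
    exactly n (fun v => V t c y v /\ end1 (state t) (V t c y) v)]) lk).
  move=> c _; have [[y0 [Vy0 ay0 by0 Vz0 e0]]|no] := pselect (exists y, [/\ V t c y y, att t c y,
    branch3 (state t) (V t c y) y, V t c y z &
    exactly n (fun v => V t c y v /\ end1 (state t) (V t c y) v)]); last first.
    by exists [::] => // y h; case: no; exists y.
  have [l' sl' l'P] := branch_count Vy0 ay0 e0.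
  exists l'; first exact: ltnW.
  move=> y [Vy _ by_ Vz _]; have [ss _] : substate (marks t) := open_adj_sub t.1.2.
  have e : V t c y = V t c y0.
    apply: V_ext; first exact: reach_refl.
    by apply: reach_trans Vz.1 (reach_sym _ Vz0.1); exact: minus_sym.
  by apply: l'P; rewrite -e.
move=> y [_ _ [b [Vy ay by_ ey [Vz _]]]].
have [_ [c [bc zc]]] := Vz.2; exists c; first exact: lP.
have e : V t c y = V t b y by apply: V_ext; [exact: reach_sym|exact: reach_refl].
rewrite e; split=> //; apply: att_eq ay => //; exact: reach_refl.
Qed.

Lemma branch_sub n y z t : K n y z t -> En n z t.
Proof.
move=> [_ vz [b [Vy ay _ ey [Vz ez]]]]; split=> //; exists b.
have e : spots w r (state t) (marks t) (level t) b y = spots w r (state t) (marks t) (level t) b z.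
  by apply: V_ext; [exact: reach_refl|exact: Vz.1].
rewrite -e; split=> //; apply: att_eq ay; [exact: reach_refl|exact: Vz.1].
Qed.

(** Measures are divided by weights, since mass transport compares mass per unit
   weight. *)
Definition density (B : G -> set (sys R G)) : \bar R :=
  (\sum_(o <- os) ((w o)^-1)%:E * ms (B o))%E.

Let w1 o : 0 < (w o)^-1. Proof. by rewrite invr_gt0; exact: tr_pos tr o. Qed.
Let w2 o : (0 <= ((w o)^-1)%:E)%E. Proof. by rewrite lee_fin; apply: ltW; exact: w1. Qed.
Let term_ge0 (B : G -> set (sys R G)) o : (0 <= ((w o)^-1)%:E * ms (B o))%E.
Proof. by apply: mule_ge0; [exact: w2|exact: measure_ge0]. Qed.

(** A branching sends at least [n] and an end receives at most [k * n], as it sees at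
   most [k] clusters and fewer than [n] branchings for each of them. *)
Lemma density_n n : (n%:R%:E * density (Dn n) <= (k * n)%:R%:E * density (En n))%E.
Proof.
have kK := branch_kernel conn lf tr r n.
pose f x y := fine (ms [set t | K n x y t]).
have fE x y : ms [set t | K n x y t] = (f x y)%:E by exact: (kernel_fin tr P Q kK).
have f0 x y : 0 <= f x y by exact: kernel_ge0.
have trE := tr_reps tr f0 (kernel_equi tr bP bQ kK).
clearbody f.
have S1 : (n%:R%:E * density (Dn n) <= \sum_(o <- os) \esum_(z in [set: G]) (f o z / w o)%:E)%E.
  rewrite /density ge0_sume_distrr => [|o _]; last exact: term_ge0.
  apply: lee_sum => o _; rewrite (esum_div conn lf (tr_pos tr o) (f0 o)).
  rewrite muleCA; apply: lee_wpmul2l; first exact: w2.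
  have -> : (\esum_(x in [set: G]) (f o x)%:E = \esum_(x in [set: G]) ms [set t | K n o x t])%E.
    by apply: eq_esum => x _; rewrite fE.
  apply: (sum_measure_ge cG ms (fun z => ker_meas kK o z)); first exact: Dn_measurable.
  by move=> t; exact: branch_row.
apply: le_trans S1 _; rewrite trE /density ge0_sume_distrr => [|o _]; last exact: term_ge0.
apply: lee_sum => o _; rewrite (esum_div conn lf (tr_pos tr o) (fun x => f0 x o)).
rewrite [leRHS]muleCA; apply: lee_wpmul2l; first exact: w2.
have -> : (\esum_(x in [set: G]) (f x o)%:E = \esum_(x in [set: G]) ms [set t | K n x o t])%E.
  by apply: eq_esum => x _; rewrite fE.
apply: (sum_measure_le cG ms (fun z => ker_meas kK z o)); first exact: En_measurable.
- by move=> y t; exact: branch_sub.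
- by move=> t _; exact: branch_col.
Qed.

Lemma Dn0 y : Dn 0 y = set0.
Proof.
by apply/seteqP; split=> // t [_ [b [Vy ay _ e0]]]; have [l] := branch_count Vy ay e0.
Qed.

Lemma density_le n : (density (Dn n) <= k%:R%:E * density (En n))%E.
Proof.
have d0 B : (0 <= density B)%E.
  by apply: sume_ge0 => o _; exact: term_ge0.
case: n => [|n].
  rewrite [leLHS](_ : _ = 0%E) ?mule_ge0 ?lee_fin//.
  by rewrite /density big1// => o _; rewrite Dn0 measure0 mule0.
rewrite -(@lee_pmul2l _ n.+1%:R%:E)//; apply: le_trans (density_n n.+1) _.
by rewrite mulnC natrM EFinM muleA.
Qed.

Let cN := countable_nats.

(** Summation over the number [n] of ends; an end is counted for at most [k] values
   of [n], one for each cluster near it. *)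
Lemma density_branch : (density Dall <= (k * k)%:R%:E * density Eall)%E.
Proof.
have h1 o : (ms (Dall o) <= \esum_(n in [set: nat]) ms (Dn n o))%E.
  rewrite -[leLHS]mul1e; apply: (sum_measure_ge cN ms (fun n => Dn_measurable n o) (n := 1)) => [|t [vy [b [Vy ay by_]]]].
    exact: Dall_measurable.
  have [N [lV [/andP[uV _] VP]]] := ay.2.
  pose l := [seq v <- lV | `[< end1 (state t) (V t b o) v >]].
  exists [:: size l]; split=> // n; rewrite inE => /eqP->; split=> //; exists b; split=> //.
  exists l; rewrite filter_uniq// eqxx; split=> // x; rewrite mem_filter; split.
    by move=> /andP[/asboolP ex /VP].
  by move=> [/VP Vx ex]; rewrite asboolT.
have h2 o : (\esum_(n in [set: nat]) ms (En n o) <= k%:R%:E * ms (Eall o))%E.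
  apply: (sum_measure_le cN ms (fun n => En_measurable n o)) => [|n t|t _].
  - exact: Eall_measurable.
  - by move=> [vy [b [h h' h'' _]]]; split=> //; exists b.
  have [l lk lP] := kP o; rewrite -[k]muln1.
  apply: (at_most_union (Q := fun c n => exactly n (fun v => V t c o v /\ end1 (state t) (V t c o) v)) lk).
    by move=> c _; apply: at_most1 => n n'; exact: exactly_size.
  move=> n [_ [b [Vo _ _ eo]]]; have [_ [c [bc zc]]] := Vo.2; exists c; first exact: lP.
  have [so _] : substate (state t) := open_adj_sub t.1.1.
  by rewrite (_ : V t c o = V t b o)//; apply: V_ext; [exact: reach_sym|exact: reach_refl].
have dens (B : nat -> G -> set (sys R G)) : (\sum_(o <- os) (((w o)^-1)%:E * (\esum_(n in [set: nat]) ms (B n o))) =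
    \esum_(n in [set: nat]) density (B n))%E.
  rewrite /density esum_sum => [|n o _ _]; last exact: term_ge0.
  by apply: eq_bigr => o _; rewrite esumZ//; exact: ltW.
apply: (@le_trans _ _ (\esum_(n in [set: nat]) density (Dn n))%E).
  rewrite -dens; apply: lee_sum => o _; apply: lee_wpmul2l; last exact: h1.
  exact: w2.
apply: (@le_trans _ _ (\esum_(n in [set: nat]) (k%:R%:E * density (En n)))%E).
  by apply: le_esum => n _; exact: density_le.
rewrite esumZ//; last by move=> n; apply: sume_ge0 => o _; exact: term_ge0.
rewrite natrM EFinM -muleA; apply: lee_wpmul2l; first by rewrite lee_fin.
rewrite -dens /density ge0_sume_distrr; last by move=> o _; exact: term_ge0.
apply: lee_sum => o _; rewrite [leRHS]muleCA; apply: lee_wpmul2l; last exact: h2.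
exact: w2.
Qed.

End Branching.

(** * Sparse marks: trifurcations have density zero *)

Section MeasureFacts.
Context d (T : measurableType d) (R : realType) (mu : {measure set T -> \bar R}).

Lemma ae_le_measure (X Y : set T) : measurable X -> measurable Y ->
  {ae mu, forall t, X t -> Y t} -> (mu X <= mu Y)%E.
Proof.
move=> mX mY [N [mN N0 XY]].
apply: (@le_trans _ _ (mu (Y `|` N))).
  apply: le_measure; rewrite ?inE//; first exact: measurableU.
  move=> t Xt; have [Yt|nYt] := pselect (Y t); first by left.
  by right; apply: XY => /= h; apply: nYt; exact: h.
by rewrite -[leRHS]adde0 -N0; exact: measureU2.
Qed.

End MeasureFacts.

Section LocalWitness.
Variables (R : realType) (G : sgraph) (w : G -> R).
Implicit Types (o s : rel G) (t : R) (a b c x y z u v : G) (l : seq G) (r : nat).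

Definition within o l : rel G := [rel u v | [&& o u v, u \in l & v \in l]].

(** A witnessed spot is a branching of an attached piece as soon as the marks miss
   the finite set [l]. *)
Definition witness r l o t b y :=
  branch3 o (fun u => reachable (within o l) y u /\ spot w r o t b u) y /\
  exists a, exists c, [/\ reachable (within o l) y a, adj a c, reachable o b c, t <= w a & t <= w c].
Definition witnessed r l o t y := forall b, spot w r o t b y -> witness r l o t b y.
Definition miss l s := forall u, forall v, u \in l -> v \in l -> ~ s u v.

Lemma within_minus o s l u v : miss l s -> reachable (within o l) u v -> reachable (minus o s) u v.
Proof.
move=> ms; apply: reach_mono => x y /and3P[oxy xl yl]; rewrite /minus /= oxy /=.
by apply/negP; exact: ms.
Qed.

Lemma within_mono o l l' u v : {subset l <= l'} -> reachable (within o l) u v ->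
  reachable (within o l') u v.
Proof. by move=> ll; apply: reach_mono => x y /and3P[oxy /ll xl /ll yl]; apply/and3P. Qed.

Lemma witness_mono r o t b y l l' : {subset l <= l'} -> witness r l o t b y -> witness r l' o t b y.
Proof.
move=> ll [[u0 [u1 [u2 [[[h0 s0] [h1 s1] [h2 s2]] n1 n2 n3 n4]]]] [a [c [h3 h4 h5 h6 h7]]]]; split.
  by exists u0, u1, u2; split=> //; split; split=> //; apply: (within_mono ll).
by exists a, c; split=> //; apply: (within_mono ll).
Qed.

Lemma within_path o x y : reachable o x y -> exists l, reachable (within o l) x y.
Proof.
move=> [s ps <-]; exists (x :: s), s => //.
have : {subset x :: s <= x :: s} by [].
move: {2 3}(x :: s) => l; elim: s x ps => //= z s IH x /andP[xz ps] sub.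
rewrite /within /= xz (sub x) ?mem_head ?(sub z) ?inE ?eqxx ?orbT//=.
by apply: IH => // u us; apply: sub; rewrite inE us orbT.
Qed.

Lemma within_paths o x (s : seq G) : (forall y, y \in s -> reachable o x y) ->
  exists l, forall y, y \in s -> reachable (within o l) x y.
Proof.
elim: s => [|y s IH] h; first by exists [::].
have [l lP] := IH (fun z zs => h z (mem_behead (s := y :: s) zs)).
have [l' l'P] := within_path (h y (mem_head _ _)); exists (l' ++ l) => z.
rewrite inE => /orP[/eqP->|/lP zl].
  by apply: within_mono l'P => u ul; rewrite mem_cat ul.
by apply: within_mono zl => u ul; rewrite mem_cat ul orbT.
Qed.

Lemma witness_eq r l o t b b' y : symmetric o -> reachable o b b' ->
  witness r l o t b y -> witness r l o t b' y.
Proof.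
move=> so bb [[u0 [u1 [u2 [[[h0 s0] [h1 s1] [h2 s2]] n1 n2 n3 n4]]]] [a [c [h3 h4 h5 h6 h7]]]]; split.
  by exists u0, u1, u2; split=> //; split; split=> //; exact: (spot_eq so bb).
by exists a, c; split=> //; apply: reach_trans h5; exact: reach_sym.
Qed.

End LocalWitness.

Section NoSpots.
Variables (R : realType) (G : sgraph).
Hypotheses (conn : connected_graph G) (lf : locally_finite G).
Variables (w : G -> R) (D : aut G -> R) (os : seq G).
Hypothesis tr : transports w D os.
Variables (p : R) (P : probability (config G) R).
Hypotheses (bP : bernoulli_percolation p P) (p01 : 0 < p < 1).
Implicit Types (a b x y z o : G) (g : aut G) (l : seq G).
Let cG := countable_vertex conn lf.
Let lam : {sigma_finite_measure set (measurableTypeR R) -> \bar R} := lebesgue_measure.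

Definition spotted r y : set (sys R G) :=
  [set t | vis w y t /\ exists b, spot w r (state t) (level t) b y].

Let m1 := @mrel_state R G.
Let m2 := @mrel_marks R G.
Let m3 := @mlevel_level R G.

Lemma spotted_measurable r y : measurable (spotted r y).
Proof.
change (mp (fun t : sys R G => vis w y t /\ exists b, spot w r (state t) (level t) b y)).
apply: mp_and; first exact: vis_measurable.
by apply: mp_ex => // b; exact: (mp_spot conn lf w m1 m3).
Qed.

Lemma mp_witnessed d (T : measurableType d) (o : T -> rel G) (t : T -> R) r l y :
  mrel o -> mlevel t -> mp (fun x : T => witnessed w r l (o x) (t x) y).
Proof.
move=> mo mt; apply: mp_all => // b; apply: mp_imp; first exact: (mp_spot conn lf w mo mt).
have mw : mrel (fun x : T => within (o x) l).
  by move=> u v; rewrite /within /=; apply: mp_andb => //; exact: mp_const.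
apply: mp_and.
  rewrite /branch3; do 3 (apply: mp_ex => //; intros ?).
  have md v : mrel (fun x : T => delv (o x) v) by exact: mrel_delv.
  apply: mp_and5.
  - by apply: mp_and3; apply: mp_and; try exact: (mp_reach conn lf); exact: (mp_spot conn lf w mo mt).
  - exact: mp_const.
  - by apply: mp_not; exact: (mp_reach conn lf).
  - by apply: mp_not; exact: (mp_reach conn lf).
  - by apply: mp_not; exact: (mp_reach conn lf).
do 2 (apply: mp_ex => //; intros ?); apply: mp_and5; try exact: (mp_reach conn lf);
  try exact: mp_const; exact: mt.
Qed.

Lemma miss_measurable l : measurable [set S : config G | miss l (open_adj S)].
Proof.
change (mp (fun S : config G => miss l (open_adj S))).
apply: mp_all => // u; apply: mp_all => // v; apply: mp_imp; first exact: mp_const.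
by apply: mp_imp; [exact: mp_const|apply: mp_not; exact: mp_open_adj].
Qed.

(** Powers of [p] supply percolations of arbitrarily small positive density. *)
Lemma miss_small l (eps : R) : 0 < eps -> exists q (Q : probability (config G) R),
  [/\ bernoulli_percolation q Q, 0 < q < 1 &
      (Q (~` [set S : config G | miss l (open_adj S)]) <= eps%:E)%E].
Proof.
move=> e0; have [p0 p1] := andP p01.
pose L := allpairs pair l l.
have [n hn] : exists n, (size L)%:R * p ^+ n.+1 <= eps.
  have cv : p ^+ n @[n --> \oo] --> 0 by apply: cvg_expr; rewrite ger0_norm ?ltW.
  have s1 : 0 < (size L).+1%:R :> R by [].
  have /cvgrPdist_le/(_ _ (divr_gt0 e0 s1))[N _ /(_ N.+1 (leqnSn N))/=] := cv.
  rewrite sub0r normrN ger0_norm; last by rewrite exprn_ge0// ltW.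
  move=> h; exists N.
  rewrite ler_pdivlMr// mulrC in h; apply: le_trans h; apply: ler_wpM2r; first by rewrite exprn_ge0 ?ltW.
  by rewrite ler_nat.
have [Q bQ] := bernoulli_exp n bP; exists (p ^+ n.+1), Q; split=> //.
  by rewrite exprn_gt0//= exprn_ilt1// ltW.
have q0 : 0 <= p ^+ n.+1 by rewrite exprn_ge0 ?ltW.
pose U (s : seq (G * G)) : set (config G) := [set S | exists2 e, e \in s & open_adj S e.1 e.2].
have mo u v : measurable [set S : config G | open_adj S u v] by exact: mp_open_adj.
have Qo u v : (Q [set S : config G | open_adj S u v] <= (p ^+ n.+1)%:E)%E.
  have [uv|nuv] := boolP (adj u v); last first.
    rewrite (_ : [set S | _] = set0) ?measure0 ?lee_fin//.
    by apply/seteqP; split=> // S /=; rewrite open_adj_nadj.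
  rewrite (_ : [set S | _] = open_event (mkedge uv)); first by rewrite (P_open bQ).
  by apply/seteqP; split=> S; rewrite /= open_adjP.
have Ubound s : measurable (U s) /\ (Q (U s) <= ((size s)%:R * p ^+ n.+1)%:E)%E.
  elim: s => [|e s [mU IH]].
    have -> : U [::] = set0 by apply/seteqP; split=> // S [].
    by rewrite measure0 mul0r; split; first exact: measurable0.
  have -> : U (e :: s) = [set S : config G | open_adj S e.1 e.2] `|` U s.
    apply/seteqP; split=> S; first by move=> [e']; rewrite inE => /orP[/eqP->|]; [left|right; exists e'].
    by move=> [h|[e' e's h]]; [exists e; rewrite ?mem_head|exists e'; rewrite // inE e's orbT].
  split; first exact: measurableU.
  apply: le_trans (measureU2 _ (mo _ _) mU) _.
  rewrite [size _]/= -natr1 mulrDl mul1r addrC EFinD; apply: leeD => //.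
  exact: Qo.
apply: le_trans (_ : _ <= Q (U L))%E _; last by apply: le_trans (Ubound L).2 _; rewrite lee_fin.
apply: le_measure; rewrite ?inE; [by apply: measurableC; exact: miss_measurable|exact: (Ubound L).1|].
move=> S /= nm; apply: contrapT => nU; apply: nm => u v ul vl Suv; apply: nU.
by exists (u, v) => //; apply/allpairsP; exists (u, v).
Qed.

Section FixQ.
Variables (q : R) (Q : probability (config G) R).
Hypotheses (bQ : bernoulli_percolation q Q) (q01 : 0 < q < 1).
Let ms := mu P Q.

Lemma ae_lift (A : config G * config G -> Prop) : {ae (P \x Q)%E, forall c, A c} ->
  {ae ms, forall t, A t.1}.
Proof.
move=> [N [mN N0 AN]]; exists (N `*` setT); split.
- by apply: measurableX.
- have mX : measurable (N `*` [set: measurableTypeR R]) by exact: measurableX.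
  apply/(null_xsection (P \x Q)%E lam mX); exists N; split=> // c /= h; apply: contrapT => nN.
  apply: h; rewrite (_ : xsection _ _ = set0) ?measure0//.
  by apply/seteqP; split=> // t; rewrite /xsection /= inE => -[].
- by move=> t h; split=> //; exact: AN.
Qed.

(** Systems with marks of different densities are compared through their common
   part. *)
Lemma mu_proj (B : set (config G * measurableTypeR R)) : measurable B ->
  ms [set t | B (t.1.1, t.2)] = (P \x lam)%E B.
Proof.
move=> mB; pose f (t : sys R G) : config G * measurableTypeR R := (t.1.1, t.2).
have mf : measurable_fun setT f.
  apply/measurable_fun_pair; last exact: measurable_snd.
  exact: measurableT_comp measurable_fst measurable_fst.
pose F : {mfun sys R G >-> (config G * measurableTypeR R)%type} := mfun_Sub (mem_set mf).
apply/esym; apply: (product_measure_unique (m' := pushforward ms F)) => //.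
move=> A1 A2 mA1 mA2; rewrite /= /pushforward.
rewrite (_ : F @^-1` _ = (A1 `*` setT) `*` A2).
  by rewrite mu_rect// probability_setT mule1.
by apply/seteqP; split=> t /=; [move=> [? ?]|move=> [[? _] ?]].
Qed.

(** The contact bounds the number of spots in the piece, by [near_piece]. *)
Lemma attached_ae r : {ae ms, forall t, forall y b, 0 < level t ->
  spot w r (state t) (level t) b y ->
  (exists a, exists c, [/\ reachable (minus (state t) (marks t)) y a, adj a c,
     reachable (state t) b c, level t <= w a & level t <= w c]) ->
  attached w r (state t) (marks t) (level t) b y}.
Proof.
have := ae_lift (near_piece conn lf tr bP bQ p01 q01); apply: filterS => t h y b t0 sy att.
split=> //; have [so _] : substate (state t) := open_adj_sub t.1.1.
have [ss _] : substate (marks t) := open_adj_sub t.1.2.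
have sub u v : reachable (minus (state t) (marks t)) u v -> reachable (state t) u v.
  by apply: reach_mono => x x' /andP[].
have [a [c [ya ac bc ta tc]]] := att; have [[_ nyb _] _] := sy.
have nac : ~ reachable (state t) a c.
  by move=> ac'; apply: nyb; apply: reach_trans (sub _ _ ya) (reach_trans ac' (reach_sym so bc)).
have /infinitelyNE[s sP] := h a c ac nac (level t) r t0 ta.
pose A := spots w r (state t) (marks t) (level t) b y.
have As z : A z -> z \in s.
  move=> [yz [[tz _ _] [d [bd zd]]]]; apply: sP; split=> //.
    by apply: reach_trans yz; apply: reach_sym ya; exact: minus_sym.
  by exists d; split=> //; apply: reach_trans bd; exact: reach_sym.
exists (size [seq z <- undup s | `[< A z >]]), [seq z <- undup s | `[< A z >]].
rewrite filter_uniq ?undup_uniq// eqxx; split=> // z; rewrite mem_filter mem_undup; split.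
  by move=> /andP[/asboolP].
by move=> Az; rewrite asboolT// As.
Qed.

Variables (r k : nat).
Hypothesis kP : forall x : G, at_most k (gdist_le r x).
Variable l : seq G.

(** The spots that are certainly branchings. *)
Definition local_spot y : set (sys R G) :=
  [set t | spotted r y t /\ (witnessed w r l (state t) (level t) y /\ miss l (marks t))].

Lemma local_spot_measurable y : measurable (local_spot y).
Proof.
change (mp (fun t : sys R G => spotted r y t /\
  (witnessed w r l (state t) (level t) y /\ miss l (marks t)))).
apply: mp_and; first exact: spotted_measurable.
apply: mp_and; first exact: (mp_witnessed r l y m1 m3).
apply: mp_all => // u; apply: mp_all => // v; apply: mp_imp; first exact: mp_const.
by apply: mp_imp; [exact: mp_const|apply: mp_not; exact: m2].
Qed.

Lemma local_spot_branch t y b : 0 < level t ->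
  (forall y b, 0 < level t -> spot w r (state t) (level t) b y ->
  (exists a, exists c, [/\ reachable (minus (state t) (marks t)) y a, adj a c,
     reachable (state t) b c, level t <= w a & level t <= w c]) ->
  attached w r (state t) (marks t) (level t) b y) ->
  witnessed w r l (state t) (level t) y -> miss l (marks t) ->
  spot w r (state t) (level t) b y ->
  attached w r (state t) (marks t) (level t) b y /\
  branch3 (state t) (spots w r (state t) (marks t) (level t) b y) y.
Proof.
move=> t0 att wit mis sy.
have [[u0 [u1 [u2 [[[h0 s0] [h1 s1] [h2 s2]] n1 n2 n3 n4]]]] [a [c [h3 h4 h5 h6 h7]]]] := wit b sy.
split; first by apply: att => //; exists a, c; split=> //; exact: within_minus mis h3.
by exists u0, u1, u2; split=> //; split; split=> //; apply: within_minus mis _.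
Qed.

(** Local spots are branchings, hence at most [k * k] times as dense as ends; and
   an end is a spot that is no branching, hence not local. *)
Lemma spotted_density :
  (density w os P Q (spotted r) <= (k * k).+1%:R%:E *
   density w os P Q (fun y => spotted r y `\` local_spot y))%E.
Proof.
have w2 o : (0 <= ((w o)^-1)%:E)%E.
  by rewrite lee_fin; apply: ltW; rewrite invr_gt0; exact: tr_pos tr o.
have mD y : measurable (spotted r y `\` local_spot y).
  by apply: measurableD; [exact: spotted_measurable|exact: local_spot_measurable].
have term_ge0 (B : G -> set (sys R G)) o : (0 <= ((w o)^-1)%:E * ms (B o))%E.
  by apply: mule_ge0; [exact: w2|exact: measure_ge0].
have lower : (density w os P Q local_spot <= density w os P Q (Dall w r))%E.
  apply: lee_sum => o _; apply: lee_wpmul2l; first exact: w2.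
  apply: ae_le_measure; [exact: local_spot_measurable|exact: (Dall_measurable conn lf)|].
  have := attached_ae r; apply: filterS => t att [[vy [b sy]] [wit mis]].
  have t0 : 0 < level t by case/andP: vy.
  have [a3 b3] := local_spot_branch t0 att wit mis sy.
  split=> //; exists b; split=> //; split=> //; exact: reach_refl.
have upper : (density w os P Q (Eall w r) <=
    density w os P Q (fun y => spotted r y `\` local_spot y))%E.
  apply: lee_sum => o _; apply: lee_wpmul2l; first exact: w2.
  apply: ae_le_measure; [exact: (Eall_measurable conn lf)|exact: mD|].
  have := attached_ae r; apply: filterS => t att [vy [b [[_ sy] ay ey]]].
  have t0 : 0 < level t by case/andP: vy.
  split; first by split=> //; exists b.
  move=> [_ [wit mis]].
  have [_ [u0 [u1 [u2 [[h0 h1 h2] [n0 n1 n2] n3 n4 n5]]]]] := local_spot_branch t0 att wit mis sy.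
  by apply: n3; exact: ey.
have mid := density_branch conn lf tr bP bQ kP.
rewrite -natr1 EFinD ge0_muleDl ?lee_fin//.
rewrite mul1e; apply: (@le_trans _ _ (density w os P Q local_spot +
    density w os P Q (fun y => spotted r y `\` local_spot y))%E).
  rewrite /density -big_split /=; apply: lee_sum => o _.
  rewrite -ge0_muleDr//; apply: lee_wpmul2l; first exact: w2.
  apply: le_trans (measureU2 _ (local_spot_measurable o) (mD o)).
  apply: le_measure; rewrite ?inE.
  - exact: spotted_measurable.
  - by apply: measurableU; [exact: local_spot_measurable|exact: mD].
  - by move=> t st; have [h|h] := pselect (local_spot o t); [left|right].
apply: leeD; last exact: lexx.
apply: le_trans lower _; apply: le_trans mid _.
by apply: lee_wpmul2l; rewrite ?lee_fin.
Qed.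

End FixQ.
End NoSpots.

Section NoSplit.
Variables (R : realType) (G : sgraph).
Hypotheses (conn : connected_graph G) (lf : locally_finite G).
Variables (w : G -> R) (D : aut G -> R) (os : seq G).
Hypothesis tr : transports w D os.
Variables (p : R) (P : probability (config G) R).
Hypotheses (bP : bernoulli_percolation p P) (p01 : 0 < p < 1).
Implicit Types (a b x y z o : G) (g : aut G) (l : seq G).
Let cG := countable_vertex conn lf.
Let lam : {sigma_finite_measure set (measurableTypeR R) -> \bar R} := lebesgue_measure.

Definition exhaust (n : nat) : seq G := pmap (decode cG) (iota 0 n).

Lemma exhaust_mono n n' : (n <= n')%N -> {subset exhaust n <= exhaust n'}.
Proof.
move=> nn x; rewrite !mem_pmap => /mapP[i]; rewrite mem_iota add0n /= => ilt e.
by apply/mapP; exists i; rewrite // mem_iota add0n /=; exact: leq_trans nn.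
Qed.

Lemma exhaust_ex l : exists n, {subset l <= exhaust n}.
Proof.
elim: l => [|x l [n nP]]; first by exists 0%N.
exists (maxn n (code cG x).+1) => y; rewrite inE => /orP[/eqP->|/nP].
  rewrite mem_pmap; apply/mapP; exists (code cG x); last by rewrite codeK.
  by rewrite mem_iota add0n /= leq_maxr.
by apply: exhaust_mono; exact: leq_maxl.
Qed.

(** Each of three arms contains a further spot by [arm_spot], and only finitely many
   clusters are near [y]. *)
Lemma witnessed_ex r : {ae mu P P, forall t, forall y, 0 < level t ->
  exists n, witnessed w r (exhaust n) (state t) (level t) y}.
Proof.
have := arm_spot conn lf tr bP bP; apply: filterS => t h y t0.
have [so _] : substate (state t) := open_adj_sub t.1.1.
have one b : spot w r (state t) (level t) b y -> exists n, witness w r (exhaust n) (state t) (level t) b y.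
  move=> sy; have [[ty nyb [x0 [x1 [x2 [[a0 a1 a2] n01 n02 n12]]]]] _] := sy.
  have [z0 [z0y x0z0 s0]] := h _ _ _ _ t0 sy a0.
  have [z1 [z1y x1z1 s1]] := h _ _ _ _ t0 sy a1.
  have [z2 [z2y x2z2 s2]] := h _ _ _ _ t0 sy a2.
  have [_ _ inf] := a0; have [c _ [_ [yc tc [d [cd td bd]]]]] := inf [::].
  have dsub x z : reachable (delv (state t) y) x z -> reachable (state t) x z.
    by apply: reach_mono => u v /and3P[].
  have yz x z : arm w (state t) (level t) b y x -> reachable (delv (state t) y) x z -> reachable (state t) y z.
    by move=> [_ yx _] xz; exact: reach_trans yx (dsub _ _ xz).
  have [l lP] : exists l, forall z, z \in [:: z0; z1; z2; c] -> reachable (within (state t) l) y z.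
    apply: within_paths => z; rewrite !inE => /or4P[]/eqP->; [exact: yz a0 _|exact: yz a1 _|exact: yz a2 _|exact: yc].
  have [n nl] := exhaust_ex l; exists n; apply: witness_mono nl _; split.
    have dsym := delv_sym y so.
    have sep x x' z z' : reachable (delv (state t) y) x z -> reachable (delv (state t) y) x' z' ->
        ~ reachable (delv (state t) y) x x' -> ~ reachable (delv (state t) y) z z'.
      move=> xz xz' nn zz; apply: nn; apply: reach_trans xz (reach_trans zz _); exact: reach_sym.
    exists z0, z1, z2; split=> //.
    - by split; split=> //; apply: lP; rewrite !inE eqxx ?orbT.
    - exact: sep x0z0 x1z1 n01.
    - exact: sep x0z0 x2z2 n02.
    - exact: sep x1z1 x2z2 n12.
  by exists c, d; split=> //; apply: lP; rewrite !inE eqxx !orbT.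
have [k kP] := tr_ball tr r; have [l _ lP] := kP y.
suff [n nP] : exists n, forall c, c \in l -> spot w r (state t) (level t) c y ->
    witness w r (exhaust n) (state t) (level t) c y.
  exists n => b sy; have [_ [c [bc yc]]] := sy.
  apply: (witness_eq so (reach_sym so bc)); apply: nP; [exact: lP|exact: spot_eq so bc sy].
elim: (l) => [|c s [n nP]]; first by exists 0%N.
have [[n' n'P]|no] := pselect (exists n', spot w r (state t) (level t) c y ->
    witness w r (exhaust n') (state t) (level t) c y).
  exists (maxn n n') => x; rewrite inE => /orP[/eqP->|xs] sx.
    by apply: witness_mono (n'P sx); apply: exhaust_mono; exact: leq_maxr.
  by apply: witness_mono (nP _ xs sx); apply: exhaust_mono; exact: leq_maxl.
case: no; have [sc|nsc] := pselect (spot w r (state t) (level t) c y); last by exists 0%N.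
by have [n' hn'] := one _ sc; exists n'.
Qed.

Let SpB r y : set (config G * measurableTypeR R) :=
  [set c | 0 < c.2 <= w y /\ exists b, spot w r (open_adj c.1) c.2 b y].
Let WiB r n y : set (config G * measurableTypeR R) :=
  [set c | witnessed w r (exhaust n) (open_adj c.1) c.2 y].

Let o1 (c : config G * measurableTypeR R) := open_adj c.1.
Let mo1 : mrel o1.
Proof. by move=> u v; exact: (mp_comp (f := fst) measurable_fst (mp_open_adj u v)). Qed.
Let ml1 : mlevel (fun c : config G * measurableTypeR R => c.2).
Proof.
move=> c; rewrite /mp (_ : mkset _ = setT `*` `]-oo, c]%classic).
  by apply: measurableX => //; exact: measurable_itv.
by apply/seteqP; split=> t; rewrite /= in_itv //= => -[].
Qed.

Lemma SpB_measurable r y : measurable (SpB r y).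
Proof.
change (mp (fun c : config G * measurableTypeR R => 0 < c.2 <= w y /\
  exists b, spot w r (o1 c) c.2 b y)).
apply: mp_and; last by apply: mp_ex => // b; exact: (mp_spot conn lf w mo1 ml1).
rewrite /mp (_ : mkset _ = setT `*` `]0, w y]%classic).
  by apply: measurableX => //; exact: measurable_itv.
by apply/seteqP; split=> t; rewrite /= in_itv //= => -[].
Qed.

Lemma WiB_measurable r n y : measurable (WiB r n y).
Proof. exact: (mp_witnessed conn lf w r (exhaust n) y mo1 ml1). Qed.

(** Every spot is witnessed in some finite set by [witnessed_ex], and the measure is
   continuous from above. *)
Lemma unwitnessed_small r y (eps : R) : 0 < eps ->
  exists N, forall n, (N <= n)%N -> ((P \x lam)%E (SpB r y `\` WiB r n y) <= eps%:E)%E.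
Proof.
move=> e0; pose F n := SpB r y `\` WiB r n y.
have mF n : measurable (F n) by apply: measurableD; [exact: SpB_measurable|exact: WiB_measurable].
have mI : measurable (\bigcap_n F n) by exact: bigcapT_measurable.
have I0 : (P \x lam)%E (\bigcap_n F n) = 0%E.
  rewrite -(mu_proj P P mI); apply/eqP; rewrite eq_le measure_ge0 andbT.
  rewrite -(measure0 (mu P P)); apply: ae_le_measure.
  - change (mp (fun t : sys R G => (\bigcap_n F n) (t.1.1, t.2))).
    apply: (mp_comp (f := fun t : sys R G => (t.1.1, t.2))) mI.
    apply/measurable_fun_pair; last exact: measurable_snd.
    exact: measurableT_comp measurable_fst measurable_fst.
  - exact: measurable0.
  - have := witnessed_ex r; apply: filterS => t h /= hF.
    have [[/andP[t0 _] _] _] := hF 0%N Logic.I.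
    by have [n wn] := h y t0; have [_ []] := hF n Logic.I.
have fin : ((P \x lam)%E (F 0%N) < +oo)%E.
  apply: le_lt_trans (ltry (w y)); rewrite -(mu_proj P P (mF 0%N)) -(mu_vis tr P P y).
  apply: le_measure; rewrite ?inE.
  - change (mp (fun t : sys R G => F 0%N (t.1.1, t.2))).
    apply: (mp_comp (f := fun t : sys R G => (t.1.1, t.2))) (mF 0%N).
    apply/measurable_fun_pair; last exact: measurable_snd.
    exact: measurableT_comp measurable_fst measurable_fst.
  - exact: vis_measurable.
  - by move=> t [[]].
have mono : nonincreasing_seq F.
  move=> n n' nn; apply/subsetPset => c [Sc nW]; split=> //; apply: contra_not nW => h b sb.
  by apply: witness_mono (h b sb); exact: exhaust_mono.
have cv : (P \x lam)%E (F n) @[n --> \oo] --> 0%E by rewrite -I0; exact: nonincreasing_cvg_mu.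
have /fine_cvgP[[N1 _ h1] /cvgrPdist_le/(_ _ e0)[N2 _ h2]] := cv.
exists (maxn N1 N2) => n; rewrite geq_max => /andP[n1 n2].
have f1 := h1 n n1; have := h2 n n2; rewrite /= sub0r normrN => /(le_trans (ler_norm _)) h.
by rewrite -[leLHS]fineK// lee_fin.
Qed.

Lemma spotted_proj r y (Q : probability (config G) R) : mu P Q (spotted w r y) = (P \x lam)%E (SpB r y).
Proof. by rewrite -(mu_proj P Q (SpB_measurable r y)). Qed.

(** Choose first the finite set so large that few spots are not witnessed in it, then
   marks so sparse that they rarely meet it. The density of the spots does not
   depend on the marks and is bounded by a constant times that of the exceptions. *)
Lemma no_spot_rep r o : o \in os -> mu P P (spotted w r o) = 0%E.
Proof.
move=> oos; rewrite spotted_proj; have [k kP] := tr_ball tr r.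
have w2 x : 0 < (w x)^-1 by rewrite invr_gt0; exact: tr_pos tr x.
pose C : R := (k * k).+1%:R * (2 * (size os)%:R).
suff small eps : 0 < eps -> (((w o)^-1)%:E * (P \x lam)%E (SpB r o) <= (C * eps)%:E)%E.
  apply/eqP; rewrite eq_le measure_ge0 andbT.
  have C1 : 0 < C + 1 by rewrite ltr_wpDl// mulr_ge0.
  apply/lee_addgt0Pr => eps e0; rewrite add0e.
  have w0 := tr_pos tr o.
  have e1 : 0 < eps / w o / (C + 1) by rewrite !divr_gt0.
  have := small _ e1; rewrite lee_pdivrMl// => /le_trans; apply; rewrite -EFinM lee_fin.
  have -> : w o * (C * (eps / w o / (C + 1))) = C * eps / (C + 1).
    by field; rewrite (gt_eqF w0) (gt_eqF C1).
  by rewrite ler_pdivrMr// mulrC ler_pM2l// lerDl.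
move=> e0.
have [N hN] : exists N, forall x, x \in os -> ((P \x lam)%E (SpB r x `\` WiB r N x) <= (eps * w x)%:E)%E.
  suff [N hN] : exists N, forall n x, (N <= n)%N -> x \in os ->
      ((P \x lam)%E (SpB r x `\` WiB r n x) <= (eps * w x)%:E)%E by exists N => x; exact: hN.
  elim: os => [|x s [N hN]]; first by exists 0%N.
  have [N' hN'] := unwitnessed_small r x (mulr_gt0 e0 (tr_pos tr x)).
  exists (maxn N N') => n y; rewrite geq_max => /andP[n1 n2]; rewrite inE => /orP[/eqP->|ys].
    exact: hN'.
  exact: hN.
have [q [Q [bQ q01 Qm]]] := miss_small conn lf bP p01 (exhaust N) e0.
have loc := spotted_density conn lf tr bP p01 bQ q01 kP (exhaust N).
have mL x : measurable (spotted w r x `\` local_spot w r (exhaust N) x).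
  by apply: measurableD; [exact: spotted_measurable|exact: local_spot_measurable].
have bound x : x \in os -> (mu P Q (spotted w r x `\` local_spot w r (exhaust N) x) <= (2 * eps * w x)%:E)%E.
  move=> xos; pose A : set (sys R G) := [set t | (SpB r x `\` WiB r N x) (t.1.1, t.2)].
  pose B : set (sys R G) := (setT `*` ~` [set S : config G | miss (exhaust N) (open_adj S)]) `*` `]0, w x]%classic.
  have mS : measurable (SpB r x `\` WiB r N x).
    by apply: measurableD; [exact: SpB_measurable|exact: WiB_measurable].
  have mA : measurable A.
    change (mp (fun t : sys R G => (SpB r x `\` WiB r N x) (t.1.1, t.2))).
    apply: (mp_comp (f := fun t : sys R G => (t.1.1, t.2))) mS.
    apply/measurable_fun_pair; last exact: measurable_snd.
    exact: measurableT_comp measurable_fst measurable_fst.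
  have mM : measurable (~` [set S : config G | miss (exhaust N) (open_adj S)]).
    by apply: measurableC; exact: miss_measurable.
  have mB : measurable B.
    by apply: measurableX; [exact: measurableX|exact: measurable_itv].
  apply: (@le_trans _ _ (mu P Q A + mu P Q B)%E).
    apply: le_trans (measureU2 _ mA mB); apply: le_measure; rewrite ?inE//; first exact: measurableU.
    move=> t [[vx sx] nl].
    have [wi|nw] := pselect (witnessed w r (exhaust N) (state t) (level t) x).
      right; split=> /=; last by rewrite in_itv.
      by split=> // mi; apply: nl; split.
    by left; split.
  rewrite (mu_proj P Q mS) /B mu_rect; try exact: mM; try exact: measurableT; try exact: measurable_itv.
  rewrite probability_setT mul1e lam_oc ?(tr_pos tr)//.
  rewrite -mulrA mulrDl mul1r EFinD; apply: leeD; first exact: hN.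
  by rewrite EFinM; apply: lee_wpmul2r => //; rewrite lee_fin ltW ?(tr_pos tr).
apply: (@le_trans _ _ (density w os P Q (spotted w r))).
  apply: (@le_trans _ _ (((w o)^-1)%:E * mu P Q (spotted w r o))%E); first by rewrite spotted_proj.
  rewrite /density (big_rem o oos) /= leeDl// sume_ge0// => x _.
  by apply: mule_ge0; [rewrite lee_fin ltW|exact: measure_ge0].
apply: le_trans loc _; rewrite /C -mulrA EFinM; apply: lee_wpmul2l; first by rewrite lee_fin.
rewrite /density big_seq; apply: (@le_trans _ _ (\sum_(x <- os | x \in os) (2 * eps)%:E)%E).
  apply: lee_sum => x xos; rewrite lee_pdivrMl ?(tr_pos tr)// -EFinM mulrC; exact: bound.
rewrite -big_seq sumEFin lee_fin big_const_seq count_predT iter_addr_0.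
by rewrite -[leLHS]mulr_natr [leLHS]mulrAC.
Qed.

Lemma no_spot r y : mu P P (spotted w r y) = 0%E.
Proof.
have [x xos [g gx]] := tr_orbit tr y.
rewrite -(mu_sact tr bP bP g y); last exact: spotted_measurable.
rewrite (_ : sact D g @^-1` _ = spotted w r x) ?no_spot_rep ?mule0//.
have Dg := modulus_gt0 tr g x; have wg z : w (g z) = D g * w z by exact: tr_mod tr _ _.
apply/seteqP; split=> t; rewrite -gx.
  move=> [/(vis_sact tr) vx [b]]; rewrite -(autVK g b).
  by move=> /(eqi_spot Dg wg _ (requi_state D g t)) sb; split=> //; exists (g^-1 b)%g.
move=> [vx [b sb]]; split; first exact/(vis_sact tr).
by exists (g b); apply/(eqi_spot Dg wg _ (requi_state D g t)).
Qed.

Lemma no_split3 : {ae P, forall om, forall t y b, 0 < t -> ~ split3 w (open_adj om) t b y}.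
Proof.
apply: (@ae_fst R G P P).
have none : {ae mu P P, forall t, forall r y, ~ spotted w r y t}.
  apply/ae_foralln => r.
  have : {ae mu P P, forall t, forall k y, decode cG k = Some y -> ~ spotted w r y t}.
    apply/ae_foralln => k; case: (decode cG k) => [y|]; last by apply: aeW.
    exists (spotted w r y); split; [exact: spotted_measurable|exact: no_spot|].
    by move=> t h; apply: contrapT => n; apply: h => z [<-].
  by apply: filterS => t h y; apply: (h (code cG y)); exact: codeK.
have := ae_good_levels none; apply: filterS => -[om S] /= good t y b t0 sp.
have [t' /andP[t'0 /ltW t't] no] := good t t0; have [r yr] := gdist_ex conn y b.
apply: (no r y); have [ty nyb [x0 [x1 [x2 [[a0 a1 a2] h1 h2 h3]]]]] := sp.
split; first by rewrite /vis /level /= t'0 (le_trans t't ty).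
exists b; split; last by exists b; split=> //; exact: reach_refl.
have arm_le x : arm w (open_adj om) t b y x -> arm w (open_adj om) t' b y x.
  by move=> [? ? inf]; split=> //; apply: infinitely_sub inf => z [? c]; split=> //; exact: contact_le c.
split=> //; first exact: le_trans t't ty.
by exists x0, x1, x2; split=> //; split; exact: arm_le.
Qed.

End NoSplit.

(** * Ergodicity and modifications *)

Section NoMeeting.
Variables (R : realType) (G : sgraph).
Hypotheses (conn : connected_graph G) (lf : locally_finite G).
Variables (w : G -> R) (D : aut G -> R) (os : seq G).
Hypothesis tr : transports w D os.
Variables (p : R) (P : probability (config G) R).
Hypotheses (bP : bernoulli_percolation p P) (p01 : 0 < p < 1).
Implicit Types (a b x y z u v : G) (g : aut G) (e : G * G) (om : config G).
Let cG := countable_vertex conn lf.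

Lemma ae_ex (A : config G -> Prop) : {ae P, forall om, A om} -> exists om, A om.
Proof.
move=> [N [mN N0 AN]]; apply: contrapT => no.
have NT : N = setT by apply/seteqP; split=> // om _; apply: AN => /= h; apply: no; exists om.
by move: N0; rewrite NT probability_setT => /eqP; rewrite onee_eq0.
Qed.

Lemma linked_equi g e f : linked (g e.1, g e.2) (g f.1, g f.2) <-> linked e f.
Proof.
have one (h : aut G) (e' f' : G * G) : linked e' f' -> linked (h e'.1, h e'.2) (h f'.1, h f'.2).
  move=> lnk z; have [u [v [ue vf uz vz uv]]] := lnk (h^-1 z)%g.
  exists (h u), (h v); split.
  - by move: ue; rewrite !inE => /orP[]/eqP->; rewrite eqxx ?orbT.
  - by move: vf; rewrite !inE => /orP[]/eqP->; rewrite eqxx ?orbT.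
  - by apply: contraNneq uz => <-; rewrite autK.
  - by apply: contraNneq vz => <-; rewrite autK.
  - rewrite -(autVK h z); apply/(eqi_reach (g := h) (o := delv adj (h^-1 z)%g)) => //.
    by apply: requi_delv => x y; exact: aut_adj.
split; last exact: one.
by move=> /(one g^-1%g); rewrite /= !autK; case: e f => ? ? [].
Qed.

(** The automorphisms that preserve the block of [e] then move finite sets off each
   other, as the zero-one law requires. *)
Definition rich e : Prop := adj e.1 e.2 /\ forall F : seq G, exists g,
  linked e (g e.1, g e.2) /\ g e.1 \notin F.

(** Infinitely many of the contacts lie in one orbit of oriented edges, and all of
   them are in the same block. *)
Lemma meet_rich (o : rel G) a b : substate o -> meet w o a b -> exists u v,
  [/\ reachable o a u, reachable o b v, adj u v & rich (u, v)].
Proof.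
move=> so [nab [t _ inf]].
pose l := [seq (c, d) | c <- os, d <- nbrs lf c].
pose Q (c : G * G) x := exists g, [/\ adj c.1 c.2, x = g c.1, reachable o a (g c.1) & reachable o b (g c.2)].
have [|c cl infc] := @infinitely_split _ _ l _ Q inf.
  move=> x [ax _ [y [xy _ bY]]]; have [c cos [g gc]] := tr_orbit tr x.
  have cy : adj c (g^-1 y)%g by rewrite -(aut_adj g) autVK gc.
  exists (c, (g^-1 y)%g); last by exists g; rewrite /= autVK gc.
  by apply/allpairsPdep; exists c, (g^-1 y)%g; split=> //; exact: nbrsP.
have [_ _ [h [c12 _ ah bh]]] := infc [::].
exists (h c.1), (h c.2); rewrite aut_adj; split=> //; split; first by rewrite /= aut_adj.
move=> F; have [x xF [g [_ xg ag bg]]] := infc F.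
exists (g * h^-1)%g; rewrite /= ?mulaE !autK -xg; split=> //.
rewrite xg; apply: (linked_contact (Psi := fun o => substate o) (fun o so => so) so nab ah bh ag bg).
Qed.

Definition pair_at e om := exists a, exists b, meet w (open_adj om) a b /\ exists u, exists v,
  [/\ reachable (open_adj om) a u, reachable (open_adj om) b v, adj u v & linked e (u, v)].

Lemma pair_at_measurable e : measurable [set om | pair_at e om].
Proof.
have mo : mrel (fun om : config G => open_adj om) by exact: mp_open_adj.
change (mp (fun om : config G => pair_at e om)).
apply: mp_ex => // a; apply: mp_ex => // b; apply: mp_and; first exact: (mp_meet conn lf w a b mo).
by apply: mp_ex => // u; apply: mp_ex => // v; apply: mp_and4;
  first [exact: (mp_reach conn lf) | exact: mp_const].
Qed.

Lemma pair_at_act e g om : adj e.1 e.2 -> linked e (g e.1, g e.2) ->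
  pair_at e (act g om) <-> pair_at e om.
Proof.
move=> eadj ge; have Dg := modulus_gt0 tr g e.1.
have wg x : w (g x) = D g * w x by exact: tr_mod tr _ _.
have ho : requi g (open_adj (act g om)) (open_adj om) by move=> x y; exact: act_open.
apply: (eqi_exG (g := g)) => a; apply: (eqi_exG (g := g)) => b; apply: eqi_and.
  exact: (eqi_meet Dg wg ho).
apply: (eqi_exG (g := g)) => u; apply: (eqi_exG (g := g)) => v; apply: eqi_and4.
- exact: eqi_reach.
- exact: eqi_reach.
- by rewrite aut_adj.
have gadj : adj (g e.1) (g e.2) by rewrite aut_adj.
split=> h; last by apply: linked_trans ge _; [|apply/(linked_equi g e (u, v))].
by apply/(linked_equi g e (u, v)); apply: linked_trans (linked_sym ge) h.
Qed.

Lemma rich_far e : rich e -> forall F H : {fset edge G}, exists2 g : aut G,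
  linked e (g e.1, g e.2) & forall f, f \in F -> eact g f \notin H.
Proof.
move=> [eadj far] F H.
have vs_ex (K : seq (edge G)) : exists s : seq G, forall f x, f \in K -> x \in val f -> x \in s.
  elim: K => [|f K [s sP]]; first by exists [::].
  exists (enum_fset (val f) ++ s) => f' x; rewrite inE mem_cat => /orP[/eqP->|fK] xf.
    by apply/orP; left; exact: xf.
  by rewrite (sP _ _ fK xf) orbT.
have [vF vFP] := vs_ex (enum_fset F); have [vH vHP] := vs_ex (enum_fset H).
have [n nP] : exists n, forall x, x \in vF -> gdist_le n e.1 x.
  elim: (vF) => [|x s [n nP]]; first by exists 0%N.
  have [n' [q [pq lq sq]]] := gdist_ex conn e.1 x; exists (maxn n n') => y.
  rewrite inE => /orP[/eqP->|/nP[q' [pq' lq' sq']]].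
    by exists q; split=> //; apply: leq_trans sq (leq_maxr _ _).
  by exists q'; split=> //; apply: leq_trans sq' (leq_maxl _ _).
have [g [ge gF]] := far (flatten [seq ball lf n y | y <- vH]).
exists g => // f fF; apply/negP => gfH; move/negP: gF; apply.
have [x [y [xy fv]]] := edgeP f; have xf : x \in val f by rewrite fv !inE eqxx.
apply/flattenP; exists (ball lf n (g x)).
  by apply: map_f; apply: vHP gfH _; apply/imfsetP; exists x.
by apply: ballP; apply: gdist_sym; apply: aut_gdist; apply: nP; exact: vFP fF xf.
Qed.

Definition update (s : seq (edge G * bool)) om : config G :=
  foldr (fun c om => upd c.1 c.2 om) om s.

Lemma ae_update (A : config G -> Prop) : {ae P, forall om, A om} ->
  {ae P, forall om, forall s, A (update s om)}.
Proof.
move=> aA; have cE : countable [set: edge G * bool].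
  by rewrite -setXTT; apply: countableX; [exact: countable_edge|exact: countableP].
pose cU := countable_seqs cE.
have one s : {ae P, forall om, A (update s om)}.
  elim: s A aA => [//|[e b] s IH] A aA; apply: (IH (fun om => A (upd e b om))).
  exact: (ae_upd bP p01).
have : {ae P, forall om, forall k s, decode cU k = Some s -> A (update s om)}.
  apply/ae_foralln => k; case: (decode cU k) => [s|]; last by apply: aeW.
  by apply: filterS (one s) => om h s' [<-].
by apply: filterS => om h s; apply: (h (code cU s)); exact: codeK.
Qed.

Section Surgery.
Variable Good : config G -> Prop.

(** Requiring all finite modifications to be good makes the family stable under the
   surgery, and by [ae_update] loses only a null set. *)
Definition modifiable (o : rel G) : Prop :=
  exists2 om, forall s, Good (update s om) & open_adj om = o.

Lemma modifiable_sub o : modifiable o -> substate o.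
Proof. by move=> [om _ <-]; exact: open_adj_sub. Qed.

Lemma modifiable_upd om (e : edge G) (b : bool) : (forall s, Good (update s om)) ->
  forall s, Good (update s (upd e b om)).
Proof. by move=> h s; have := h (s ++ [:: (e, b)]); rewrite /update foldr_cat. Qed.

Lemma modifiable_link u v o : modifiable o -> adj u v -> modifiable (link u v o).
Proof.
move=> [om h <-] uv; exists (upd (mkedge uv) true om); last exact: upd_link.
exact: modifiable_upd.
Qed.

Lemma modifiable_cut u v o : modifiable o -> modifiable (cut o u v).
Proof.
move=> mo; have [uv|nuv] := boolP (adj u v).
  have [om h <-] := mo; exists (upd (mkedge uv) false om); last exact: upd_cut.
  exact: modifiable_upd.
rewrite (_ : cut o u v = o)//; apply/funext => x; apply/funext => y; rewrite /cut /=.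
have [oxy|//] := boolP (o x y); have xy := (modifiable_sub mo).2 _ _ oxy.
apply/negP => /orP[]/andP[/eqP xu /eqP yv]; move: xy; rewrite xu yv ?(negbTE nuv)//.
by rewrite adj_sym (negbTE nuv).
Qed.

Lemma modifiable_delv y o : modifiable o -> modifiable (delv o y).
Proof.
move=> mo; pose cuts s := foldr (fun z o => cut o y z) o s.
have mc s : modifiable (cuts s) by elim: s => //= z s; exact: modifiable_cut.
rewrite (_ : delv o y = cuts (nbrs lf y)); first exact: mc.
have cE s u v : cuts s u v = o u v && ~~ ((u == y) && (v \in s) || (u \in s) && (v == y)).
  elim: s => [|z s IH] /=; first by rewrite !in_nil andbF andbT.
  rewrite -[LHS]/(cuts s u v && ~~ ((u == y) && (v == z) || (u == z) && (v == y))).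
  rewrite IH !inE -andbA -negb_or; congr (_ && ~~ _).
  by case: (u \in s); case: (v \in s); case: (u == y); case: (v == y); case: (u == z); case: (v == z).
apply/funext => u; apply/funext => v; rewrite cE.
have [ouv|/negbTE nouv] := boolP (o u v); last by rewrite /delv /= nouv.
have uv := (modifiable_sub mo).2 _ _ ouv; rewrite /delv /= ouv /= negb_or !negb_and.
have [uy|nuy] := eqVneq u y => /=.
  by apply/esym/negbTE; rewrite negb_and negb_or !negbK nbrsP ?orbT//= -uy.
have [vy|nvy] := eqVneq v y => /=; last by rewrite orbT.
by rewrite orbF nbrsP//= -vy adj_sym.
Qed.

Lemma modifiable_close B o : modifiable o -> modifiable (close B o).
Proof.
move=> mo; elim: B => [|y B IH].
  rewrite (_ : close [::] o = o)//; apply/funext => u; apply/funext => v.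
  by rewrite /close /= ?in_nil ?andbT.
rewrite (_ : close (y :: B) o = delv (close B o) y); first exact: modifiable_delv.
apply/funext => u; apply/funext => v; rewrite /close /delv /= !inE !negb_or.
by case: (o u v); case: (u == y); case: (v == y); rewrite /= ?andbF ?andbT.
Qed.

End Surgery.

(** Otherwise pairs at some edge [e] have positive probability, hence probability one
   by the zero-one law for the automorphisms that preserve the block of [e]. So
   almost every configuration and its modifications satisfy all assumptions of
   [surgery_contradiction]. *)
Lemma no_meet : {ae P, forall om, forall a b, ~ meet w (open_adj om) a b}.
Proof.
have cGG : countable [set: G * G] by rewrite -setXTT; apply: countableX.
apply: contrapT => nae.
have [e [re ne]] : exists e, rich e /\ P [set om | pair_at e om] <> 0%E.
  apply: contrapT => no; apply: nae.
  have : {ae P, forall om, forall k e, decode cGG k = Some e -> rich e -> ~ pair_at e om}.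
    apply/ae_foralln => k; case: (decode cGG k) => [e|]; last by apply: aeW.
    have [re|nre] := pselect (rich e); last by apply: aeW => om e' [<-].
    exists [set om | pair_at e om]; split; first exact: pair_at_measurable.
      by apply: contrapT => n0; apply: no; exists e.
    by move=> om h; apply: contrapT => npa; apply: h => e' [<-] _.
  apply: filterS => om h a b ab.
  have [u [v [au bv uv ruv]]] := meet_rich (open_adj_sub om) ab.
  apply: (h (code cGG (u, v)) (u, v) (codeK _ _) ruv); exists a, b; split=> //; exists u, v; split=> //.
  by have := linked_contact (Psi := fun o => substate o) (fun o so => so) (open_adj_sub om) ab.1 au bv au bv.
have eadj := re.1.
have P1 : P [set om | pair_at e om] = 1%E.
  have [] // := zero_one bP (pair_at_measurable e)
    (Gam := fun g => linked e (g e.1, g e.2)) _ (rich_far re).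
  move=> g ge; apply/seteqP; split=> om /=; first by move/(pair_at_act om eadj ge).
  by move=> h; exact/(pair_at_act om eadj ge).
have pair_ae : {ae P, forall om, pair_at e om}.
  exists (~` [set om | pair_at e om]); split.
  - by apply: measurableC; exact: pair_at_measurable.
  - by rewrite probability_setC ?P1 ?subee//; exact: pair_at_measurable.
  - by move=> om.
pose Good om := [/\ forall t y b, 0 < t -> ~ split3 w (open_adj om) t b y,
  forall m x0 x1, meet w (open_adj om) x0 m -> meet w (open_adj om) x1 m ->
    ~ reachable (open_adj om) x0 x1 -> reachable (off (open_adj om) m) x0 x1 ->
    (exists u v, [/\ reachable (open_adj om) x0 u, reachable (open_adj om) x1 v & adj u v]) ->
    (forall x, meet w (open_adj om) x m -> reachable (off (open_adj om) m) x0 x ->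
      reachable (open_adj om) x0 x \/ reachable (open_adj om) x1 x) ->
    meet w (open_adj om) x0 x1 & pair_at e om].
have good_ae : {ae P, forall om, Good om}.
  have := no_split3 conn lf tr bP p01; have := no_selection conn lf tr bP.
  by apply: filterS3 pair_ae => om h1 h2 h3; split.
have [om gom] := ae_ex (ae_update good_ae).
have now o : modifiable Good o -> exists2 om', Good om' & open_adj om' = o.
  by move=> [om' h <-]; exists om' => //; exact: (h [::]).
apply: (@surgery_contradiction R G w lf (tr_pos tr) (modifiable Good) (@modifiable_sub Good)
  (fun B o => @modifiable_close Good B o) (fun u v o => @modifiable_link Good u v o)
  _ _ conn e eadj _ (open_adj om)).
- by move=> o /now[om' [h _ _] <-].
- by move=> o /now[om' [_ h _] <-].
- by move=> o /now[om' [_ _ h] <-].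
- by exists om.
Qed.

End NoMeeting.

Section Degenerate.
Variables (R : realType) (G : sgraph).
Hypotheses (conn : connected_graph G) (lf : locally_finite G).
Variables (p : R) (P : probability (config G) R).
Hypothesis bP : bernoulli_percolation p P.

Lemma ae_edges (A : edge G -> config G -> Prop) : (forall e, {ae P, forall om, A e om}) ->
  {ae P, forall om, forall e, A e om}.
Proof.
move=> h; pose cE := countable_edge conn lf.
have : {ae P, forall om, forall k e, decode cE k = Some e -> A e om}.
  apply/ae_foralln => k; case: (decode cE k) => [e|]; last by apply: aeW.
  by apply: filterS (h e) => om he e' [<-].
by apply: filterS => om he e; apply: (he (code cE e)); exact: codeK.
Qed.

Lemma ae_all_open : p = 1 -> {ae P, forall om : config G, forall e : edge G, om e = true}.
Proof.
move=> p1; apply: ae_edges => e; exists (~` open_event e); split.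
- by apply: measurableC; exact: open_event_measurable.
- by rewrite probability_setC ?(P_open bP) ?p1 ?subee//; exact: open_event_measurable.
- by move=> om; rewrite /open_event /=; case: (om e).
Qed.

Lemma ae_all_closed : p = 0 -> {ae P, forall om : config G, forall e : edge G, om e = false}.
Proof.
move=> p0; apply: ae_edges => e; exists (open_event e); split.
- exact: open_event_measurable.
- by rewrite (P_open bP) p0.
- by move=> om; rewrite /open_event /=; case: (om e).
Qed.

End Degenerate.

Theorem theorem1p2 (R : realType) (G : sgraph)
  (G_connected : connected_graph G) (G_lf : locally_finite G)
  (G_qt : quasi_transitive G) (G_nonunimodular : ~ unimodular R G)
  (m : {measure set (borel_aut G) -> \bar R}) (m_haar : haar_measure m)
  (x0 : G) (p : R) (p01 : 0 <= p <= 1)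
  (P : probability (config G) R) (P_bernoulli : bernoulli_percolation p P) :
  {ae P, forall omega : config G, forall C C' : set G,
    is_cluster omega C -> is_cluster omega C' -> C <> C' ->
    heavy m x0 C -> heavy m x0 C' ->
    light m x0 [set x | C x /\ exists2 y, C' y & gdist_le 1 x y]}.
Proof.
(* [fine] of an infinite value is zero, and then so are all relative weights *)
have [w00|w0] := eqVneq (fine (m (stabilizer x0))) 0.
  apply: aeW => om C C' _ _ _ _ _; rewrite /light esum1 ?ltry// => y _.
  by rewrite /rel_weight w00 invr0 mulr0.
have fx0 : (m (stabilizer x0) < +oo)%E.
  by rewrite ltey; apply: contra_neq w0 => ->.
have tr : transports (weight m) (modulus m x0) (reps G_qt x0).
  split.
  - exact: weight_pos fx0.
  - exact: weight_modulus fx0.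
  - by move=> f f0 fE a; exact: (mass_transport_out G_connected G_lf G_qt m_haar fx0 a f0 fE).
  - by move=> f f0 fE; exact: (mass_transport_reps G_connected G_lf G_qt m_haar fx0 f0 fE).
  - by move=> x; exists (orbit_rep x0 x); [exact: reps_mem|exact: orbit_repP].
  - by move=> r; have [n nP] := ball_bound G_lf G_qt x0 r; exists n.
  - exact: (weight_adj G_connected G_lf G_qt m_haar fx0).
have reach_cluster om x y : cluster_of om x <> cluster_of om y -> ~ reachable (open_adj om) x y.
  move=> ne xy; apply: ne; have [so _] := open_adj_sub om.
  apply/seteqP; split=> z; last exact: reach_trans xy.
  by move=> xz; apply: reach_trans (reach_sym so xy) xz.
have [p0|pn0] := eqVneq p 0.
  have := ae_all_closed G_connected G_lf P_bernoulli p0; apply: filterS => om closed C C' [x ->] _ _ hx _.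
  suff fin : finite_set (cluster_of om x).
    move: hx; rewrite /heavy esum_fset//; last first.
      by move=> y _; rewrite lee_fin divr_ge0// fine_ge0.
    by rewrite fsbig_finite//= sumEFin.
  apply: (sub_finite_set _ (finite_set1 x)) => y [s + <-]; case: s => [//|z s] /= /andP[/asboolP[e _ oe]].
  by have := closed e; rewrite oe.
have [p1|pn1] := eqVneq p 1.
  have := ae_all_open G_connected G_lf P_bernoulli p1; apply: filterS => om opn C C' [x ->] [y ->] /reach_cluster[].
  have := G_connected x y; apply: reach_mono => u v uv; by rewrite (open_adjP om uv).
have p01' : 0 < p < 1 by have [h1 h2] := andP p01; rewrite !lt_neqAle h1 h2 eq_sym pn0 pn1.
have := heavy_meet G_connected G_lf tr P_bernoulli; have := no_meet G_connected G_lf tr P_bernoulli p01'.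
apply: filterS2 => om nomeet hmeet C C' [x ->] [y ->] /reach_cluster nxy _ _.
rewrite /light ltey; apply/eqP => inf; apply: (nomeet x y); apply: hmeet => //.
have wx : 0 < (weight m x0)^-1 by rewrite invr_gt0; exact: tr_pos tr x0.
apply/eqP; rewrite -leye_eq; set S := [set z | _] in inf.
have SE : (\esum_(z in S) (weight m z)%:E = +oo)%E.
  move: inf; rewrite esum_mkcond (_ : \esum_(z in [set: G]) _ = \esum_(z in [set: G])
      (((weight m x0)^-1)%:E * (if z \in S then (weight m z)%:E else 0)))%E; last first.
    by apply: eq_esum => z _; case: ifP => _; rewrite ?mule0// -EFinM mulrC.
  rewrite (esumZ (countable_vertex G_connected G_lf) (ltW wx)); last first.
    by move=> z; case: ifP => _ //; rewrite lee_fin ltW// (tr_pos tr).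
  rewrite -esum_mkcond; case: (\esum_(_ in _) _)%E => [r| |] //.
  by rewrite mulrNy gtr0_sg ?mul1e.
rewrite -SE esum_mkcond [leRHS]esum_mkcond; apply: le_esum => z _.
case: ifPn => [|_]; last by case: ifP => _ //; rewrite lee_fin ltW// (tr_pos tr).
rewrite inE => -[xz [y' yy' [s [ps ls ss]]]]; rewrite ifT//; rewrite inE; split=> //.
exists y'; split=> //; case: s ps ls ss => [|u [|//]] /=.
  by move=> _ zy; case: nxy; apply: reach_trans xz _; rewrite zy; apply: reach_sym yy'; exact: (open_adj_sub om).1.
by rewrite andbT => zu <-.
Qed.
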